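(* Let $\{g_{m,T}\}_{m\in\mathbb{Z}^d,T\in\mathcal{T}}$ be a painless NSGF with associated structured covering $\mathcal{Q}=\{Q_T\}_{T\in\mathcal{T}}$ and weight function $\{\omega_T\}_{T\in\mathcal{T}}=\{1+\|a_T\|_2\}_{T\in\mathcal{T}}$. Given $s\in\mathbb{R}$ and $1\le q<\infty$, the reconstruction operator $$R\big(\{c_{m,T}\}_{m\in\mathbb{Z}^d,T\in\mathcal{T}}\big)=\sum_{T\in\mathcal{T}}\sum_{m\in\mathbb{Z}^d}c_{m,T}\,\tilde g_{m,T}$$ is bounded from $d(\mathcal{Q},\ell^2,\ell^q_{\omega^s})$ onto $D(\mathcal{Q},L^2,\ell^q_{\omega^s})$, and, with $C$ denoting the coefficient operator $C(f)=\{\langle f,g_{m,T}\rangle\}_{m,T}$, we have the expansions $$f=RC(f)=\sum_{m\in\mathbb{Z}^d,T\in\mathcal{T}}\langle f,g_{m,T}\rangle\,\tilde g_{m,T},\qquad f\in D(\mathcal{Q},L^2,\ell^q_{\omega^s}),$$ with unconditional convergence (in $D(\mathcal{Q},L^2,\ell^q_{\omega^s})$).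
   Context: Painless NSGF (nonstationary Gabor frame). Let $\{g_n\}_{n\in\mathbb{Z}^d}\subset L^2(\mathbb{R}^d)$ be window functions with frequency sampling steps $b_n>0$ and points $a_n\in\mathbb{R}^d$ such that $\mathrm{supp}(g_n)\subseteq[0,\frac1{b_n}]^d+a_n$ for all $n$. Put $g_{m,n}(x):=g_n(x)e^{2\pi i m b_n\cdot x}$, $m,n\in\mathbb{Z}^d$. The system $\{g_{m,n}\}$ is an NSGF if it is a frame for $L^2(\mathbb{R}^d)$; under the support condition this is equivalent to the existence of $0<A\le B<\infty$ with $A\le G(x):=\sum_{n\in\mathbb{Z}^d}b_n^{-d}|g_n(x)|^2\le B$ for a.e. $x$. In that case the frame operator is multiplication by $G$ and the canonical dual frame is $\tilde g_{m,n}(x)=\frac{g_n(x)}{G(x)}e^{2\pi i m b_n\cdot x}$. The system is called a painless NSGF if in addition: (1) there are $C_*>0$ and $n_0\in\mathbb{N}$ such that the open cubes $I_n:=(-\varepsilon_n,\frac1{b_n}+\varepsilon_n)^d+a_n$, $\varepsilon_n:=C_*/b_n$, satisfy $|\{n'\in\mathbb{Z}^d: I_{n'}\cap I_n\ne\emptyset\}|\le n_0$ for all $n$; (2) $\{a_n\}_{n\in\mathbb{Z}^d}$ is $\delta$-separated (i.e. $\inf_{n\ne n'}\|a_n-a_{n'}\|_2=\delta>0$) and $\{1+\|a_n\|_2\}_{n\in\mathbb{Z}^d}$ is an $\{I_n\}$-moderate weight, meaning that there is a constant $C>0$ with $1+\|x\|_2\le C(1+\|y\|_2)$ for all $x,y\in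 I_n$ and all $n$; (3) the $g_n$ are continuous, real valued, and $g_n(x)\le C b_n^{d/2}\chi_{I_n}(x)$ for all $n$ and $x$, with a uniform constant $C>0$. Associated covering. With $Q:=(0,1)^d$ and the affine maps $T_n x:=(2\varepsilon_n+\frac1{b_n})x+c_n$, $(c_n)_j:=-\varepsilon_n+(a_n)_j$, let $\mathcal{T}:=\{T_n\}_{n\in\mathbb{Z}^d}$ and $Q_{T_n}:=T_n(Q)=I_n$. Then $\mathcal{Q}:=\{Q_T\}_{T\in\mathcal{T}}=\{I_n\}_{n\in\mathbb{Z}^d}$ is the associated (structured) covering of $\mathbb{R}^d$. Indices $n$ and $T=T_n$ are identified: $g_{m,T}:=g_{m,n}$, $\tilde g_{m,T}:=\tilde g_{m,n}$, $a_T:=a_n$, $b_T:=b_n$, $\omega_T:=1+\|a_n\|_2$. Spaces. A BAPU subordinate to $\mathcal{Q}$ is a family of non-negative $\{\psi_T\}_{T\in\mathcal{T}}\subset C_c^\infty(\mathbb{R}^d)$ with $\mathrm{supp}(\psi_T)\subset Q_T$ and $\sum_T\psi_T\equiv1$ on $\mathbb{R}^d$; fix one (different choices give equivalent norms below). For $s\in\mathbb{R}$, $1\le p,q\le\infty$: $\|\{a_T\}\|_{\ell^q_{\omega^s}}:=\|\{\omega_T^sa_T\}_{T\in\mathcal{T}}\|_{\ell^q}$; the decomposition space $D(\mathcal{Q},L^p,\ell^q_{\omega^s})$ is the set of $f\in\mathcal{S}'(\mathbb{R}^d)$ with $\|f\|_{D(\mathcal{Q},L^p,\ell^q_{\omega^s})}:=\big\|\{\|\psi_Tf\|_{L^p}\}_{T}\big\|_{\ell^q_{\omega^s}}<\infty$;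 the sequence space $d(\mathcal{Q},\ell^p,\ell^q_{\omega^s})$ is the set of $\{c_{m,T}\}_{m\in\mathbb{Z}^d,T\in\mathcal{T}}\subset\mathbb{C}$ with $\|\{c_{m,T}\}\|_{d(\mathcal{Q},\ell^p,\ell^q_{\omega^s})}:=\big\|\{\|\{c_{m,T}\}_{m\in\mathbb{Z}^d}\|_{\ell^p}\}_{T\in\mathcal{T}}\big\|_{\ell^q_{\omega^s}}<\infty$. Pairing: $\langle f,g_{m,T}\rangle=\int_{\mathbb{R}^d}f(x)\overline{g_{m,T}(x)}\,dx$, which makes sense for $f\in D(\mathcal{Q},L^2,\ell^q_{\omega^s})$ since such $f$ is locally in $L^2$ and $g_{m,T}$ is bounded with compact support. The coefficient operator $C$ is bounded from $D(\mathcal{Q},L^2,\ell^q_{\omega^s})$ into $d(\mathcal{Q},\ell^2,\ell^q_{\omega^s})$ for $1\le q<\infty$. *)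

(* Defs.v *)
From HB Require Import structures.
From mathcomp Require Import all_boot all_order all_algebra finmap.
From mathcomp Require Import all_classical all_reals all_analysis.
From mathcomp Require Import summability.
From mathcomp Require Import complex.

Set Implicit Arguments.
Unset Strict Implicit.
Unset Printing Implicit Defensive.
Import Order.TTheory GRing.Theory Num.Theory.
Import numFieldNormedType.Exports.

Local Open Scope classical_set_scope.
Local Open Scope complex_scope.
Local Open Scope ring_scope.

Definition rV_display : measure_display. Proof. exact. Qed.

Section rV_measurable.
Variables (R : realType) (d : nat).

Let coord (i : 'I_d) (x : 'rV[R]_d) : measurableTypeR R := x ord0 i.

Let rV_set0 : g_sigma_preimage coord set0.
Proof. exact: sigma_algebra0. Qed.

Let rV_setC A : g_sigma_preimage coord A -> g_sigma_preimage coord (~` A).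
Proof. exact: sigma_algebraC. Qed.

Let rV_bigcup (F : _^nat) : (forall i, g_sigma_preimage coord (F i)) ->
  g_sigma_preimage coord (\bigcup_i (F i)).
Proof. exact: sigma_algebra_bigcup. Qed.

HB.instance Definition _ := @isMeasurable.Build rV_display
  'rV[R]_d (g_sigma_preimage coord) rV_set0 rV_setC rV_bigcup.

Lemma measurable_coord (i : 'I_d) :
  measurable_fun [set: 'rV[R]_d] (coord i).
Proof.
move=> _ Y mY; rewrite setTI; apply: sub_sigma_algebra => /=.
rewrite -bigcup_seq/=; exists i => /=; first by rewrite mem_index_enum.
by exists Y => //; rewrite setTI.
Qed.

Lemma measurable_fun_rV d' (T : measurableType d') (f : T -> 'rV[R]_d) :
  (forall i, measurable_fun [set: T] (coord i \o f)) ->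
  measurable_fun [set: T] f.
Proof.
move=> mf; suff H : g_sigma_preimage (fun i => coord i \o f) `<=` measurable.
  by move=> _ A mA; apply: H; rewrite g_sigma_preimage_comp; exists A.
apply: smallest_sub; first exact: sigma_algebra_measurable.
rewrite -bigcup_seq; apply: bigcup_sub => i _.
by move=> A [B mB <-]; exact: mf.
Qed.

End rV_measurable.

Section rV_lebesgue_step.
Variables (R : realType) (d : nat).

Definition rV_cons (p : measurableTypeR R * 'rV[R]_d) : 'rV[R]_d.+1 :=
  \row_i oapp (fun j => p.2 ord0 j) p.1 (unlift ord0 i).

Definition rV_uncons (x : 'rV[R]_d.+1) : measurableTypeR R * 'rV[R]_d :=
  (x ord0 ord0, \row_i x ord0 (lift ord0 i)).

Lemma rV_consK : cancel rV_cons rV_uncons.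
Proof.
move=> [u v]; rewrite /rV_uncons; congr pair; first by rewrite mxE unlift_none.
by apply/rowP => i; rewrite !mxE liftK.
Qed.

Lemma measurable_rV_cons : measurable_fun setT rV_cons.
Proof.
apply: measurable_fun_rV => i; have [j ij|i0] := unliftP ord0 i.
  rewrite (_ : _ \o _ =
    (fun x : 'rV[R]_d => x ord0 j : measurableTypeR R) \o snd).
    by apply: measurableT_comp => //; exact: measurable_coord.
  by apply/funext => p; rewrite /= mxE ij liftK.
rewrite (_ : _ \o _ = fst)//; apply/funext => p.
by rewrite /= mxE i0 unlift_none.
Qed.

Lemma measurable_rV_uncons : measurable_fun setT rV_uncons.
Proof.
apply/measurable_fun_pairP; split; first exact: (@measurable_coord R d.+1 ord0).
apply: measurable_fun_rV => i.
rewrite (_ : _ \o _ =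
  fun x : 'rV[R]_d.+1 => x ord0 (lift ord0 i) : measurableTypeR R).
  exact: measurable_coord.
by apply/funext => x /=; rewrite mxE.
Qed.

Variable nu : {sigma_finite_measure set 'rV[R]_d -> \bar R}.

Definition rV_lebesgue_step : set 'rV[R]_d.+1 -> \bar R :=
  pushforward (lebesgue_measure \x nu)%E rV_cons.

Let step0 : rV_lebesgue_step set0 = 0%E.
Proof. by rewrite /rV_lebesgue_step /pushforward preimage_set0 measure0. Qed.

Let step_ge0 A : (0 <= rV_lebesgue_step A)%E.
Proof. by rewrite /rV_lebesgue_step /pushforward; exact: measure_ge0. Qed.

Let step_sigma_additive : semi_sigma_additive rV_lebesgue_step.
Proof.
move=> F mF tF mUF; rewrite /rV_lebesgue_step /pushforward preimage_bigcup.
apply: measure_semi_sigma_additive.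
- by move=> n; rewrite -[X in measurable X]setTI; exact: measurable_rV_cons.
- apply/trivIsetP => /= i j _ _ ij; rewrite -preimage_setI.
  by move/trivIsetP : tF => /(_ _ _ _ _ ij) ->//; rewrite preimage_set0.
- by rewrite -preimage_bigcup -[X in measurable X]setTI;
    exact: measurable_rV_cons.
Qed.

HB.instance Definition _ := isMeasure.Build _ _ _ rV_lebesgue_step
  step0 step_ge0 step_sigma_additive.

Let step_sigma_finite : sigma_finite setT rV_lebesgue_step.
Proof.
have /sigma_finiteP[F [FT ndF Foo]] := sigma_finiteT (@lebesgue_measure R).
have /sigma_finiteP[G [GT ndG Goo]] := sigma_finiteT nu.
exists (fun n => rV_uncons @^-1` (F n `*` G n)).
  rewrite -preimage_bigcup (_ : \bigcup_n _ = setT) ?preimage_setT//.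
  apply/seteqP; split=> // -[x y] _.
  have [k _ Fkx] : (\bigcup_k F k) x by rewrite -FT.
  have [l _ Gly] : (\bigcup_k G k) y by rewrite -GT.
  exists (maxn k l) => //; split.
    by move: x Fkx; exact/subsetPset/ndF/leq_maxl.
  by move: y Gly; exact/subsetPset/ndG/leq_maxr.
move=> n; have [mF Fn] := Foo n; have [mG Gn] := Goo n; split.
  rewrite -[X in measurable X]setTI; apply: measurable_rV_uncons => //.
  exact: measurableX.
rewrite /rV_lebesgue_step /pushforward -comp_preimage.
rewrite (_ : rV_uncons \o rV_cons = id) ?preimage_id; last first.
  by apply/funext => p; exact: rV_consK.
by rewrite product_measure1E// lte_mul_pinfty// ge0_fin_numE.
Qed.

HB.instance Definition _ := Measure_isSigmaFinite.Build _ _ _ rV_lebesgue_step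
  step_sigma_finite.

End rV_lebesgue_step.

(* Lebesgue measure on R^d, as a d-fold product of the Lebesgue measure on R;
   the base case is the Dirac mass at the only point of R^0. *)
Fixpoint rV_lebesgue (R : realType) (d : nat) :
    {sigma_finite_measure set 'rV[R]_d -> \bar R} :=
  match d with
  | 0 => \d_(0 : 'rV[R]_0)
  | d'.+1 => rV_lebesgue_step (rV_lebesgue R d')
  end.

Section function_spaces.
Variables (R : realType) (d : nat).
Local Notation E := 'rV[R]_d.
Local Notation mu := (rV_lebesgue R d).
Local Notation cabs := (@Normc.normc R).
Implicit Types (h phi : E -> R[i]) (u v : (E -> R[i]) -> R[i]).

Definition enorm (x : E) : R := Num.sqrt (\sum_i x ord0 i ^+ 2).

Definition supp (V : zmodType) (f : E -> V) : set E :=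
  closure [set x | f x != 0].

Definition cRe h (x : E) : R := complex.Re (h x).
Definition cIm h (x : E) : R := complex.Im (h x).

Definition cmeasurable h :=
  measurable_fun setT (cRe h) /\ measurable_fun setT (cIm h).

Definition cint h : R[i] :=
  Rintegral mu setT (cRe h) +i* Rintegral mu setT (cIm h).

Definition LpN (p : R) h : \bar R :=
  Lnorm mu p%:E (fun x => (cabs (h x))%:E).

Definition inLp (p : R) h := cmeasurable h /\ (LpN p h < +oo)%E.

Definition inL2loc h := cmeasurable h /\
  forall K : set E, compact K ->
    (\int[mu]_(x in K) (cabs (h x) ^+ 2)%:E < +oo)%E.

(* [inner h k] is linear in h and conjugate-linear in k. *)
Definition inner h k : R[i] := cint (fun x => h x * (k x)^*).

(* Iterated partial derivatives: the multi-index is given as the list of the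
   coordinates along which one differentiates. *)
Definition partials (s : seq 'I_d) (f : E -> R) : E -> R :=
  foldr (fun i (k : E -> R) x => 'D_(delta_mx ord0 i) k x) f s.

Definition cpartials (s : seq 'I_d) h : E -> R[i] :=
  fun x => partials s (cRe h) x +i* partials s (cIm h) x.

(* All iterated partial derivatives exist and are differentiable (hence
   continuous), i.e., f is C^oo. *)
Definition smooth (f : E -> R) :=
  forall (s : seq 'I_d) (x : E), differentiable (partials s f) x.

Definition csmooth h := smooth (cRe h) /\ smooth (cIm h).

Definition test_function h := csmooth h /\ compact (supp h).

Definition schwartz_norm (k : nat) h : \bar R :=
  ereal_sup [set ((1 + enorm x) ^+ k * cabs (cpartials s h x))%:E |
             x in [set: E] & s in [set s : seq 'I_d | (size s <= k)%N]].

Definition schwartz h :=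
  csmooth h /\ forall k : nat, (schwartz_norm k h < +oo)%E.

(* A tempered distribution is represented by a functional on all functions, of
   which only the values on the Schwartz space are relevant; two functionals
   denote the same tempered distribution when they satisfy [eq_dist]. *)
Definition tempered u :=
  (forall (c : R[i]) phi psi, schwartz phi -> schwartz psi ->
     u (fun x => c * phi x + psi x) = c * u phi + u psi) /\
  exists (k : nat) (M : R), forall phi, schwartz phi ->
     ((cabs (u phi))%:E <= M%:E * schwartz_norm k phi)%E.

Definition eq_dist u v := forall phi, schwartz phi -> u phi = v phi.

Definition dist_of h : (E -> R[i]) -> R[i] :=
  fun phi => cint (fun x => h x * phi x).

Definition dist_scale (c : R[i]) u : (E -> R[i]) -> R[i] :=
  fun phi => c * u phi.

Definition dist_mul (f : E -> R) u : (E -> R[i]) -> R[i] :=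
  fun phi => u (fun x => (f x)%:C * phi x).

(* The L^p norm of a distribution: that of any function in L^p representing it
   (they are all equal almost everywhere), and +oo when there is none. *)
Definition dist_LpN (p : R) u : \bar R :=
  ereal_inf [set LpN p h | h in [set h | inLp p h /\ eq_dist u (dist_of h)]].

(* The locally square integrable function, unique up to null sets, that agrees
   with u on test functions. *)
Definition L2loc_repr u : E -> R[i] :=
  xget (fun=> 0) [set h | inL2loc h /\
    forall phi, test_function phi -> u phi = dist_of h phi].

Definition dist_inner u h : R[i] := inner (L2loc_repr u) h.

End function_spaces.

(* The l^q norm of a non-negative family, for a finite exponent q. *)
Definition lqN (R : realType) (I : choiceType) (q : R) (x : I -> \bar R) :
    \bar R :=
  ((\esum_(i in [set: I]) (x i `^ q)) `^ q^-1)%E.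

Section painless.
Variables (R : realType) (d : nat).
Local Notation E := 'rV[R]_d.
Local Notation Z := 'rV[int]_d.
Local Notation cabs := (@Normc.normc R).

Variables (g : Z -> E -> R) (a : Z -> E) (b : Z -> R).

Definition modulation (m n : Z) (x : E) : R[i] :=
  let t := 2 * pi * b n * \sum_i (m ord0 i)%:~R * x ord0 i in
  cos t +i* sin t.

Definition gmod (m n : Z) (x : E) : R[i] := (g n x)%:C * modulation m n x.

Definition NSGF :=
  [/\ forall n, 0 < b n,
      forall n, inLp 2 (fun x => (g n x)%:C),
      forall n, supp (g n) `<=`
        [set x | forall i, 0 <= x ord0 i - a n ord0 i <= (b n)^-1] &
      exists A B : R, 0 < A /\
        forall f : E -> R[i], inLp 2 f ->
          (A%:E * LpN 2 f ^+ 2 <=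
             \esum_(k in [set: Z * Z])
                (cabs (inner f (gmod k.1 k.2)) ^+ 2)%:E <=
           B%:E * LpN 2 f ^+ 2)%E].

Definition Gfun (x : E) : R :=
  fine (\esum_(n in [set: Z]) (b n ^- d * `|g n x| ^+ 2)%:E)%E.

Definition gdual (m n : Z) (x : E) : R[i] :=
  (g n x / Gfun x)%:C * modulation m n x.

Variable Cs : R.

(* The open cube I_n = Q_{T_n}, with eps_n = Cs / b_n. *)
Definition cube (n : Z) : set E :=
  [set x | forall i,
     - (Cs / b n) < x ord0 i - a n ord0 i < (b n)^-1 + Cs / b n].

Definition omega (n : Z) : R := 1 + enorm (a n).

Definition painless_NSGF :=
  NSGF /\
  [/\ 0 < Cs /\ exists n0 : nat, forall n : Z,
        ([set n' : Z | cube n' `&` cube n !=set0] #<= `I_n0)%card,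
      0 < inf [set enorm (a p.1 - a p.2) | p in [set p : Z * Z | p.1 != p.2]],
      exists C : R, 0 < C /\ forall n x y, cube n x -> cube n y ->
        1 + enorm x <= C * (1 + enorm y) &
      (forall n, continuous (g n)) /\
      exists C : R, 0 < C /\ forall n x,
        g n x <= C * b n `^ (d%:R / 2) * \1_(cube n) x].

Definition BAPU (psi : Z -> E -> R) :=
  [/\ forall n x, 0 <= psi n x,
      forall n, smooth (psi n),
      forall n, compact (supp (psi n)) /\ supp (psi n) `<=` cube n &
      forall x, (\esum_(n in [set: Z]) (psi n x)%:E)%E = 1%E].

Definition DN (psi : Z -> E -> R) (p q s : R) (u : (E -> R[i]) -> R[i]) :
    \bar R :=
  lqN q (fun n => (omega n `^ s)%:E * dist_LpN p (dist_mul (psi n) u))%E.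

Definition inD psi (p q s : R) (u : (E -> R[i]) -> R[i]) :=
  tempered u /\ (DN psi p q s u < +oo)%E.

Definition dN (p q s : R) (c : Z -> Z -> R[i]) : \bar R :=
  lqN q (fun n => (omega n `^ s)%:E * lqN p (fun m => (cabs (c m n))%:E))%E.

Definition ind (p q s : R) (c : Z -> Z -> R[i]) := (dN p q s c < +oo)%E.

Definition coef (u : (E -> R[i]) -> R[i]) : Z -> Z -> R[i] :=
  fun m n => dist_inner u (gmod m n).

(* The series sum_{m,n} c_{m,n} gdual_{m,n} converges unconditionally to u in
   the norm of D: convergence of the net of its finite partial sums. *)
Definition expansion psi (p q s : R) (c : Z -> Z -> R[i])
    (u : (E -> R[i]) -> R[i]) :=
  DN psi p q s (u - partial_sum
    (fun k : Z * Z => dist_scale (c k.1 k.2) (dist_of (gdual k.1 k.2))) F)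
  @[F --> totally] --> 0%E.

(* The reconstruction operator: c is mapped to the sum, in D, of its series. *)
Definition recon psi (p q s : R) (c : Z -> Z -> R[i]) : (E -> R[i]) -> R[i] :=
  xget (fun=> 0) [set u | inD psi p q s u /\ expansion psi p q s c u].

End painless.

(* Main.v *)
Require Import Defs.
From HB Require Import structures.
From mathcomp Require Import all_boot all_order all_algebra finmap.
From mathcomp Require Import all_classical all_reals all_analysis.
From mathcomp Require Import measurable_realfun summability.
From mathcomp Require Import complex ring lra.

Set Implicit Arguments.
Unset Strict Implicit.
Unset Printing Implicit Defensive.
Import Order.TTheory GRing.Theory Num.Theory.
Import numFieldNormedType.Exports.

Local Open Scope classical_set_scope.
Local Open Scope complex_scope.
Local Open Scope ring_scope.

(** The support condition makes everything local. On the box of corner a_n and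
    side 1/b_n, which carries g_n, the functions e_(m,n)(x) = exp(2 pi i m b_n.x)
    form an orthogonal basis of L^2, so <f, g_(m,n)> is a Fourier coefficient of
    f g_n on that box and Parseval gives
      sum_m |<f, g_(m,n)>|^2 = b_n^-d ||f g_n||^2.
    Testing the frame inequality on indicators of small boxes then yields
    A <= G <= B everywhere ([frame_window]), since G is continuous, and hence
    |g_n|^2 <= B b_n^d.

    Conversely, by the Riesz-Fischer theorem ([riesz_fischer]) a family c with
    square summable rows is realized by functions H_n, supported in these boxes,
    whose coefficients are b_n^-d c_(m,n); as the cubes I_n are locally finite, the
    sum f = sum_n (g_n / G) H_n makes sense pointwise. The relation between c and f
    obtained in this way is called [synth]. It is linear, it relates a unit
    coefficient to a dual atom, so that it is compatible with passing to partial
    sums ([synth_rest]), and it relates the coefficients of f to f because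
    sum_n (g_n / G) b_n^-d g_n f = f ([synth_gcoef]).

    Both directions are bounded by neighbours only: ||psi_n f||^2 is at most a
    constant times the sum, over the cubes I_j that meet I_n, of
    sum_m |c_(m,j)|^2 ([synth_local]), and the coefficients of f are bounded in the
    same way by the ||psi_j f||^2 ([sqc_gcoef]). Every cube has at most n_0
    neighbours, and the weights of neighbours are comparable, so a Schur test
    ([lqw_schur]) turns these local bounds into bounds for the weighted l^q norms.
    Applied to the tails c - c 1_F, which tend to 0 in norm as q is finite
    ([lqw_tail]), the bound for synthesis gives the unconditional convergence.

    What remains is to pass between distributions and functions. An element u of D
    is represented by a function f that is locally in L^2, obtained by gluing the
    representatives of the psi_n u ([L2loc_representation]); conversely, a function
    f for which ||psi_n f|| is bounded by a power of omega_n is a tempered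
    distribution ([tempered_dist_of]), because the a_n are separated and the sum of
    omega_n^(-2d) is finite. Density of the test functions in the Schwartz space
    ([tempered_test_eq]) makes the two passages inverse to each other. Finally, two
    sums in D of the same series agree almost everywhere on each cube
    ([expansion_unique]), so that [recon] yields the distribution of the function
    synthesized from c. *)

(** * Borel sets of R^d and products of integrals *)

Section borel.
Variables (R : realType) (d : nat).
Local Notation E := 'rV[R]_d.

Lemma nbhs_rVP (x : E) (U : set E) :
  nbhs x U <-> exists2 e : R, 0 < e &
    forall y : E, (forall i, `|x ord0 i - y ord0 i| < e) -> U y.
Proof.
split=> [/nbhs_ballP[e /= e0 eU]|[e e0 eU]].
  by exists e => // y xy; apply: eU; split => // i j; rewrite ord1; exact: xy.
by apply/nbhs_ballP; exists e => //= y [_ xy]; apply: eU => i; exact: xy.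
Qed.

(** The sigma-algebra of R^d is generated by the coordinates, and an open set
    is the union of the countably many rational cubes that it contains. *)
Lemma open_measurable_rV (U : set E) : open U -> measurable U.
Proof.
move=> oU.
pose B (p : 'rV[int]_d * nat) : set E :=
  \bigcap_(i in [set: 'I_d]) [set x : E | `|x ord0 i - (p.1 ord0 i)%:~R / p.2.+1%:R| < p.2.+1%:R^-1].
have mB p : measurable (B p).
  apply: fin_bigcap_measurable => // i _.
  have := @measurable_coord R d i measurableT _
    (@measurable_ball R ((p.1 ord0 i)%:~R / p.2.+1%:R) (p.2.+1%:R^-1)).
  by rewrite setTI; congr measurable; apply/funext => z /=; rewrite /ball/= distrC.
rewrite (_ : U = \bigcup_p (if `[< B p `<=` U >] then B p else set0)).
  apply: countable_bigcupT_measurable => // p; by case: ifP.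
apply/seteqP; split => [x Ux|x [p _]]; last first.
  by case: asboolP => // BU /BU.
have /nbhs_rVP[e e0 eU] : nbhs x U by exact: open_nbhs_nbhs.
have [n ne] : exists n : nat, n.+1%:R^-1 < e / 2.
  have [N _ HN] := near_infty_natSinv_lt (PosNum (divr_gt0 e0 (ltr0n R 2))).
  by exists N; exact: (HN _ (leqnn N)).
have n0 : (0 : R) < n.+1%:R by [].
(* Rounding the coordinates of x down to multiples of 1/(n+1) gives the centre
   of a cube of radius 1/(n+1) that contains x. *)
pose p := (\row_i Num.floor (x ord0 i * n.+1%:R), n) : 'rV[int]_d * nat.
have Bx : B p x.
  move=> i _ /=; rewrite mxE.
  have /andP[h1 h2] := floor_itv (x ord0 i * n.+1%:R).
  set t := (Num.floor _)%:~R in h1 h2 *.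
  rewrite -(@ltr_pM2r _ n.+1%:R)// -[X in _ * X < _]ger0_norm// -normrM mulrBl.
  rewrite divfK ?gt_eqF// mulVf ?gt_eqF// ger0_norm ?subr_ge0//.
  by rewrite ltrBlDl (lt_le_trans h2)// intrD addrC.
exists p => //; rewrite asboolT// => y By; apply: eU => i.
have := By i I; have := Bx i I; rewrite /= => h1 h2.
rewrite (le_lt_trans (ler_distD ((p.1 ord0 i)%:~R / n.+1%:R) _ _))//.
rewrite (splitr e) ltrD//; first exact: lt_trans ne.
by rewrite distrC; exact: lt_trans ne.
Qed.

Lemma continuous_measurable_rV (f : E -> R) :
  continuous f -> measurable_fun setT f.
Proof.
move=> cf; apply: (measurability _ (RGenOpens.measurableE R)).
move=> _ [_ [a [b ->] <-]]; rewrite setTI.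
apply: open_measurable_rV; apply: open_comp => //.
Qed.

Lemma compact_measurable_rV (K : set E) : compact K -> measurable K.
Proof.
move=> cK; rewrite -[K]setCK; apply: measurableC.
apply: open_measurable_rV; apply: closed_openC; exact: compact_closed.
Qed.

End borel.

Section product_integral.
Variables (R : realType) (d : nat).
Local Notation mu := (rV_lebesgue R).
Local Notation leb := (@lebesgue_measure R).

(** Lebesgue measure on R^(d+1) is the image of a product measure, so Fubini's
    theorem integrates such products; the integrals over boxes below follow by
    induction on the dimension. *)
Definition tens (f : R -> R) (g : 'rV[R]_d -> R) (x : 'rV[R]_d.+1) : R :=
  f (x ord0 ord0) * g (\row_i x ord0 (lift ord0 i)).

Lemma tens_uncons f g : tens f g = (fun p => f p.1 * g p.2) \o @rV_uncons R d.
Proof. by apply/funext. Qed.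

Lemma tens_cons f g : tens f g \o @rV_cons R d = (fun p => f p.1 * g p.2).
Proof. by rewrite tens_uncons; apply/funext => p; rewrite /comp rV_consK. Qed.

Variables (f : R -> R) (g : 'rV[R]_d -> R).
Hypotheses (fi : leb.-integrable setT (EFin \o f))
           (gi : (mu d).-integrable setT (EFin \o g)).

Let mf : measurable_fun setT f.
Proof. by apply/measurable_EFinP; case/integrableP : fi. Qed.

Let mg : measurable_fun setT g.
Proof. by apply/measurable_EFinP; case/integrableP : gi. Qed.

Let mfg : measurable_fun setT (fun p : measurableTypeR R * 'rV[R]_d => f p.1 * g p.2).
Proof.
by apply: measurable_funM; [exact: (measurableT_comp mf)|exact: (measurableT_comp mg)].
Qed.

Let prod_integrable : (leb \x mu d)%E.-integrable setT
  (fun p : measurableTypeR R * 'rV[R]_d => (f p.1 * g p.2)%:E).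
Proof.
apply/integrable12ltyP; first exact/measurable_EFinP.
under eq_integral => x _.
  under eq_integral => y _ do rewrite /= normrM EFinM.
  rewrite ge0_integralZl//; last first.
    by apply/measurable_EFinP; exact: measurableT_comp.
  over.
rewrite /= ge0_integralZr//; last 2 first.
- by apply/measurable_EFinP; exact: measurableT_comp.
- by apply: integral_ge0 => // ? _; rewrite lee_fin.
have /integrableP[_ fi1] := fi; have /integrableP[_ gi1] := gi.
by apply: lte_mul_pinfty => //; [exact: integral_ge0|rewrite ge0_fin_numE//; exact: integral_ge0].
Qed.

Lemma measurable_tens : measurable_fun setT (tens f g).
Proof.
rewrite tens_uncons; apply: measurableT_comp; first exact: mfg.
exact: measurable_rV_uncons.
Qed.

Lemma integrable_tens : (mu d.+1).-integrable setT (EFin \o tens f g).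
apply: (@integrable_pushforward _ _ _ _ R (@rV_cons R d)
  (@measurable_rV_cons R d) (leb \x mu d)%E setT) => //.
- by apply/measurable_EFinP; exact: measurable_tens.
- by rewrite preimage_setT -compA tens_cons; exact: prod_integrable.
Qed.

Lemma Rintegral_tens : Rintegral (mu d.+1) setT (tens f g) =
  Rintegral leb setT f * Rintegral (mu d) setT g.
Proof.
rewrite /Rintegral (@integral_pushforward _ _ _ _ R (@rV_cons R d)
  (@measurable_rV_cons R d) (leb \x mu d)%E setT)//; last 2 first.
- by apply/measurable_EFinP; exact: measurable_tens.
- rewrite preimage_setT -compA tens_cons; exact: prod_integrable.
rewrite preimage_setT -compA tens_cons.
rewrite -(integral12_prod_meas1 prod_integrable).
have -> : (\int[leb]_x \int[mu d]_y (f x * g y)%:E =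
    \int[leb]_x ((f x)%:E * (\int[mu d]_y (g y)%:E)))%E.
  apply: eq_integral => x _; rewrite -integralZl//.
have gfin : (\int[mu d]_y (g y)%:E)%E \is a fin_num by exact: integrable_fin_num.
rewrite -(fineK gfin) integralZr// fineM//.
exact: integrable_fin_num.
Qed.

End product_integral.

(** * Trigonometric functions on a box *)

Section trig1.
Variable R : realType.
Local Notation leb := (@lebesgue_measure R).

Definition oitv (a l : R) : set R := [set x | 0 < x - a < l].

Lemma oitvE a l : oitv a l = `]a, a + l[%classic.
Proof.
by apply/seteqP; split=> x; rewrite /oitv/= in_itv/= subr_gt0 ltrBlDl.
Qed.

Lemma measurable_oitv a l : measurable (oitv a l).
Proof. by rewrite oitvE. Qed.

Lemma integrable_oitv_bounded (a l : R) (f : R -> R) : 0 < l ->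
  measurable_fun setT f -> (forall x, `|f x| <= 1) ->
  leb.-integrable setT (EFin \o (fun x => \1_(oitv a l) x * f x)).
Proof.
move=> l0 mf f1.
have mI : measurable_fun setT (\1_(oitv a l) : R -> R).
  by apply: measurable_indic; exact: measurable_oitv.
have : leb.-integrable setT (EFin \o (\1_(oitv a l) : R -> R)).
  by rewrite oitvE; exact: integrable_indic_itv.
apply: le_integrable => //; first exact/measurable_EFinP/measurable_funM.
move=> x _ /=; rewrite lee_fin normrM ler_piMr//.
Qed.

(** The indicator of an open interval is used as a factor, instead of a domain
    of integration, because it is a product of such factors in R^d. *)
Lemma Rintegral_oitv (a l : R) (f F : R -> R) : 0 < l ->
  (forall x, is_derive x (1 : R) F (f x)) -> continuous f ->
  Rintegral leb setT (fun x => \1_(oitv a l) x * f x) = F (a + l) - F a.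
Proof.
move=> l0 dF cf.
have -> : (fun x => \1_(oitv a l) x * f x) = f \_ (oitv a l).
  apply/funext => x; rewrite patchE indicE; case: ifP; rewrite ?mul1r ?mul0r//.
rewrite -Rintegral_mkcond /Rintegral oitvE.
have mf : measurable_fun setT f by exact: continuous_measurable_fun.
rewrite -(integral_itv_bndoo true false); last first.
  by apply/measurable_EFinP; exact: measurable_funTS.
rewrite (@continuous_FTC2 R f F) ?ltrDl// -?EFinB//.
- exact: continuous_subspaceT.
- have cF x : {for x, continuous F}.
    by apply: differentiable_continuous; apply/derivable1_diffP; case: (dF x).
  split.
  + by move=> x _; case: (dF x).
  + by apply: cvg_at_right_filter; exact: cF.
  + by apply: cvg_at_left_filter; exact: cF.
- by move=> x _; rewrite derive1E; case: (dF x).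
Qed.

Lemma periodic_int (f : R -> R) (T : R) : periodic f T ->
  forall (k : int) x, f (x + k%:~R * T) = f x.
Proof.
move=> pf [n|n] x; first by rewrite -[RHS](periodicn pf n); congr f; rewrite -mulr_natl.
rewrite -[LHS](periodicn pf n.+1); congr f.
by rewrite NegzE mulrNz mulNr -mulr_natl subrK.
Qed.

End trig1.

Section phase.
Variable R : realType.
Local Notation leb := (@lebesgue_measure R).
Local Notation mu := (rV_lebesgue R).

(** With this phase, exp(i phase b m x) is the modulation exp(2 pi i m b.x). *)
Definition phase d (b : R) (m : 'rV[int]_d) (x : 'rV[R]_d) : R :=
  2 * pi * b * \sum_i (m ord0 i)%:~R * x ord0 i.

(** The open cube with corner a and side l. For l = 1/b it is a period cell of
    the functions of [phase b m]. *)
Definition obox d (a : 'rV[R]_d) (l : R) : set 'rV[R]_d :=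
  [set x | forall i, 0 < x ord0 i - a ord0 i < l].

Lemma measurable_obox d (a : 'rV[R]_d) l : measurable (obox a l).
Proof.
rewrite (_ : obox a l = \bigcap_(i in [set: 'I_d])
  ((fun x : 'rV[R]_d => x ord0 i) @^-1` oitv (a ord0 i) l)).
  apply: fin_bigcap_measurable => // i _.
  have := @measurable_coord R d i measurableT _ (measurable_oitv (a ord0 i) l).
  by rewrite setTI.
by apply/seteqP; split => [x h i _|x h i]; [exact: h|exact: (h i I)].
Qed.

Lemma measurable_phase d b (m : 'rV[int]_d) : measurable_fun setT (phase b m).
Proof.
apply: measurable_funM => //; apply: measurable_sum => i.
apply: measurable_funM => //; exact: measurable_coord.
Qed.

Lemma is_derive_sin_lin (c x : R) : c != 0 ->
  is_derive x (1 : R) (fun y => c^-1 * sin (c * y)) (cos (c * x)).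
Proof.
move=> c0; apply: is_derive_eq.
by rewrite /GRing.scale/= mulr1; field.
Qed.

Lemma is_derive_cos_lin (c x : R) : c != 0 ->
  is_derive x (1 : R) (fun y => - c^-1 * cos (c * y)) (sin (c * x)).
Proof.
move=> c0; apply: is_derive_eq.
by rewrite /GRing.scale/= mulr1; field.
Qed.

Lemma continuous_cos_lin (c : R) : continuous (fun y => cos (c * y)).
Proof.
move=> x; apply: (@continuous_comp _ _ _ ( *%R c) cos).
  exact: mulrl_continuous.
exact: continuous_cos.
Qed.

Lemma continuous_sin_lin (c : R) : continuous (fun y => sin (c * y)).
Proof.
move=> x; apply: (@continuous_comp _ _ _ ( *%R c) sin).
  exact: mulrl_continuous.
exact: continuous_sin.
Qed.

Lemma freq_neq0 (b : R) (k : int) : 0 < b -> k != 0 -> 2 * pi * b * k%:~R != 0.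
Proof.
move=> b0 k0; apply: mulf_neq0; last by rewrite intr_eq0.
by rewrite gt_eqF// !mulr_gt0// pi_gt0.
Qed.

Lemma Rintegral_cos_oitv (a b : R) (k : int) : 0 < b ->
  Rintegral leb setT (fun x => \1_(oitv a b^-1) x * cos (2 * pi * b * (k%:~R * x)))
  = (k == 0)%:R * b^-1.
Proof.
move=> b0; case: eqVneq => [->|k0].
  under eq_Rintegral do rewrite mul0r mulr0 cos0.
  rewrite (@Rintegral_oitv _ _ _ (cst 1) id) ?invr_gt0//; last exact: cst_continuous.
  by rewrite mul1r addrC addKr.
under eq_Rintegral do rewrite mulrA.
set c := _ * k%:~R.
have c0 : c != 0 by exact: freq_neq0.
rewrite (Rintegral_oitv _ _ (fun x => is_derive_sin_lin x c0)) ?invr_gt0//; last exact: continuous_cos_lin.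
rewrite mulrDr (_ : c / b = k%:~R * (pi *+ 2)).
  by rewrite (periodic_int (@sinD2pi R)) mul0r subrr.
by rewrite /c -mulr_natl; field; rewrite gt_eqF.
Qed.

Lemma Rintegral_sin_oitv (a b : R) (k : int) : 0 < b ->
  Rintegral leb setT (fun x => \1_(oitv a b^-1) x * sin (2 * pi * b * (k%:~R * x)))
  = 0.
Proof.
move=> b0; case: (eqVneq k 0) => [->|k0].
  under eq_Rintegral do rewrite mul0r mulr0 sin0 mulr0.
  by rewrite Rintegral_cst// mul0r.
under eq_Rintegral do rewrite mulrA.
set c := _ * k%:~R.
have c0 : c != 0 by exact: freq_neq0.
rewrite (Rintegral_oitv _ _ (fun x => is_derive_cos_lin x c0)) ?invr_gt0//; last exact: continuous_sin_lin.
rewrite mulrDr (_ : c / b = k%:~R * (pi *+ 2)).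
  by rewrite (periodic_int (@cosD2pi R)) subrr.
by rewrite /c -mulr_natl; field; rewrite gt_eqF.
Qed.

End phase.

Section phase_integral.
Variable R : realType.
Local Notation leb := (@lebesgue_measure R).
Local Notation mu := (rV_lebesgue R).

Definition rtail (T : Type) d (x : 'rV[T]_d.+1) : 'rV[T]_d :=
  \row_i x ord0 (lift ord0 i).

Lemma phaseS d b (m : 'rV[int]_d.+1) (x : 'rV[R]_d.+1) :
  phase b m x = 2 * pi * b * ((m ord0 ord0)%:~R * x ord0 ord0) +
                phase b (rtail m) (rtail x).
Proof.
rewrite /phase big_ord_recl mulrDr; congr (_ + _ * _).
by apply: eq_bigr => i _; rewrite !mxE.
Qed.

Lemma indic_oboxS d (a : 'rV[R]_d.+1) l x :
  \1_(obox a l) x = \1_(oitv (a ord0 ord0) l) (x ord0 ord0) *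
                    \1_(obox (rtail a) l) (rtail x) :> R.
Proof.
rewrite !indicE -natrM mulnb; congr (nat_of_bool _)%:R.
apply/idP/andP; rewrite !inE.
  move=> h; split; first exact: h.
  by move=> i; rewrite !mxE; exact: h.
move=> [h0 h] i; have [j ->|->] := unliftP ord0 i; last exact: h0.
by have := h j; rewrite !mxE.
Qed.

(** Orthogonality of the exponentials, in real terms. The addition formulas
    express the integrals in dimension d+1 by those in dimension d, and they
    mix cosines and sines, whence the simultaneous induction. *)
Lemma Rintegral_phase d (a : 'rV[R]_d) (b : R) (m : 'rV[int]_d) : 0 < b ->
  [/\ (mu d).-integrable setT
        (EFin \o (fun x => \1_(obox a b^-1) x * cos (phase b m x))),
      (mu d).-integrable setT
        (EFin \o (fun x => \1_(obox a b^-1) x * sin (phase b m x))),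
      Rintegral (mu d) setT (fun x => \1_(obox a b^-1) x * cos (phase b m x))
        = (m == 0)%:R * b^-1 ^+ d &
      Rintegral (mu d) setT (fun x => \1_(obox a b^-1) x * sin (phase b m x))
        = 0].
Proof.
move=> b0; elim: d a m => [|d IH] a m.
  have e0 (x : 'rV[R]_0) : phase b m x = 0 by rewrite /phase big_ord0 mulr0.
  have e1 : (fun x => \1_(obox a b^-1) x * cos (phase b m x)) = cst (1 : R).
    by apply/funext => x; rewrite e0 cos0 indicE mem_set ?mulr1// => -[].
  have e2 : (fun x => \1_(obox a b^-1) x * sin (phase b m x)) = cst (0 : R).
    by apply/funext => x; rewrite e0 sin0 mulr0.
  have m0 : m = 0 by apply/rowP => -[].
  rewrite e1 e2 m0 eqxx; split.
  - by apply: finite_measure_integrable_cst.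
  - by apply: integrable0.
  - by rewrite /Rintegral /= integral_dirac// diracT mul1e expr0 mulr1.
  - by rewrite Rintegral_cst// mul0r.
have bV : 0 < b^-1 by rewrite invr_gt0.
set a0 := a ord0 ord0; set m0 := m ord0 ord0.
pose fc (y : R) : R := \1_(oitv a0 b^-1) y * cos (2 * pi * b * (m0%:~R * y)).
pose fs (y : R) : R := \1_(oitv a0 b^-1) y * sin (2 * pi * b * (m0%:~R * y)).
pose gc (x : 'rV[R]_d) : R := \1_(obox (rtail a) b^-1) x * cos (phase b (rtail m) x).
pose gs (x : 'rV[R]_d) : R := \1_(obox (rtail a) b^-1) x * sin (phase b (rtail m) x).
have [igc igs Igc Igs] := IH (rtail a) (rtail m).
have mlin : measurable_fun setT (fun y : R => 2 * pi * b * (m0%:~R * y)).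
  by do 2 apply: measurable_funM.
have ifc : leb.-integrable setT (EFin \o fc).
  apply: integrable_oitv_bounded => //.
    by apply: (measurableT_comp _ mlin); apply: continuous_measurable_fun; exact: continuous_cos.
  by move=> x; rewrite ler_norml cos_geN1 cos_le1.
have ifs : leb.-integrable setT (EFin \o fs).
  apply: integrable_oitv_bounded => //.
    by apply: (measurableT_comp _ mlin); apply: continuous_measurable_fun; exact: continuous_sin.
  by move=> x; rewrite ler_norml sin_geN1 sin_le1.
have Ifc : Rintegral leb setT fc = (m0 == 0)%:R * b^-1 by exact: Rintegral_cos_oitv.
have Ifs : Rintegral leb setT fs = 0 by exact: Rintegral_sin_oitv.
have -> : (fun x => \1_(obox a b^-1) x * cos (phase b m x)) = tens fc gc \- tens fs gs.
  apply/funext => x /=; rewrite indic_oboxS phaseS cosD /tens /fc /gc /fs /gs.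
  rewrite -/(rtail x); set u := \1_(_) _; set v := \1_(_) _; ring.
have -> : (fun x => \1_(obox a b^-1) x * sin (phase b m x)) = tens fs gc \+ tens fc gs.
  apply/funext => x /=; rewrite indic_oboxS phaseS sinD /tens /fc /gc /fs /gs.
  rewrite -/(rtail x); set u := \1_(_) _; set v := \1_(_) _; ring.
have i1 := integrable_tens ifc igc; have i2 := integrable_tens ifs igs.
have i3 := integrable_tens ifs igc; have i4 := integrable_tens ifc igs.
split.
- by have := integrableB measurableT i1 i2; apply: eq_integrable.
- by have := integrableD measurableT i3 i4; apply: eq_integrable.
- rewrite RintegralB// !Rintegral_tens// Ifc Ifs Igc mul0r subr0.
  rewrite exprS mulrACA -natrM mulnb; congr ((nat_of_bool _)%:R * _).
  apply/andP/eqP => [[/eqP m00 /eqP m10]|mE]; last first.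
    by rewrite /m0 mE mxE eqxx; split=> //; apply/eqP/rowP => i; rewrite !mxE.
  apply/rowP => i; rewrite mxE; have [j ->|->//] := unliftP ord0 i.
  by have /rowP/(_ j) := m10; rewrite !mxE.
- by rewrite RintegralD// !Rintegral_tens// Ifc Ifs Igs mulr0 mul0r addr0.
Qed.

Lemma phaseD d b (m m' : 'rV[int]_d) (x : 'rV[R]_d) :
  phase b (m + m') x = phase b m x + phase b m' x.
Proof.
rewrite /phase -mulrDr -big_split/=; congr (_ * _); apply: eq_bigr => i _.
by rewrite !mxE intrD mulrDl.
Qed.

Lemma phaseN d b (m : 'rV[int]_d) (x : 'rV[R]_d) :
  phase b (- m) x = - phase b m x.
Proof.
rewrite /phase -mulrN -sumrN; congr (_ * _); apply: eq_bigr => i _.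
by rewrite !mxE mulrNz mulNr.
Qed.

End phase_integral.

(** * Uniqueness of Fourier coefficients on a box *)

Section bounded_measurable.
Context dd (T : measurableType dd) (R : realType).
Implicit Types (M N : T -> R).

(** Bounded measurable functions: they multiply integrable functions into
    integrable ones. *)
Definition bm M := measurable_fun setT M /\ exists K, forall x, `|M x| <= K.

Lemma bm_cst c : bm (cst c).
Proof. by split=> //; exists `|c|. Qed.

Lemma bmD M N : bm M -> bm N -> bm (fun x => M x + N x).
Proof.
move=> [mM [K HK]] [mN [L HL]]; split; first exact: measurable_funD.
by exists (K + L) => x; rewrite (le_trans (ler_normD _ _))// lerD.
Qed.

Lemma bmM M N : bm M -> bm N -> bm (fun x => M x * N x).
Proof.
move=> [mM [K HK]] [mN [L HL]]; split; first exact: measurable_funM.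
by exists (K * L) => x; rewrite normrM ler_pM.
Qed.

Lemma bm_indic (A : set T) : measurable A -> bm (\1_A).
Proof.
move=> mA; split; first exact: measurable_indic.
by exists 1 => x; rewrite indicE; case: (_ \in _); rewrite ?normr1 ?normr0.
Qed.

Variable mu : {measure set T -> \bar R}.

Lemma integrable_bm h M : mu.-integrable setT (EFin \o h) -> bm M ->
  mu.-integrable setT (EFin \o (fun x => h x * M x)).
Proof.
move=> ih [mM [K HK]].
have mh : measurable_fun setT h by apply/measurable_EFinP; case/integrableP: ih.
have := integrableZl measurableT K (integrable_abse ih).
apply: le_integrable => //; first by apply/measurable_EFinP/measurable_funM.
move=> x _ /=; rewrite lee_fin !normrM normr_id mulrC ler_wpM2r//.
exact: le_trans (HK x) (ler_norm _).
Qed.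

End bounded_measurable.

Section one_variable.
Variable R : realType.

(** The classical iteration that approximates the absolute value on [-1, 1] by
    polynomials in u. It is used to stay inside an algebra of functions. *)
Fixpoint abs_approx (u : R) (n : nat) : R :=
  if n is k.+1 then abs_approx u k + (u ^+ 2 - abs_approx u k ^+ 2) / 2 else 0.

(** Each step multiplies the error |u| - p by 1 - (|u| + p) / 2, which is at
    most 1 - |u| / 2. *)
Lemma abs_approxP (u : R) n : `|u| <= 1 ->
  0 <= abs_approx u n /\ 0 <= `|u| - abs_approx u n <= (1 - `|u| / 2) ^+ n.
Proof.
move=> u1; have u0 : 0 <= `|u| by [].
elim: n => [|n [p0 /andP[IH1 IH2]]] /=; first by rewrite subr0 u0 expr0 u1.
set p := abs_approx u n in p0 IH1 IH2 *.
rewrite -[u ^+ 2]real_normK ?num_real//; set v := `|u| in u0 u1 IH1 IH2 *.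
have pv : p <= v by rewrite -subr_ge0.
split.
  rewrite addr_ge0// divr_ge0// subr_ge0 lerXn2r//.
have -> : v - (p + (v ^+ 2 - p ^+ 2) / 2) = (v - p) * (1 - (v + p) / 2) by field.
rewrite mulr_ge0 ?exprSr//=; last by lra.
by rewrite ler_pM//; lra.
Qed.

Lemma cvg_expr_small (z : R) : 0 <= z < 1 -> (z ^+ n) @[n --> \oo] --> 0.
Proof. by move=> /andP[z0 z1]; apply: cvg_expr; rewrite ger0_norm. Qed.

Lemma abs_approx_cvg (u : R) : `|u| <= 1 ->
  abs_approx u n @[n --> \oo] --> `|u|.
Proof.
move=> u1; have [->|u0] := eqVneq u 0.
  have -> : abs_approx 0 = cst (0 : R).
    by apply/funext; elim=> // n /= ->; rewrite expr0n/= subr0 mul0r addr0.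
  by rewrite normr0; exact: cvg_cst.
have v0 : 0 < `|u| by rewrite normr_gt0.
have : `|u| - abs_approx u n @[n --> \oo] --> 0.
  apply: (@squeeze_cvgr _ _ _ _ (cst 0) (fun n => (1 - `|u| / 2) ^+ n)).
  - by near=> n; have [_] := abs_approxP n u1.
  - exact: cvg_cst.
  - by apply: cvg_expr_small; lra.
move=> /(cvgB (cvg_cst `|u|)) /=; rewrite subr0.
by apply: cvg_trans; apply: near_eq_cvg; near=> n => /=; rewrite /= opprB addrC subrK.
Unshelve. all: by end_near. Qed.

(** Cosine is decreasing on [0, pi]: comparing two cosines tells whether an
    angle lies in the arc (-r, r). *)
Lemma cos_arc (r z : R) : 0 < r < pi -> - r < z < 2 * pi - r ->
  (cos r < cos z) = (z < r).
Proof.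
move=> /andP[r0 rpi] /andP[rz zr].
have dec x y : 0 <= x -> x <= y -> y <= pi -> cos y <= cos x :> R.
  move=> x0 xy ypi.
  have hx : x \in `[0, pi] by rewrite in_itv/=; apply/andP; split; lra.
  have hy : y \in `[0, pi] by rewrite in_itv/=; apply/andP; split; lra.
  by rewrite leNgt ltr_cos// -leNgt.
have cabs x : cos `|x| = cos x :> R.
  by case: (ler0P x) => // _; rewrite cosN.
have [zr'|rz'] := ltP z r.
  have nz : `|z| < r by rewrite ltr_norml rz zr'.
  have hz : `|z| \in `[0, pi].
    by rewrite in_itv/= normr_ge0/= (le_trans (ltW nz)); lra.
  have hr : r \in `[0, pi] by rewrite in_itv/=; apply/andP; split; lra.
  by rewrite -[cos z]cabs ltr_cos.
apply/negbTE; rewrite -leNgt; have [zpi|piz] := leP z pi.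
  by apply: dec => //; lra.
have <- : cos (2 * pi - z) = cos z :> R.
  by rewrite -[LHS]cosN -[LHS]cosD2pi; congr cos; ring.
by apply: dec; lra.
Qed.

End one_variable.

Section fourier_uniqueness.
Variables (R : realType) (d : nat).
Local Notation E := 'rV[R]_d.
Local Notation mu := (rV_lebesgue R d).
Variables (h : E -> R) (a : E) (b : R).
Hypotheses (b0 : 0 < b) (ih : mu.-integrable setT (EFin \o h))
  (h0 : forall x, ~ obox a b^-1 x -> h x = 0)
  (hc : forall m, Rintegral mu setT (fun x => h x * cos (phase b m x)) = 0)
  (hs : forall m, Rintegral mu setT (fun x => h x * sin (phase b m x)) = 0).

Let I (M : E -> R) := Rintegral mu setT (fun x => h x * M x).

(* All Fourier coefficients of h M vanish. *)
Let killed (M : E -> R) := forall m,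
  I (fun x => M x * cos (phase b m x)) = 0 /\
  I (fun x => M x * sin (phase b m x)) = 0.

(** The functions M such that all Fourier coefficients of h N M vanish
    whenever those of h N do. They form an algebra that contains the
    trigonometric polynomials and is closed under bounded pointwise limits, so
    the measurable sets whose indicators belong to it form a sigma-algebra;
    the aim is to show that it contains all measurable sets. *)
Definition fmult (M : E -> R) :=
  bm M /\ forall N, bm N -> killed N -> killed (fun x => N x * M x).

Let bm_cosp m : bm (fun x : E => cos (phase b m x)).
Proof.
split; last by exists 1 => x; rewrite ler_norml cos_geN1 cos_le1.
apply: (measurableT_comp _ (measurable_phase b m)).
by apply: continuous_measurable_fun; exact: continuous_cos.
Qed.

Let bm_sinp m : bm (fun x : E => sin (phase b m x)).
Proof.
split; last by exists 1 => x; rewrite ler_norml sin_geN1 sin_le1.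
apply: (measurableT_comp _ (measurable_phase b m)).
by apply: continuous_measurable_fun; exact: continuous_sin.
Qed.

Let IE M N : (forall x, M x = N x) -> I M = I N.
Proof. by move=> MN; apply: eq_Rintegral => x _; rewrite MN. Qed.

Let ID M N : bm M -> bm N -> I (fun x => M x + N x) = I M + I N.
Proof.
move=> bM bN; rewrite /I -RintegralD//; [|exact: integrable_bm..].
by apply: eq_Rintegral => x _; rewrite mulrDr.
Qed.

Let IZ M c : bm M -> I (fun x => c * M x) = c * I M.
Proof.
move=> bM; rewrite /I -RintegralZl//; last exact: integrable_bm.
by apply: eq_Rintegral => x _; rewrite mulrCA.
Qed.

Let I_lim (M : nat -> E -> R) N K : (forall n, measurable_fun setT (M n)) ->
  (forall n x, `|M n x| <= K) -> (forall x, M n x @[n --> \oo] --> N x) ->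
  (forall n, I (M n) = 0) -> I N = 0.
Proof.
move=> mM MK MN IM.
have mh : measurable_fun setT h by apply/measurable_EFinP; case/integrableP: ih.
have mN : measurable_fun setT N by apply: (measurable_fun_cvg mM) => x _.
have K0 : 0 <= K by exact: le_trans (MK 0%N a).
have NK x : `|N x| <= K.
  by apply: (cvgr_to_le (cvg_norm (MN x))); exact: nearW.
have := @dominated_convergence _ E R mu setT measurableT
  (fun n x => (h x * M n x)%:E) (fun x => (h x * N x)%:E) (fun x => (K * `|h x|)%:E).
case.
- by move=> n; apply/measurable_EFinP/measurable_funM.
- by apply/measurable_EFinP/measurable_funM.
- apply: aeW => x _; apply/fine_cvgP; split; first exact: nearW.
  rewrite /comp/=; apply: cvgM; [exact: cvg_cst|exact: MN].
- have := integrableZl measurableT K (integrable_abse ih).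
  by apply: eq_integrable.
- apply: aeW => x n _; rewrite /= lee_fin normrM mulrC; exact: ler_wpM2r.
move=> iN _ cI; have cI' : (fun n => \int[mu]_x (h x * M n x)%:E)%E = cst 0%E.
  apply/funext => n; rewrite -[LHS]fineK; first by congr EFin; exact: IM.
  by apply: integrable_fin_num => //; apply: integrable_bm => //; split => //; exists K.
have /cvg_unique : (\int[mu]_x (h x * M n x)%:E)%E @[n --> \oo] --> 0%E.
  by rewrite cI'; exact: cvg_cst.
by move=> /(_ (@ereal_hausdorff R) _ cI) e0; rewrite /I /Rintegral -e0.
Qed.

Lemma fmult_cst c : fmult (cst c).
Proof.
split=> [|N bN kN m]; first exact: bm_cst.
have [k1 k2] := kN m; split.
  rewrite (IE (N := fun x => c * (N x * cos (phase b m x)))).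
    by rewrite IZ ?k1 ?mulr0//; exact: bmM.
  by move=> x; rewrite /cst mulrAC mulrC.
rewrite (IE (N := fun x => c * (N x * sin (phase b m x)))).
  by rewrite IZ ?k2 ?mulr0//; exact: bmM.
by move=> x; rewrite /cst mulrAC mulrC.
Qed.

Lemma fmultD M M' : fmult M -> fmult M' -> fmult (fun x => M x + M' x).
Proof.
move=> [bM kM] [bM' kM']; split=> [|N bN kN m]; first exact: bmD.
have [k1 k2] := kM N bN kN m; have [k1' k2'] := kM' N bN kN m.
split.
  rewrite (IE (N := fun x => N x * M x * cos (phase b m x) + N x * M' x * cos (phase b m x))).
    by rewrite ID ?k1 ?k1' ?addr0//; apply: bmM => //; exact: bmM.
  by move=> x; rewrite mulrDr mulrDl.
rewrite (IE (N := fun x => N x * M x * sin (phase b m x) + N x * M' x * sin (phase b m x))).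
  by rewrite ID ?k2 ?k2' ?addr0//; apply: bmM => //; exact: bmM.
by move=> x; rewrite mulrDr mulrDl.
Qed.

Lemma fmultM M M' : fmult M -> fmult M' -> fmult (fun x => M x * M' x).
Proof.
move=> [bM kM] [bM' kM']; split=> [|N bN kN]; first exact: bmM.
have -> : (fun x => N x * (M x * M' x)) = (fun x => N x * M x * M' x).
  by apply/funext => x; rewrite mulrA.
exact: kM' _ (bmM bN bM) (kM N bN kN).
Qed.

(** Only the values on the box matter, since h vanishes outside of it. *)
Lemma fmult_ext M M' : bm M' -> (forall x, obox a b^-1 x -> M' x = M x) ->
  fmult M -> fmult M'.
Proof.
move=> bM' MM' [bM kM]; split=> // N bN kN m.
have [k1 k2] := kM N bN kN m.
have e (c : R) x : h x * (N x * M' x * c) = h x * (N x * M x * c).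
  by have [/MM' ->//|/h0 ->] := pselect (obox a b^-1 x); rewrite !mul0r.
by split; [rewrite -k1|rewrite -k2]; apply: eq_Rintegral => x _; rewrite e.
Qed.

Lemma fmult_lim (M : nat -> E -> R) N K : (forall n, fmult (M n)) ->
  (forall n x, `|M n x| <= K) -> (forall x, M n x @[n --> \oo] --> N x) ->
  fmult N.
Proof.
move=> fM MK MN.
have mM n : measurable_fun setT (M n) by have [[]] := fM n.
have mN : measurable_fun setT N by apply: (measurable_fun_cvg mM) => x _.
have K0 : 0 <= K by exact: le_trans (MK 0%N a).
have NK x : `|N x| <= K.
  by apply: (cvgr_to_le (cvg_norm (MN x))); exact: nearW.
split=> [|N' bN' kN' m]; first by split=> //; exists K.
have [mN' [K' N'K']] := bN'.
have lim (g : E -> R) : measurable_fun setT g -> (forall x, `|g x| <= 1) ->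
    (forall n, I (fun x => N' x * M n x * g x) = 0) -> I (fun x => N' x * N x * g x) = 0.
  move=> mg g1; apply: (@I_lim _ _ (K' * K * 1)).
  - by move=> n; do 2 apply: measurable_funM => //.
  - by move=> n x; rewrite !normrM ler_pM ?mulr_ge0 ?normr_ge0// ler_pM.
  - by move=> x; apply: cvgMl; apply: cvgMr; exact: MN.
split.
  apply: lim => [|x|n]; first by have [] := bm_cosp m.
    by rewrite ler_norml cos_geN1 cos_le1.
  by have [_ /(_ N' bN' kN' m)[]] := fM n.
apply: lim => [|x|n]; first by have [] := bm_sinp m.
  by rewrite ler_norml sin_geN1 sin_le1.
by have [_ /(_ N' bN' kN' m)[]] := fM n.
Qed.

Ltac bmtac := repeat first [assumption | exact: bm_cosp | exact: bm_sinp
  | exact: (bm_cst _) | apply: bmD | apply: bmM].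

(** Multiplying by a cosine replaces a Fourier coefficient by the half sum of
    two shifted ones. *)
Lemma fmult_cos m : fmult (fun x => cos (phase b m x)).
Proof.
split=> [|N bN kN m']; first exact: bm_cosp.
have [c1 s1] := kN (m' + m); have [c2 s2] := kN (m' - m).
split.
  rewrite (IE (N := fun x => 2^-1 * (N x * cos (phase b (m' + m) x)
      + N x * cos (phase b (m' - m) x)))).
    by rewrite IZ ?ID ?c1 ?c2 ?addr0 ?mulr0//; bmtac.
  by move=> x; rewrite !phaseD phaseN !cosD cosN sinN; field.
rewrite (IE (N := fun x => 2^-1 * (N x * sin (phase b (m' + m) x)
    + N x * sin (phase b (m' - m) x)))).
  by rewrite IZ ?ID ?s1 ?s2 ?addr0 ?mulr0//; bmtac.
by move=> x; rewrite !phaseD phaseN !sinD cosN sinN; field.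
Qed.

Lemma fmult_sin m : fmult (fun x => sin (phase b m x)).
Proof.
split=> [|N bN kN m']; first exact: bm_sinp.
have [c1 s1] := kN (m' + m); have [c2 s2] := kN (m' - m).
split.
  rewrite (IE (N := fun x => 2^-1 * (N x * sin (phase b (m' + m) x)
      + -1 * (N x * sin (phase b (m' - m) x))))).
    by rewrite IZ ?ID ?IZ ?s1 ?s2 ?mulr0 ?addr0 ?mulr0//; bmtac.
  by move=> x; rewrite !phaseD phaseN !sinD cosN sinN; field.
rewrite (IE (N := fun x => 2^-1 * (N x * cos (phase b (m' - m) x)
    + -1 * (N x * cos (phase b (m' + m) x))))).
  by rewrite IZ ?ID ?IZ ?c1 ?c2 ?mulr0 ?addr0 ?mulr0//; bmtac.
by move=> x; rewrite !phaseD phaseN !cosD cosN sinN; field.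
Qed.

Lemma fmultX M n : fmult M -> fmult (fun x => M x ^+ n).
Proof.
move=> fM; elim: n => [|n IH]; first exact: (fmult_cst 1).
rewrite (_ : (fun x => _) = (fun x => M x * M x ^+ n)); first exact: fmultM.
by apply/funext => x; rewrite exprS.
Qed.

Lemma fmultZ c M : fmult M -> fmult (fun x => c * M x).
Proof. by move=> fM; apply: fmultM => //; exact: (fmult_cst c). Qed.

Lemma fmult_abs M : fmult M -> (forall x, `|M x| <= 1) ->
  fmult (fun x => `|M x|).
Proof.
move=> fM M1.
apply: (@fmult_lim (fun n x => abs_approx (M x) n) _ 1).
- elim=> [|n IH] /=; first exact: (fmult_cst 0).
  apply: fmultD => //; rewrite (_ : (fun x => _) =
    (fun x => 2^-1 * (M x ^+ 2 + -1 * abs_approx (M x) n ^+ 2))).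
    by apply: fmultZ; apply: fmultD; [exact: fmultX|apply: fmultZ; exact: fmultX].
  by apply/funext => x; field.
- move=> n x; have [p0 /andP[p1 _]] := abs_approxP n (M1 x).
  by rewrite ger0_norm// (le_trans _ (M1 x))// -subr_ge0.
- by move=> x; exact: abs_approx_cvg.
Qed.

(** Let v be the positive part of M - c, scaled to take values in [0, 1]. The
    functions 1 - (1 - v)^n converge to the indicator of v > 0, and v is
    obtained by the approximation of the absolute value. *)
Lemma fmult_level M c : fmult M -> fmult (\1_[set x | c < M x]).
Proof.
move=> fM; have [[mM [K MK]] _] := fM.
have K0 : 0 <= K by exact: le_trans (MK a).
pose L := K + `|c| + 1.
have L0 : 0 < L by rewrite /L ltr_wpDl// addr_ge0.
pose u x := L^-1 * (M x - c).
have u1 x : `|u x| <= 1.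
  rewrite /u normrM gtr0_norm ?invr_gt0// ler_pdivrMl// mulr1.
  by rewrite (le_trans (ler_normB _ _))// /L ler_wpDr// lerD.
have fu : fmult u.
  by apply: fmultZ; apply: fmultD => //; exact: (fmult_cst (- c)).
pose v x := 2^-1 * (`|u x| + u x).
have v01 x : 0 <= v x <= 1.
  by have := u1 x; have := ler_norm (u x); have := ler_norm (- u x); rewrite normrN /v; lra.
have fv : fmult v by apply: fmultZ; apply: fmultD => //; exact: fmult_abs.
apply: (@fmult_lim (fun n x => 1 + -1 * (1 + -1 * v x) ^+ n) _ 1).
- move=> n; apply: fmultD; first exact: (fmult_cst 1).
  apply: fmultZ; apply: fmultX; apply: fmultD; first exact: (fmult_cst 1).
  exact: fmultZ.
- move=> n x; have /andP[v0 v1] := v01 x; rewrite !mulN1r ger0_norm.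
    by rewrite gerBl exprn_ge0// subr_ge0.
  by rewrite subr_ge0 exprn_ile1// ?subr_ge0// gerBl.
move=> x; rewrite indicE; case: (ltP c (M x)) => cM.
  rewrite mem_set// -[X in _ --> X]subr0; under eq_fun do rewrite !mulN1r.
  apply: cvgB; first exact: cvg_cst.
  apply: cvg_expr_small.
  have u0 : 0 < u x by rewrite /u mulr_gt0 ?invr_gt0// subr_gt0.
  have v0 : 0 < v x by rewrite /v gtr0_norm// mulr_gt0// addr_gt0.
  by have /andP[_ v1] := v01 x; rewrite subr_ge0 v1 gtrBl v0.
rewrite memNset/=; last by apply/negP; rewrite -leNgt.
have -> : v x = 0.
  have u0 : u x <= 0 by rewrite /u mulr_ge0_le0 ?subr_le0// invr_ge0 ltW.
  by rewrite /v ler0_norm// addrC subrr mulr0.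
under eq_fun do rewrite mulr0 addr0 expr1n mulr1 subrr.
exact: cvg_cst.
Qed.

(** It suffices to treat half-spaces x_i > t. Inside the box such a set is an
    arc of the circle of which x_i is the angle, i.e., a level set of a
    trigonometric polynomial. *)
Lemma fmult_indic (A : set E) : measurable A -> fmult (\1_A).
Proof.
pose S : set (set E) := [set A | measurable A /\ fmult (\1_A)].
have S0 : S set0 by split=> //; rewrite indic0; exact: (fmult_cst 0).
have SC B : S B -> S (~` B).
  move=> [mB fB]; split; first exact: measurableC.
  have -> : \1_(~` B) = (fun x => 1 + -1 * \1_B x) :> (E -> R).
    by apply/funext => x; rewrite !indicE in_setC; case: (_ \in _) => /=; rewrite ?mulr1 ?mulr0 ?addr0 ?subrr.
  by apply: fmultD; [exact: (fmult_cst 1)|exact: fmultZ].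
have SI B C : S B -> S C -> S (B `&` C).
  move=> [mB fB] [mC fC]; split; first exact: measurableI.
  have -> : \1_(B `&` C) = (fun x => \1_B x * \1_C x) :> (E -> R).
    by apply/funext => x; rewrite !indicE in_setI -natrM mulnb.
  exact: fmultM.
have SU (F : (set E)^nat) : (forall n, S (F n)) -> S (\bigcup_n F n).
  move=> SF; split; first by apply: bigcup_measurable => n _; have [] := SF n.
  pose G n := \big[setI/setT]_(i < n) ~` F i.
  have GE n : G n = \bigcap_(i < n) ~` F i by rewrite bigcap_mkord.
  have SG n : S (G n).
    apply: big_ind => // [|i _]; last exact: SC.
    by rewrite -setC0; exact: SC.
  apply: (@fmult_lim (fun n => \1_(~` G n)) _ 1).
  - by move=> n; have [] := SC _ (SG n).
  - by move=> n x; rewrite indicE; case: (_ \in _); rewrite ?normr1 ?normr0.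
  move=> x; have [[k _ Fkx]|nF] := pselect ((\bigcup_n F n) x).
    rewrite [X in _ --> X]indicE mem_set; last by exists k.
    apply: cvg_near_cst; near=> n; rewrite indicE mem_set//= => Gx.
    move: Gx; rewrite GE => /(_ k); apply => //=.
    by near: n; exists k.+1.
  rewrite [X in _ --> X]indicE memNset//.
  apply: cvg_near_cst; apply: nearW => n; rewrite indicE memNset//=; apply.
  by rewrite GE => k _ Fx; apply: nF; exists k.
have Sray i t : S [set x : E | t < x ord0 i].
  have mray : measurable [set x : E | t < x ord0 i].
    have := @measurable_coord R d i measurableT `]t, +oo[%classic (measurable_itv _).
    by rewrite setTI; congr measurable; apply/funext => x /=; rewrite in_itv/= andbT.
  split=> //.
  pose tau := b * (t - a ord0 i).
  have [tau0|tau0] := leP tau 0.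
    apply: (fmult_ext (bm_indic _ mray) _ (fmult_cst 1)) => x /(_ i)/andP[x0 _].
    rewrite indicE mem_set//=.
    move: tau0; rewrite /tau pmulr_rle0// subr_le0 => /le_lt_trans; apply.
    by rewrite -subr_gt0.
  have [tau1|tau1] := leP 1 tau.
    apply: (fmult_ext (bm_indic _ mray) _ (fmult_cst 0)) => x /(_ i)/andP[_ x1].
    rewrite indicE memNset//=; apply/negP; rewrite -leNgt.
    move: tau1; rewrite /tau -ler_pdivrMl// mulr1 => /(lt_le_trans x1).
    by rewrite ltrD2r => /ltW.
  pose m : 'rV[int]_d := delta_mx ord0 i.
  have phm x : phase b m x = 2 * pi * b * x ord0 i :> R.
    rewrite /phase (bigD1 i)//= big1 ?addr0; first by rewrite mxE !eqxx mul1r.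
    by move=> j /negbTE ji; rewrite mxE ji andbF mul0r.
  (* With th = b (x_i - a_i) in (0, 1), the half-space is tau < th < 1; the
     rotation by kap moves the midpoint (1 + tau) / 2 of this arc to the angle
     0. *)
  pose kap := pi * (1 + tau) + 2 * pi * b * a ord0 i.
  pose u x := cos kap * cos (phase b m x) + sin kap * sin (phase b m x).
  have fu : fmult u.
    by apply: fmultD; apply: fmultZ; [exact: fmult_cos|exact: fmult_sin].
  apply: (fmult_ext (bm_indic _ mray) _ (fmult_level (cos (pi * (1 - tau))) fu)) => x /(_ i)/andP[x0 x1].
  have pi0 := pi_gt0 R.
  pose th := b * (x ord0 i - a ord0 i).
  have th0 : 0 < th by rewrite mulr_gt0.
  have th1 : th < 1 by rewrite /th -ltr_pdivlMl// mulr1.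
  have txth : (t < x ord0 i) = (tau < th) by rewrite /tau /th ltr_pM2l// ltrD2r.
  have ux : u x = cos (pi * (1 + tau) - 2 * pi * th).
    by rewrite /u -cosB phm /kap /th; congr cos; ring.
  have arc : (cos (pi * (1 - tau)) < u x) = (tau < th).
    rewrite ux cos_arc; first by rewrite -[RHS](ltr_pM2l pi0); apply/idP/idP; lra.
    - by apply/andP; split; nra.
    - by apply/andP; split; nra.
  by rewrite !indicE; congr (nat_of_bool _)%:R; apply/idP/idP; rewrite !inE/= arc txth.
move=> mA; suff : S A by case.
have : @measurable _ E `<=` S; last exact.
rewrite /measurable/=; apply: smallest_sub.
  split=> //.
  - by move=> B SB; rewrite setTD; exact: SC.
rewrite -bigcup_seq; apply: bigcup_sub => i _.
move=> _ [Y mY <-]; rewrite setTI.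
pose S' : set (set R) := [set Y | S ((fun x : E => x ord0 i) @^-1` Y)].
suff : S' Y by [].
move: Y mY; rewrite -/(_ `<=` _).
rewrite [X in X `<=` _](RGenOInfty.measurableE R); apply: smallest_sub.
  split.
  - by rewrite /S'/= preimage_set0.
  - by move=> B; rewrite /S'/= setTD preimage_setC; exact: SC.
  - by move=> F HF; rewrite /S'/= preimage_bigcup; exact: SU.
move=> _ [t ->]; rewrite /S'/=.
rewrite (_ : _ @^-1` _ = [set x : E | t < x ord0 i])//.
by apply/funext => x /=; rewrite in_itv/= andbT.
Unshelve. all: by end_near. Qed.

(** Since h has integral 0 on every measurable set, it does on the set where h
    > 0 and on its complement, so the integral of |h| is 0. *)
Lemma fourier_uniqueness : {ae mu, forall x, h x = 0}.
Proof.
have k1 : killed (cst 1).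
  move=> m; split; [rewrite -(hc m)|rewrite -(hs m)];
    by apply: eq_Rintegral => x _; rewrite mul1r.
have IA A : measurable A -> I (\1_A) = 0.
  move=> mA; have [_ /(_ _ (bm_cst _ _) k1 0)[<- _]] := fmult_indic mA.
  apply: IE => x; rewrite /cst mul1r.
  have -> : phase b 0 x = 0 :> R.
    by rewrite -(subrr 0) phaseD phaseN subrr.
  by rewrite cos0 mulr1.
have mh : measurable_fun setT h by apply/measurable_EFinP; case/integrableP: ih.
pose A := [set x | 0 < h x].
have mA : measurable A.
  have := mh measurableT `]0, +oo[%classic (measurable_itv _).
  by rewrite setTI; congr measurable; apply/funext => x /=; rewrite in_itv/= andbT.
have : Rintegral mu setT (fun x => `|h x|) = 0.
  transitivity (I (fun x => \1_A x + -1 * \1_(~` A) x)).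
    apply: eq_Rintegral => x _; rewrite !indicE in_setC.
    case: (boolP (x \in A)); rewrite ?inE/= => hx.
      by rewrite mulr0 addr0 mulr1 gtr0_norm.
    rewrite /= add0r mulr1 mulrN1 ler0_norm//; rewrite notin_setE/= in hx.
    by rewrite leNgt; apply/negP.
  rewrite ID; [|exact: bm_indic|]; last first.
    by apply: bmM; [exact: (bm_cst _ _)|exact/bm_indic/measurableC].
  by rewrite IZ ?IA ?mulr0 ?addr0//; [exact: measurableC|exact/bm_indic/measurableC].
move=> i0.
have : (\int[mu]_x `|(h x)%:E| = 0)%E.
  rewrite -[LHS]fineK; first by congr EFin; exact: i0.
  have := integrable_fin_num measurableT (integrable_abse ih).
  exact.
move/ae_eq_integral_abs => /(_ measurableT); rewrite measurable_EFinP => /(_ mh).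
by apply: filterS => x /(_ Logic.I)[].
Qed.

End fourier_uniqueness.

(** * Sums of families of non-negative extended reals *)

Section esum_tools.
Context (R : realType) (I : choiceType).
Implicit Types (a : I -> \bar R) (A B : {fset I}).

Lemma esum_ge_fset a A : (forall i, 0 <= a i)%E ->
  (\sum_(i <- A) a i <= \esum_(i in [set: I]) a i)%E.
Proof.
move=> a0; apply: esum_ge; exists [set` A]; first by split.
rewrite fsbig_finite//= (_ : fset_set [set` A] = A)//.
by apply/fsetP => i; rewrite in_fset_set//; apply/idP/idP; rewrite inE.
Qed.

Lemma esum_le_fset a x : (forall A, \sum_(i <- A) a i <= x)%E ->
  (\esum_(i in [set: I]) a i <= x)%E.
Proof.
move=> H; apply: ge_ereal_sup => _ [A [finA _] <-].
by rewrite fsbig_finite.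
Qed.

Lemma esum_ge1 a i : (forall i, 0 <= a i)%E ->
  (a i <= \esum_(i in [set: I]) a i)%E.
Proof.
by move=> a0; have := esum_ge_fset [fset i]%fset a0; rewrite big_seq_fset1.
Qed.

Lemma esum_tail a (e : R) : (forall i, 0 <= a i)%E ->
  (\esum_(i in [set: I]) a i < +oo)%E -> 0 < e ->
  exists A, forall B, (forall i, i \in B -> i \notin A) ->
    (\sum_(i <- B) a i <= e%:E)%E.
Proof.
move=> a0 aoo e0.
have afin : (\esum_(i in [set: I]) a i)%E \is a fin_num.
  by rewrite ge0_fin_numE// esum_ge0.
have [_ [A' [finA' _] <-] hA] := ub_ereal_sup_adherent e0 afin.
pose A := fset_set A'.
have {}hA : (\esum_(i in [set: I]) a i < \sum_(i <- A) a i + e%:E)%E.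
  by rewrite -lteBlDr//; move: hA; rewrite fsbig_finite.
exists A => B BA.
have dAB : (\sum_(i <- A) a i + \sum_(i <- B) a i <= \esum_(i in [set: I]) a i)%E.
  have := esum_ge_fset (A `|` B)%fset a0.
  rewrite (big_fsetID _ (mem A))/=; congr (_ + _ <= _)%E.
    by apply: eq_fbigl => i; rewrite !inE/=; case: (i \in A); rewrite ?andbF.
  apply: eq_fbigl => i; rewrite !inE/=.
  by case: (boolP (i \in B)) => [/BA ->//|_]; case: (i \in A).
have sA : (\sum_(i <- A) a i)%E \is a fin_num.
  rewrite ge0_fin_numE; last by apply: sume_ge0.
  exact: le_lt_trans (esum_ge_fset A a0) aoo.
by have := lt_le_trans (le_lt_trans dAB hA) (lexx _); rewrite lteD2lE// => /ltW.
Qed.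

Lemma esumZ_le a (k : R) : 0 <= k -> (forall i, 0 <= a i)%E ->
  (\esum_(i in [set: I]) (k%:E * a i) <= k%:E * \esum_(i in [set: I]) a i)%E.
Proof.
move=> k0 a0; apply: esum_le_fset => A.
rewrite -ge0_sume_distrr//; apply: lee_wpmul2l; first by rewrite lee_fin.
exact: esum_ge_fset.
Qed.

Lemma esum_fin_supp a A : (forall i, 0 <= a i)%E ->
  (forall j, j \notin A -> a j = 0%E) ->
  (\esum_(i in [set: I]) a i = \sum_(i <- A) a i)%E.
Proof.
move=> a0 aA; apply/eqP; rewrite eq_le esum_ge_fset// andbT.
apply: esum_le_fset => B.
rewrite (big_fsetID _ (mem A))/= [X in (_ + X)%E]big1_fset ?adde0; last first.
  by move=> i; rewrite !inE/= => /andP[_ /aA].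
rewrite [leRHS](big_fsetID _ (mem B))/=.
rewrite (_ : \sum_(i <- [fset x in B | x \in A]%fset) a i =
  \sum_(i <- [fset x in A | x \in B]%fset) a i)%E.
  by rewrite leeDl// sume_ge0.
by apply: eq_fbigl => i; rewrite !inE/= andbC.
Qed.

End esum_tools.

Section esum_integral.
Context dd (T : measurableType dd) (R : realType) (I : countType).
Variable mu : {measure set T -> \bar R}.

(** A family over a countable type as a sequence, so that the theorems on
    series of functions apply to sums over the type; the indices that code no
    element contribute 0. *)
Definition enumf (f : I -> T -> \bar R) (n : nat) : T -> \bar R :=
  if choice.unpickle n is Some i then
    if choice.pickle i == n then f i else cst 0%E else cst 0%E.

Lemma esum_enumf (f : I -> T -> \bar R) x : (forall i, 0 <= f i x)%E ->
  (\esum_(i in [set: I]) f i x = \sum_(n <oo) enumf f n x)%E.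
Proof.
move=> f0.
have e0 n : (0 <= enumf f n x)%E by rewrite /enumf; case: choice.unpickle => // i; case: ifP.
rewrite nneseries_esumT//.
rewrite (esumID (range (@choice.pickle I)))// [X in (_ + X)%E]esum1 ?adde0; last first.
  move=> n [_ /=]; rewrite /enumf; case: choice.unpickle => // i; case: eqP => // <- H.
  by exfalso; apply: H; exists i.
rewrite setTI esum_image//=.
by apply: eq_esum => i _; rewrite /enumf choice.pickleK eqxx.
Qed.

Lemma integral_esum (f : I -> T -> \bar R) :
  (forall i x, 0 <= f i x)%E -> (forall i, measurable_fun setT (f i)) ->
  (\int[mu]_x (\esum_(i in [set: I]) f i x) =
   \esum_(i in [set: I]) (\int[mu]_x f i x))%E.
Proof.
move=> f0 mf.
under eq_integral => x _ do rewrite esum_enumf//.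
rewrite integral_nneseries//; last 2 first.
- by move=> n; rewrite /enumf; case: choice.unpickle => // i; case: ifP.
- by move=> n x _; rewrite /enumf; case: choice.unpickle => // i; case: ifP.
have -> : (\esum_(i in [set: I]) (\int[mu]_x f i x) =
    \sum_(n <oo) (if choice.unpickle n is Some i then if choice.pickle i == n then \int[mu]_x f i x else 0 else 0))%E.
  rewrite nneseries_esumT; last first.
    by move=> n; case: choice.unpickle => // i; case: ifP => // _; exact: integral_ge0.
  rewrite [RHS](esumID (range (@choice.pickle I))); last first.
    by move=> n; case: choice.unpickle => // i; case: ifP => // _ _; exact: integral_ge0.
  rewrite [X in (_ + X)%E]esum1 ?adde0; last first.
    move=> n [_ /=]; case: choice.unpickle => // i; case: eqP => // <- H.
    by exfalso; apply: H; exists i.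
  rewrite setTI esum_image//=.
  by apply: eq_esum => i _; rewrite choice.pickleK eqxx.
congr (limn _); apply/funext => n; apply: eq_bigr => k _.
rewrite /enumf; case: choice.unpickle => [i|]; last by rewrite integral0.
by case: ifP => _ //; rewrite integral0.
Qed.

End esum_integral.

(** * Complex-valued square integrable functions *)

Section complex_numbers.
Variable R : rcfType.
Local Notation C := R[i].
Local Notation Re := (@complex.Re R).
Local Notation Im := (@complex.Im R).
Local Notation cabs := (@Normc.normc R).
Implicit Types (x y z : C).

Lemma cReD x y : Re (x + y) = Re x + Re y. Proof. by case: x; case: y. Qed.
Lemma cImD x y : Im (x + y) = Im x + Im y. Proof. by case: x; case: y. Qed.
Lemma cReM x y : Re (x * y) = Re x * Re y - Im x * Im y.
Proof. by case: x; case: y. Qed.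
Lemma cImM x y : Im (x * y) = Re x * Im y + Im x * Re y.
Proof. by case: x; case: y. Qed.
Lemma cReN x : Re (- x) = - Re x. Proof. by case: x. Qed.
Lemma cImN x : Im (- x) = - Im x. Proof. by case: x. Qed.
Lemma cReJ x : Re x^* = Re x. Proof. by case: x. Qed.
Lemma cImJ x : Im x^* = - Im x. Proof. by case: x. Qed.
Lemma ceqP x y : Re x = Re y -> Im x = Im y -> x = y.
Proof. by case: x => a b; case: y => c d /= -> ->. Qed.
Lemma cconjK x : x^*^* = x. Proof. by apply: ceqP; rewrite ?cReJ ?cImJ ?opprK. Qed.
Lemma cconj0 : (0 : C)^* = 0. Proof. exact: rmorph0. Qed.
Lemma cconj_real (u : R) : u%:C^* = u%:C.
Proof. by apply: ceqP; rewrite ?cReJ ?cImJ //= oppr0. Qed.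
Lemma conjcM x y : (x * y)^* = x^* * y^*. Proof. exact: rmorphM. Qed.
Lemma conjcB x y : (x - y)^* = x^* - y^*. Proof. exact: rmorphB. Qed.

Lemma cabs2 z : cabs z ^+ 2 = Re z ^+ 2 + Im z ^+ 2.
Proof. by case: z => u v /=; rewrite sqr_sqrtr// addr_ge0// sqr_ge0. Qed.

Lemma cabs_ge0 z : 0 <= cabs z.
Proof. by case: z => u v /=; rewrite sqrtr_ge0. Qed.

Lemma cabs2_conj z : (cabs z ^+ 2)%:C = z * z^*.
Proof.
apply: ceqP; rewrite ?cReM ?cImM cReJ cImJ/= ?cabs2; first by ring.
by ring.
Qed.

Lemma cabsJ z : cabs z^* = cabs z.
Proof. by case: z => u v /=; rewrite sqrrN. Qed.

Lemma cabs_real (u : R) : cabs u%:C = `|u|.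
Proof. by rewrite /= expr0n/= addr0 sqrtr_sqr. Qed.

Lemma cabs_Re z : `|Re z| <= cabs z.
Proof.
by rewrite -(@ler_pXn2r _ 2%N) ?nnegrE ?cabs_ge0// cabs2 real_normK ?num_real// lerDl sqr_ge0.
Qed.

Lemma cabs_Im z : `|Im z| <= cabs z.
Proof.
by rewrite -(@ler_pXn2r _ 2%N) ?nnegrE ?cabs_ge0// cabs2 real_normK ?num_real// lerDr sqr_ge0.
Qed.

Lemma cabs_le z : cabs z <= `|Re z| + `|Im z|.
Proof.
rewrite -(@ler_pXn2r _ 2%N) ?nnegrE ?cabs_ge0 ?addr_ge0// cabs2 sqrrD.
by rewrite !real_normK ?num_real// addrAC lerDl mulrn_wge0// mulr_ge0.
Qed.

Lemma cabs_eq0 z : cabs z = 0 -> z = 0. Proof. exact: Normc.eq0_normc. Qed.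
Lemma cabsM x y : cabs (x * y) = cabs x * cabs y. Proof. exact: Normc.normcM. Qed.
Lemma cabsD x y : cabs (x + y) <= cabs x + cabs y. Proof. exact: le_normcD. Qed.
Lemma cabsN x : cabs (- x) = cabs x. Proof. exact: normcN. Qed.
Lemma cabs0 : cabs 0 = 0. Proof. exact: Normc.normc0. Qed.

Lemma cabs_sum (I : Type) (s : seq I) (P : pred I) (F : I -> C) :
  cabs (\sum_(i <- s | P i) F i) <= \sum_(i <- s | P i) cabs (F i).
Proof.
elim/big_ind2 : _ => //; first by rewrite cabs0.
by move=> x1 x2 y1 y2 h1 h2; rewrite (le_trans (cabsD _ _))// lerD.
Qed.

End complex_numbers.

Section complex_integral.
Variables (R : realType) (d : nat).
Local Notation E := 'rV[R]_d.
Local Notation mu := (rV_lebesgue R d).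
Local Notation C := R[i].
Local Notation cabs := (@Normc.normc R).
Implicit Types (h k : E -> C) (f : E -> R).

Lemma cmeasurable_real f : measurable_fun setT f -> cmeasurable (fun x => (f x)%:C).
Proof.
move=> mf; split; first exact: mf.
by have : measurable_fun [set: E] (cst (0 : R)).
Qed.

Lemma cmeasurable_cst c : cmeasurable (fun _ : E => c : C).
Proof.
split.
  by have : measurable_fun [set: E] (cst (complex.Re c)).
by have : measurable_fun [set: E] (cst (complex.Im c)).
Qed.

Lemma cmeasurableD h k : cmeasurable h -> cmeasurable k ->
  cmeasurable (fun x => h x + k x).
Proof.
move=> [h1 h2] [k1 k2]; split.
  have := measurable_funD h1 k1; congr (measurable_fun _ _).
  by apply/funext => x /=; rewrite /cRe cReD.
have := measurable_funD h2 k2; congr (measurable_fun _ _).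
by apply/funext => x /=; rewrite /cIm cImD.
Qed.

Lemma cmeasurableM h k : cmeasurable h -> cmeasurable k ->
  cmeasurable (fun x => h x * k x).
Proof.
move=> [h1 h2] [k1 k2]; split.
  have := measurable_funB (measurable_funM h1 k1) (measurable_funM h2 k2).
  by congr (measurable_fun _ _); apply/funext => x /=; rewrite /cRe /cIm cReM.
have := measurable_funD (measurable_funM h1 k2) (measurable_funM h2 k1).
by congr (measurable_fun _ _); apply/funext => x /=; rewrite /cRe /cIm cImM.
Qed.

Lemma cmeasurableJ h : cmeasurable h -> cmeasurable (fun x => (h x)^*).
Proof.
move=> [h1 h2]; split.
  by move: h1; congr (measurable_fun _ _); apply/funext => x /=; rewrite /cRe cReJ.
have := measurable_funN h2; congr (measurable_fun _ _).
by apply/funext => x /=; rewrite /cIm cImJ.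
Qed.

Lemma cmeasurable_sum (I : Type) (s : seq I) (F : I -> E -> C) :
  (forall i, cmeasurable (F i)) -> cmeasurable (fun x => \sum_(i <- s) F i x).
Proof.
move=> mF; elim: s => [|i s IH].
  by under eq_fun do rewrite big_nil; exact: cmeasurable_cst.
by under eq_fun do rewrite big_cons; exact: cmeasurableD.
Qed.

Lemma cmeasurable_cabs2 h : cmeasurable h ->
  measurable_fun setT (fun x => cabs (h x) ^+ 2).
Proof.
move=> [h1 h2].
have := measurable_funD (measurable_funX 2 h1) (measurable_funX 2 h2).
by congr (measurable_fun _ _); apply/funext => x /=; rewrite cabs2.
Qed.

Lemma emeasurable_cabs2 h : cmeasurable h ->
  measurable_fun setT (fun x => (cabs (h x) ^+ 2)%:E).
Proof. by move=> mh; apply/measurable_EFinP; exact: cmeasurable_cabs2. Qed.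

Lemma cmeasurable_cabs h : cmeasurable h -> measurable_fun setT (fun x => cabs (h x)).
Proof.
move=> mh; have := measurableT_comp (continuous_measurable_fun (@sqrt_continuous R)) (cmeasurable_cabs2 mh).
congr (measurable_fun _ _); apply/funext => x /=.
by rewrite sqrtr_sqr ger0_norm// cabs_ge0.
Qed.

Definition cintegrable h := mu.-integrable setT (EFin \o cRe h) /\
  mu.-integrable setT (EFin \o cIm h).

Lemma cintegrable_cmeasurable h : cintegrable h -> cmeasurable h.
Proof.
by move=> [/integrableP[h1 _] /integrableP[h2 _]]; split; apply/measurable_EFinP.
Qed.

Lemma le_cintegrable h (f : E -> R) : cmeasurable h ->
  mu.-integrable setT (EFin \o f) -> (forall x, cabs (h x) <= f x) ->
  cintegrable h.
Proof.
move=> [h1 h2] fi hf; split.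
  apply: le_integrable fi => //; first exact/measurable_EFinP.
  move=> x _ /=; rewrite lee_fin (le_trans (cabs_Re _))//.
  exact: le_trans (hf x) (ler_norm _).
apply: le_integrable fi => //; first exact/measurable_EFinP.
move=> x _ /=; rewrite lee_fin (le_trans (cabs_Im _))//.
exact: le_trans (hf x) (ler_norm _).
Qed.

Lemma cintegrable_cabs h : cintegrable h ->
  mu.-integrable setT (EFin \o (fun x => cabs (h x))).
Proof.
move=> ih; have [h1 h2] := ih.
have := integrableD measurableT (integrable_abse h1) (integrable_abse h2).
apply: le_integrable => //.
  by apply/measurable_EFinP; apply: cmeasurable_cabs; exact: cintegrable_cmeasurable.
move=> x _ /=; rewrite lee_fin ger0_norm ?cabs_ge0//.
exact: le_trans (cabs_le _) (ler_norm _).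
Qed.

Lemma cintegrable0 : cintegrable (fun=> 0).
Proof. by split; exact: integrable0. Qed.

Lemma cintegrableD h k : cintegrable h -> cintegrable k ->
  cintegrable (fun x => h x + k x).
Proof.
move=> [h1 h2] [k1 k2]; split.
  have := integrableD measurableT h1 k1; apply: eq_integrable => // x _ /=.
  by rewrite /cRe cReD.
have := integrableD measurableT h2 k2; apply: eq_integrable => // x _ /=.
by rewrite /cIm cImD.
Qed.

Lemma cintegrableZ c h : cintegrable h -> cintegrable (fun x => c * h x).
Proof.
move=> ih.
apply: (@le_cintegrable _ (fun x => cabs c * cabs (h x))).
- by apply: cmeasurableM; [exact: cmeasurable_cst|exact: cintegrable_cmeasurable].
- have := integrableZl measurableT (cabs c) (cintegrable_cabs ih).
  by apply: eq_integrable.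
- by move=> x; rewrite cabsM.
Qed.

Lemma cintegrable_sum (I : Type) (s : seq I) (F : I -> E -> C) :
  (forall i, cintegrable (F i)) -> cintegrable (fun x => \sum_(i <- s) F i x).
Proof.
move=> mF; elim: s => [|i s IH].
  by under eq_fun do rewrite big_nil; exact: cintegrable0.
by under eq_fun do rewrite big_cons; exact: cintegrableD.
Qed.

Lemma eq_cint h k : (forall x, h x = k x) -> cint h = cint k.
Proof. by move=> hk; congr cint; apply/funext. Qed.

Lemma cint0 : cint (fun _ : E => 0) = 0.
Proof. by rewrite /cint !Rintegral_cst// !mul0r. Qed.

Lemma cintD h k : cintegrable h -> cintegrable k ->
  cint (fun x => h x + k x) = cint h + cint k.
Proof.
move=> [h1 h2] [k1 k2]; apply: ceqP; rewrite ?cReD ?cImD /= -RintegralD//;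
  by apply: eq_Rintegral => x _; rewrite /cRe /cIm ?cReD ?cImD.
Qed.

Lemma cintZ c h : cintegrable h -> cint (fun x => c * h x) = c * cint h.
Proof.
move=> [h1 h2]; apply: ceqP; rewrite ?cReM ?cImM /= -!RintegralZl//.
  rewrite -RintegralB//; last 2 first.
  - by have := integrableZl measurableT (complex.Re c) h1; apply: eq_integrable.
  - by have := integrableZl measurableT (complex.Im c) h2; apply: eq_integrable.
  by apply: eq_Rintegral => x _; rewrite /cRe /cIm cReM.
rewrite -RintegralD//; last 2 first.
- by have := integrableZl measurableT (complex.Re c) h2; apply: eq_integrable.
- by have := integrableZl measurableT (complex.Im c) h1; apply: eq_integrable.
by apply: eq_Rintegral => x _; rewrite /cRe /cIm cImM.
Qed.

Lemma cintB h k : cintegrable h -> cintegrable k ->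
  cint (fun x => h x - k x) = cint h - cint k.
Proof.
move=> ih ik; rewrite -[- cint k]mulN1r -cintZ// -cintD//; last exact: cintegrableZ.
by apply: eq_cint => x; rewrite mulN1r.
Qed.

Lemma cintJ h : cintegrable h -> cint (fun x => (h x)^*) = (cint h)^*.
Proof.
move=> [h1 h2]; apply: ceqP; rewrite ?cReJ ?cImJ /=.
  by apply: eq_Rintegral => x _; rewrite /cRe cReJ.
rewrite -mulN1r -RintegralZl//.
by apply: eq_Rintegral => x _; rewrite /cIm cImJ mulN1r.
Qed.

Lemma cint_sum (I : Type) (s : seq I) (F : I -> E -> C) :
  (forall i, cintegrable (F i)) ->
  cint (fun x => \sum_(i <- s) F i x) = \sum_(i <- s) cint (F i).
Proof.
move=> mF; elim: s => [|i s IH].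
  by rewrite big_nil -[RHS]cint0; apply: eq_cint => x; rewrite big_nil.
rewrite big_cons -IH -cintD//; last exact: cintegrable_sum.
by apply: eq_cint => x; rewrite big_cons.
Qed.

Lemma ae_eq_cint h k : cmeasurable h -> cmeasurable k ->
  {ae mu, forall x, h x = k x} -> cint h = cint k.
Proof.
move=> [h1 h2] [k1 k2] hk; rewrite /cint /Rintegral; congr (fine _ +i* fine _).
  apply: ae_eq_integral => //; [exact/measurable_EFinP..|].
  by apply: filterS hk => x hk _; rewrite /cRe hk.
apply: ae_eq_integral => //; [exact/measurable_EFinP..|].
by apply: filterS hk => x hk _; rewrite /cIm hk.
Qed.

(** The factor 2 comes from bounding the real and imaginary parts separately. *)
Lemma cint_le h : cintegrable h ->
  cabs (cint h) <= 2 * Rintegral mu setT (fun x => cabs (h x)).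
Proof.
move=> ih; have [h1 h2] := ih; have ha := cintegrable_cabs ih.
rewrite (le_trans (cabs_le _))// mulrDl !mul1r lerD//=.
  rewrite (le_trans (le_normr_Rintegral _ h1))// le_Rintegral//.
  - exact: integrable_norm.
  - by move=> x _; exact: cabs_Re.
rewrite (le_trans (le_normr_Rintegral _ h2))// le_Rintegral//.
- exact: integrable_norm.
- by move=> x _; exact: cabs_Im.
Qed.

(** The squared L^2 norm, possibly infinite. *)
Definition sqn h : \bar R := (\int[mu]_x (cabs (h x) ^+ 2)%:E)%E.

Definition L2 h := cmeasurable h /\ (sqn h < +oo)%E.

Lemma sqn_ge0 h : (0 <= sqn h)%E.
Proof. by apply: integral_ge0 => x _; rewrite lee_fin sqr_ge0. Qed.

Lemma LpN2E h : LpN 2 h = (sqn h `^ 2^-1)%E.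
Proof.
rewrite /LpN Lnorm.unlock/=; congr (_ `^ _)%E; apply: eq_integral => x _.
by rewrite /= powR_mulrn ?cabs_ge0// ger0_norm ?cabs_ge0.
Qed.

Lemma le_sqn h k : cmeasurable h -> cmeasurable k ->
  (forall x, cabs (h x) <= cabs (k x)) -> (sqn h <= sqn k)%E.
Proof.
move=> mh mk hk; apply: ge0_le_integral => //.
- by move=> x _; rewrite lee_fin sqr_ge0.
- exact: emeasurable_cabs2.
- exact: emeasurable_cabs2.
- by move=> x _; rewrite lee_fin lerXn2r// nnegrE cabs_ge0.
Qed.

Lemma ae_eq_sqn h k : cmeasurable h -> cmeasurable k ->
  {ae mu, forall x, h x = k x} -> sqn h = sqn k.
Proof.
move=> mh mk hk; apply: ae_eq_integral => //.
- exact: emeasurable_cabs2.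
- exact: emeasurable_cabs2.
- by apply: filterS hk => x -> _.
Qed.

Lemma L2_integrable h : L2 h ->
  mu.-integrable setT (EFin \o (fun x => cabs (h x) ^+ 2)).
Proof.
move=> [mh h2]; apply/integrableP; split.
  exact: emeasurable_cabs2.
move: h2; congr (_ < _)%E; apply: eq_integral => x _.
by rewrite /= ger0_norm// sqr_ge0.
Qed.

Lemma L2M_cintegrable h k : L2 h -> L2 k -> cintegrable (fun x => h x * k x).
Proof.
move=> Lh Lk; apply: (@le_cintegrable _ (fun x => cabs (h x) ^+ 2 + cabs (k x) ^+ 2)).
- by apply: cmeasurableM; [case: Lh|case: Lk].
- have := integrableD measurableT (L2_integrable Lh) (L2_integrable Lk).
  by apply: eq_integrable.
move=> x; rewrite cabsM; have := sqr_ge0 (cabs (h x) - cabs (k x)).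
have := mulr_ge0 (cabs_ge0 (h x)) (cabs_ge0 (k x)).
set u := cabs _; set v := cabs _ => uv0; rewrite sqrrB; lra.
Qed.

Lemma L2D h k : L2 h -> L2 k -> L2 (fun x => h x + k x).
Proof.
move=> Lh Lk; have [mh _] := Lh; have [mk _] := Lk.
split; first exact: cmeasurableD.
have := integrableD measurableT (L2_integrable Lh) (L2_integrable Lk).
move=> /(integrableZl measurableT 2)/integrableP[_]; apply: le_lt_trans.
apply: ge0_le_integral => //.
- by move=> x _; rewrite lee_fin sqr_ge0.
- by apply/measurable_EFinP; apply: cmeasurable_cabs2; exact: cmeasurableD.
- apply: measurableT_comp => //; apply/measurable_EFinP.
  by apply: measurable_funM => //; apply: measurable_funD; exact: cmeasurable_cabs2.
move=> x _; rewrite /= lee_fin ger0_norm; last first.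
  by rewrite mulr_ge0// addr_ge0// sqr_ge0.
have : cabs (h x + k x) ^+ 2 <= (cabs (h x) + cabs (k x)) ^+ 2.
  by rewrite lerXn2r ?nnegrE ?addr_ge0 ?cabs_ge0//; exact: cabsD.
have := sqr_ge0 (cabs (h x) - cabs (k x)).
by rewrite sqrrB sqrrD; set u := cabs _; set v := cabs _; set w := cabs _; lra.
Qed.

Lemma L2Z c h : L2 h -> L2 (fun x => c * h x).
Proof.
move=> Lh; have [mh _] := Lh; split.
  by apply: cmeasurableM => //; exact: cmeasurable_cst.
have /integrableP[_] := integrableZl measurableT (cabs c ^+ 2) (L2_integrable Lh).
congr (_ < _)%E; apply: eq_integral => x _.
by rewrite /= cabsM exprMn ger0_norm// mulr_ge0// sqr_ge0.
Qed.

Lemma L2_0 : L2 (fun=> 0).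
Proof.
split; first exact: cmeasurable_cst.
by rewrite /sqn; under eq_integral do rewrite cabs0 expr0n; rewrite integral0 ltry.
Qed.

Lemma L2B h k : L2 h -> L2 k -> L2 (fun x => h x - k x).
Proof.
move=> Lh /(L2Z (-1)) Lk; have := L2D Lh Lk.
by congr L2; apply/funext => x; rewrite mulN1r.
Qed.

Lemma L2J h : L2 h -> L2 (fun x => (h x)^*).
Proof.
move=> [mh h2]; split; first exact: cmeasurableJ.
by move: h2; congr (_ < _)%E; apply: eq_integral => x _; rewrite cabsJ.
Qed.

Lemma L2_sum (I : Type) (s : seq I) (F : I -> E -> C) :
  (forall i, L2 (F i)) -> L2 (fun x => \sum_(i <- s) F i x).
Proof.
move=> mF; elim: s => [|i s IH].
  by under eq_fun do rewrite big_nil; exact: L2_0.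
by under eq_fun do rewrite big_cons; exact: L2D.
Qed.

Lemma sqn_inner h : L2 h -> sqn h = (complex.Re (inner h h))%:E.
Proof.
move=> Lh; rewrite /inner /cint/= /Rintegral fineK; last first.
  by apply: integrable_fin_num => //; have [] := L2M_cintegrable Lh (L2J Lh).
by apply: eq_integral => x _; rewrite /cRe -cabs2_conj.
Qed.

(** A form of the Cauchy-Schwarz inequality without square roots; the
    parameter e balances the two factors. *)
Lemma inner_le h k (e : R) : L2 h -> L2 k -> 0 < e ->
  ((cabs (inner h k))%:E <= e%:E * sqn h + e^-1%:E * sqn k)%E.
Proof.
move=> Lh Lk e0.
have hk := L2M_cintegrable Lh (L2J Lk).
apply: (@le_trans _ _ (2 * Rintegral mu setT (fun x => cabs (h x * (k x)^*)))%:E).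
  by rewrite lee_fin; exact: cint_le.
have ik := cintegrable_cabs hk.
rewrite -RintegralZl// /Rintegral fineK; last first.
  apply: integrable_fin_num => //.
  by have := integrableZl measurableT 2 ik; apply: eq_integrable.
have [mh _] := Lh; have [mk _] := Lk.
rewrite /sqn -!ge0_integralZl_EFin//; first last.
- exact: ltW.
- exact: emeasurable_cabs2.
- by move=> x _; rewrite lee_fin sqr_ge0.
- by rewrite invr_ge0 ltW.
- exact: emeasurable_cabs2.
- by move=> x _; rewrite lee_fin sqr_ge0.
rewrite -ge0_integralD//; first last.
- by apply/measurable_EFinP; apply: measurable_funM => //; exact: cmeasurable_cabs2.
- by move=> x _; rewrite lee_fin mulr_ge0 ?sqr_ge0// invr_ge0 ltW.
- by apply/measurable_EFinP; apply: measurable_funM => //; exact: cmeasurable_cabs2.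
- by move=> x _; rewrite lee_fin mulr_ge0 ?sqr_ge0// ltW.
apply: ge0_le_integral => //.
- by move=> x _; rewrite lee_fin mulr_ge0// cabs_ge0.
- by have := integrableZl measurableT 2 ik => /integrableP[].
- by apply/measurable_EFinP; apply: measurable_funD; apply: measurable_funM => //; exact: cmeasurable_cabs2.
move=> x _; rewrite lee_fin cabsM cabsJ.
set u := cabs (h x); set v := cabs (k x).
rewrite -subr_ge0.
have -> : e * u ^+ 2 + e^-1 * v ^+ 2 - 2 * (u * v) = e^-1 * (e * u - v) ^+ 2.
  by field; rewrite gt_eqF.
by rewrite mulr_ge0 ?sqr_ge0// invr_ge0 ltW.
Qed.

End complex_integral.

(** * Exponentials on a box: Bessel's inequality *)

Section inner_product.
Variables (R : realType) (d : nat).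
Local Notation E := 'rV[R]_d.
Local Notation mu := (rV_lebesgue R d).
Local Notation C := R[i].
Local Notation cabs := (@Normc.normc R).
Implicit Types (h k : E -> C).

Lemma inner_integrable h k : L2 h -> L2 k -> cintegrable (fun x => h x * (k x)^*).
Proof. by move=> Lh Lk; apply: L2M_cintegrable => //; exact: L2J. Qed.

Lemma innerJ h k : L2 h -> L2 k -> inner k h = (inner h k)^*.
Proof.
move=> Lh Lk; rewrite -cintJ; last exact: inner_integrable.
by apply: eq_cint => x; rewrite conjcM cconjK mulrC.
Qed.

Lemma innerBl h1 h2 k : L2 h1 -> L2 h2 -> L2 k ->
  inner (fun x => h1 x - h2 x) k = inner h1 k - inner h2 k.
Proof.
move=> L1 L2_ Lk; rewrite /inner -cintB; [|exact: inner_integrable..].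
by apply: eq_cint => x; rewrite mulrBl.
Qed.

Lemma innerDl h1 h2 k : L2 h1 -> L2 h2 -> L2 k ->
  inner (fun x => h1 x + h2 x) k = inner h1 k + inner h2 k.
Proof.
move=> L1 L2_ Lk; rewrite /inner -cintD; [|exact: inner_integrable..].
by apply: eq_cint => x; rewrite mulrDl.
Qed.

Lemma innerZl c h k : L2 h -> L2 k ->
  inner (fun x => c * h x) k = c * inner h k.
Proof.
move=> L1 Lk; rewrite /inner -cintZ; last exact: inner_integrable.
by apply: eq_cint => x; rewrite mulrA.
Qed.

Lemma inner_suml (I : Type) (s : seq I) (F : I -> E -> C) k :
  (forall i, L2 (F i)) -> L2 k ->
  inner (fun x => \sum_(i <- s) F i x) k = \sum_(i <- s) inner (F i) k.
Proof.
move=> LF Lk; rewrite /inner -cint_sum; last by move=> i; exact: inner_integrable.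
by apply: eq_cint => x; rewrite mulr_suml.
Qed.

Lemma ae_eq_inner h h' k : cmeasurable h -> cmeasurable h' -> cmeasurable k ->
  {ae mu, forall x, h x = h' x} -> inner h k = inner h' k.
Proof.
move=> mh mh' mk hh'; apply: ae_eq_cint.
- by apply: cmeasurableM => //; exact: cmeasurableJ.
- by apply: cmeasurableM => //; exact: cmeasurableJ.
- by apply: filterS hh' => x ->.
Qed.

End inner_product.

Section box_exponentials.
Variables (R : realType) (d : nat).
Local Notation E := 'rV[R]_d.
Local Notation Z := 'rV[int]_d.
Local Notation mu := (rV_lebesgue R d).
Local Notation C := R[i].
Local Notation cabs := (@Normc.normc R).

Definition expi (b : R) (m : Z) (x : E) : C :=
  cos (phase b m x) +i* sin (phase b m x).

Lemma cabs_expi b m x : cabs (expi b m x) = 1.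
Proof. by rewrite /= cos2Dsin2 sqrtr1. Qed.

Lemma expi0 b x : expi b 0 x = 1.
Proof.
by rewrite /expi -(subrr 0) phaseD phaseN subrr cos0 sin0.
Qed.

Lemma expiB b m m' x : expi b m x * (expi b m' x)^* = expi b (m - m') x.
Proof.
rewrite /expi phaseD phaseN cosB sinB /=; apply: ceqP => /=; ring.
Qed.

Lemma cmeasurable_expi b m : cmeasurable (expi b m).
Proof.
split.
  apply: (measurableT_comp _ (measurable_phase b m)).
  by apply: continuous_measurable_fun; exact: continuous_cos.
apply: (measurableT_comp _ (measurable_phase b m)).
by apply: continuous_measurable_fun; exact: continuous_sin.
Qed.

Variables (a : E) (b : R).
Hypothesis b0 : 0 < b.
Let B := obox a b^-1.
Let V : R := b^-1 ^+ d.

Let V0 : 0 < V. Proof. by rewrite exprn_gt0// invr_gt0. Qed.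

Definition ebox (m : Z) (x : E) : C := (\1_B x)%:C * expi b m x.

Lemma obox_measure : mu B = V%:E.
Proof.
have [i1 _ e1 _] := Rintegral_phase a 0 b0.
have e (x : E) : \1_B x * cos (phase b 0 x) = \1_B x :> R.
  by rewrite -[0](subrr 0) phaseD phaseN subrr cos0 mulr1.
have i2 : mu.-integrable setT (EFin \o (\1_B : E -> R)).
  by apply: eq_integrable i1 => // x _ /=; rewrite e.
have e2 : Rintegral mu setT (\1_B : E -> R) = V.
  by rewrite eqxx mul1r in e1; rewrite -[RHS]e1; apply: eq_Rintegral => x _; rewrite e.
rewrite -[in RHS]e2 /Rintegral fineK; last exact: integrable_fin_num.
by rewrite integral_indic ?setIT//; exact: measurable_obox.
Qed.

Lemma cmeasurable_ebox m : cmeasurable (ebox m).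
Proof.
apply: cmeasurableM; last exact: cmeasurable_expi.
by apply: cmeasurable_real; apply: measurable_indic; exact: measurable_obox.
Qed.

Lemma ebox_off m x : ~ B x -> ebox m x = 0.
Proof. by move=> nB; rewrite /ebox indicE memNset//= mul0r. Qed.

Lemma cabs_ebox m x : cabs (ebox m x) = \1_B x.
Proof. by rewrite /ebox cabsM cabs_expi mulr1 cabs_real ger0_norm. Qed.

Lemma sqn_ebox m : sqn (ebox m) = V%:E.
Proof.
rewrite -obox_measure /sqn; transitivity (\int[mu]_x (\1_B x)%:E)%E.
  apply: eq_integral => x _; rewrite cabs_ebox indicE.
  by case: (_ \in _); rewrite ?expr1n ?expr0n.
by rewrite integral_indic ?setIT//; exact: measurable_obox.
Qed.

Lemma L2_ebox m : L2 (ebox m).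
Proof. by split; [exact: cmeasurable_ebox|rewrite sqn_ebox ltry]. Qed.

Lemma inner_ebox m m' : inner (ebox m) (ebox m') = ((m == m')%:R * V)%:C.
Proof.
have [_ _ e1 e2] := Rintegral_phase a (m - m') b0.
have e x : ebox m x * (ebox m' x)^* = (\1_B x)%:C * expi b (m - m') x.
  rewrite /ebox conjcM mulrACA expiB; congr (_ * _).
  rewrite indicE; case: (_ \in _) => /=; apply: ceqP => /=; ring.
rewrite /inner (eq_cint e) -subr_eq0 -[(m - m' == 0)%:R * V]e1.
apply: ceqP => /=; last rewrite -[RHS]e2; apply: eq_Rintegral => x _;
  by rewrite /cRe /cIm ?cReM ?cImM /= mul0r ?subr0 ?addr0.
Qed.

Lemma inner_ebox_off h m : (forall x, ~ B x -> h x = 0) ->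
  inner h (ebox m) = inner h (expi b m).
Proof.
move=> h0; apply: eq_cint => x; have [Bx|/h0 ->] := pselect (B x); last by rewrite !mul0r.
by rewrite /ebox indicE mem_set//= mul1r.
Qed.

Definition epoly (c : Z -> C) (A : {fset Z}) (x : E) : C :=
  \sum_(m <- A) c m * ebox m x.

Lemma L2_epoly c A : L2 (epoly c A).
Proof. by apply: L2_sum => m; apply: L2Z; exact: L2_ebox. Qed.

Lemma epoly_off c A x : ~ B x -> epoly c A x = 0.
Proof. by move=> nB; rewrite /epoly big1// => m _; rewrite ebox_off// mulr0. Qed.

Lemma inner_epoly c A m : inner (epoly c A) (ebox m) = if m \in A then c m * V%:C else 0.
Proof.
rewrite inner_suml; last 2 first.
- by move=> i; apply: L2Z; exact: L2_ebox.
- exact: L2_ebox.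
have [mA|mA] := boolP (m \in A).
  rewrite (big_fsetD1 m)//= [X in _ + X]big1_fset ?addr0.
    by rewrite innerZl ?inner_ebox ?eqxx ?mul1r//; exact: L2_ebox.
  move=> i; rewrite !inE/= => /andP[/negbTE im _] _.
  by rewrite innerZl ?inner_ebox ?im ?mul0r ?mulr0//; exact: L2_ebox.
rewrite big1_fset// => i iA _.
rewrite innerZl ?inner_ebox//; [|exact: L2_ebox..].
by case: eqP iA mA => [-> ->//|_ _ _]; rewrite mul0r mulr0.
Qed.

Lemma inner_epolyr c A F : L2 F ->
  inner (epoly c A) F = \sum_(m <- A) c m * (inner F (ebox m))^*.
Proof.
move=> LF; rewrite inner_suml//; last by move=> i; apply: L2Z; exact: L2_ebox.
apply: eq_bigr => m _; rewrite innerZl//; last exact: L2_ebox.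
by rewrite (innerJ LF)//; exact: L2_ebox.
Qed.

Lemma sqn_epoly c A : sqn (epoly c A) = (V * \sum_(m <- A) cabs (c m) ^+ 2)%:E.
Proof.
rewrite sqn_inner; last exact: L2_epoly.
rewrite inner_epolyr; last exact: L2_epoly.
congr EFin; rewrite -[RHS]/(complex.Re (V * \sum_(m <- A) cabs (c m) ^+ 2)%:C).
congr complex.Re; rewrite [RHS]rmorphM rmorph_sum mulr_sumr big_seq [RHS]big_seq.
apply: eq_bigr => m mA; rewrite inner_epoly mA conjcM cconj_real.
by rewrite mulrA -cabs2_conj mulrC.
Qed.

(** The squared norm of F minus its orthogonal projection is non-negative. *)
Lemma bessel_fset F (A : {fset Z}) : L2 F ->
  (\sum_(m <- A) (cabs (inner F (ebox m)) ^+ 2)%:E <= V%:E * sqn F)%E.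
Proof.
move=> LF; pose c m : C := (V^-1)%:C * inner F (ebox m).
pose S := epoly c A.
have LS : L2 S by exact: L2_epoly.
have LFS := L2B LF LS.
have := sqn_ge0 (fun x => F x - S x).
rewrite (sqn_inner LFS) lee_fin innerBl//.
rewrite (innerJ LFS LF) (innerJ LFS LS) !innerBl//.
have eSF : inner S F = (V^-1 * \sum_(m <- A) cabs (inner F (ebox m)) ^+ 2)%:C.
  rewrite /S inner_epolyr// rmorphM rmorph_sum/= mulr_sumr.
  by apply: eq_bigr => m _; rewrite /c -mulrA -cabs2_conj.
have eFS : inner F S = inner S F by rewrite (innerJ LS LF) eSF cconj_real.
have eSS : inner S S = inner S F.
  rewrite /S inner_epolyr// eSF rmorphM rmorph_sum mulr_sumr big_seq [RHS]big_seq.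
  apply: eq_bigr => m mA; rewrite inner_epoly mA conjcM cconj_real /c conjcM cconj_real.
  have VV : (V^-1)%:C * V%:C = 1 :> C by rewrite -rmorphM mulVf ?gt_eqF.
  transitivity ((V^-1)%:C * (inner F (ebox m) * (inner F (ebox m))^*)).
    by rewrite -[RHS]mulr1 -VV; ring.
  by rewrite -cabs2_conj.
rewrite eFS eSS subrr cconj0 subr0 conjcB eSF cconj_real cReD cReJ cReN /=.
rewrite sumEFin (sqn_inner LF) -EFinM lee_fin subr_ge0.
by rewrite ler_pdivrMl.
Qed.

Lemma bessel F : L2 F ->
  (\esum_(m in [set: Z]) (cabs (inner F (ebox m)) ^+ 2)%:E <= V%:E * sqn F)%E.
Proof. by move=> LF; apply: esum_le_fset => A; exact: bessel_fset. Qed.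

End box_exponentials.

(** * The Riesz-Fischer theorem *)

Section square_integrable_limits.
Variables (R : realType) (d : nat).
Local Notation E := 'rV[R]_d.
Local Notation mu := (rV_lebesgue R d).
Local Notation C := R[i].
Local Notation cabs := (@Normc.normc R).
Implicit Types (h : E -> C).

Lemma limn_einf_le (u : nat -> \bar R) M : (forall n, u n <= M)%E -> (limn_einf u <= M)%E.
Proof.
move=> uM; rewrite limn_einf_lim; apply: lime_le; first exact: is_cvg_einfs.
apply: nearW => n; apply: le_trans (uM n).
by apply: ereal_inf_lbound; exists n => /=.
Qed.

(** Real and imaginary parts are kept apart so that the limit theorems for
    real functions apply. *)
Definition ccvg (H : nat -> E -> C) h := forall x,
  complex.Re (H n x) @[n --> \oo] --> complex.Re (h x) /\
  complex.Im (H n x) @[n --> \oo] --> complex.Im (h x).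

Lemma ccvg_cmeasurable (H : nat -> E -> C) h :
  (forall n, cmeasurable (H n)) -> ccvg H h -> cmeasurable h.
Proof.
move=> mH cH; split.
  by apply: (measurable_fun_cvg (h := fun n => cRe (H n))) => [n|x _]; [have [] := mH n|have [] := cH x].
by apply: (measurable_fun_cvg (h := fun n => cIm (H n))) => [n|x _]; [have [] := mH n|have [] := cH x].
Qed.

Lemma sqn_fatou (H : nat -> E -> C) h M : (forall n, cmeasurable (H n)) ->
  ccvg H h -> (forall n, sqn (H n) <= M)%E -> (sqn h <= M)%E.
Proof.
move=> mH cH HM.
have := @fatou _ _ _ mu setT measurableT (fun n x => (cabs (H n x) ^+ 2)%:E).
move=> /(_ (fun n => emeasurable_cabs2 (mH n))).
have nn n x : [set: E] x -> (0 <= (cabs (H n x) ^+ 2)%:E)%E by rewrite lee_fin sqr_ge0.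
move=> /(_ nn) Fa; apply: le_trans (limn_einf_le HM); apply: le_trans Fa.
rewrite /sqn (_ : (fun x => _) = (fun x => limn_einf (fun n => (cabs (H n x) ^+ 2)%:E))).
  exact: lexx.
apply/funext => x; have [c1 c2] := cH x.
have : (cabs (H n x) ^+ 2)%:E @[n --> \oo] --> (cabs (h x) ^+ 2)%:E.
  apply/fine_cvgP; split; first exact: nearW.
  rewrite /comp /=; under eq_fun do rewrite cabs2; rewrite cabs2.
  by apply: cvgD; rewrite expr2; under eq_fun do rewrite expr2; exact: cvgM.
by move=> /cvg_limn_einf_sup[-> _].
Qed.

End square_integrable_limits.

Section riesz_fischer.
Variables (R : realType) (d : nat).
Local Notation E := 'rV[R]_d.
Local Notation Z := 'rV[int]_d.
Local Notation mu := (rV_lebesgue R d).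
Local Notation C := R[i].
Local Notation cabs := (@Normc.normc R).
Variables (a : E) (b : R).
Hypothesis b0 : 0 < b.
Local Notation B := (obox a b^-1).
Local Notation V := (b^-1 ^+ d).
Local Notation ep := (epoly a b).

Let V0 : 0 < V. Proof. by rewrite exprn_gt0// invr_gt0. Qed.

Lemma geometric_small (r K : R) : (forall k : nat, r <= K * 2^-1 ^+ k) -> r <= 0.
Proof.
move=> H.
have c : geometric K 2^-1 n @[n --> \oo] --> (0 : R).
  by apply: cvg_geometric; rewrite ger0_norm// invf_lt1// ltr1n.
by apply: (cvgr_to_ge c); apply: nearW => k; exact: H.
Qed.

(** Along finite sets A_k of indices outside of which the squared coefficients
    sum to at most 8^-k, the partial sums converge almost everywhere, since
    sum_k 4^k |S_(k+1) - S_k|^2 is integrable and bounds each |S_(k+1) - S_k|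
    by a multiple of 2^-k where it is finite. Fatou's lemma bounds the limit
    and its distance to the partial sums, which determines its coefficients. *)
Lemma riesz_fischer (c : Z -> C) :
  (\esum_(m in [set: Z]) (cabs (c m) ^+ 2)%:E < +oo)%E ->
  exists F : E -> C, [/\ L2 F, forall x, ~ B x -> F x = 0,
    (sqn F <= V%:E * \esum_(m in [set: Z]) (cabs (c m) ^+ 2)%:E)%E &
    forall m, inner F (ebox a b m) = c m * V%:C].
Proof.
set W := (\esum_(m in _) _)%E => Woo.
have c0 m : (0 <= (cabs (c m) ^+ 2)%:E)%E by rewrite lee_fin sqr_ge0.
pose e k : R := 8^-1 ^+ k.
have e0 k : 0 < e k by rewrite exprn_gt0// invr_gt0.
have /choice[A' HA'] := fun k => esum_tail c0 Woo (e0 k).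
(* The tails were chosen independently for each k; unions make the sets
   increase. *)
have [A [A'A AS]] : exists A : nat -> {fset Z},
    (forall k m, m \in A' k -> m \in A k) /\
    (forall k m, m \in A k -> m \in A k.+1).
  exists (fun k => iteri k.+1 (fun j X => A' j `|` X)%fset fset0).
  split=> k m mA; first by rewrite /= inE mA.
  by rewrite iteriS inE mA orbT.
have AAn k n m : m \in A k -> m \in A (n + k)%N.
  by move=> mA; elim: n => // n IH; exact: AS.
have tail k (X : {fset Z}) : (forall m, m \in X -> m \notin A k) ->
    \sum_(m <- X) cabs (c m) ^+ 2 <= e k.
  move=> XA; rewrite -lee_fin -sumEFin; apply: HA' => m /XA.
  by apply: contra; exact: A'A.
pose S k := ep c (A k).
have SB k n x : S (n + k)%N x - S k x = ep c (A (n + k)%N `\` A k)%fset x.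
  rewrite /S /epoly (big_fsetID _ (mem (A k)) (A (n + k)%N))/=.
  rewrite (_ : [fset m in A (n + k)%N | m \in A k]%fset = A k).
    rewrite addrAC subrr add0r; apply: eq_fbigl => m.
    by rewrite !inE/= andbC.
  apply/fsetP => m; rewrite !inE/=; case: (boolP (m \in A k)) => [/(AAn k n) ->//|_].
  by rewrite ?andbF.
have sqS k n : (sqn (fun x => S (n + k)%N x - S k x)%R <= (V * e k)%:E)%E.
  rewrite (_ : (fun x => _) = ep c (A (n + k)%N `\` A k)%fset); last first.
    by apply/funext => x; exact: SB.
  rewrite sqn_epoly// lee_fin ler_pM2l// tail// => m.
  by rewrite inE => /andP[].
have mS k : cmeasurable (S k) by have [] := L2_epoly a b0 c (A k).
pose D k x := S k.+1 x - S k x.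
have mD k : cmeasurable (D k).
  by have [] := L2B (L2_epoly a b0 c (A k.+1)) (L2_epoly a b0 c (A k)).
pose w k x : \bar R := (4 ^+ k * cabs (D k x) ^+ 2)%:E.
have w0 k x : (0 <= w k x)%E by rewrite lee_fin mulr_ge0 ?sqr_ge0// exprn_ge0.
have mw k : measurable_fun setT (w k).
  by apply/measurable_EFinP; apply: measurable_funM => //; exact: cmeasurable_cabs2.
(* The full set on which the partial sums converge absolutely. They are set to
   0 outside of it, so that they converge everywhere. *)
pose G := [set x : E | (\sum_(k <oo) w k x < +oo)%E].
have mW : measurable_fun setT (fun x => \sum_(k <oo) w k x)%E.
  by apply: ge0_emeasurable_sum.
have iW : (\int[mu]_x (\sum_(k <oo) w k x) < +oo)%E.
  rewrite integral_nneseries//.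
  apply: (@le_lt_trans _ _ (\sum_(k <oo) (geometric V 2^-1 k)%:E)%E).
    apply: lee_nneseries => [k _ _|k _]; first exact: integral_ge0.
    rewrite /w; under eq_integral do rewrite EFinM.
    rewrite ge0_integralZl_EFin//; first last.
    - exact: emeasurable_cabs2.
    - by move=> x _; rewrite lee_fin sqr_ge0.
    apply: (@le_trans _ _ ((4 ^+ k)%:E * (V * e k)%:E)%E).
      by apply: lee_wpmul2l; [rewrite lee_fin exprn_ge0|exact: (sqS k 1%N)].
    rewrite -EFinM lee_fin mulrCA /e -exprMn.
    by rewrite (_ : 4 * 8^-1 = 2^-1 :> R)//; field.
  have gc : cvgn (series (geometric V 2^-1)).
    by apply: is_cvg_geometric_series; rewrite ger0_norm// invf_lt1// ltr1n.
  rewrite (_ : (\sum_(k <oo) (geometric V 2^-1 k)%:E)%E = (limn (series (geometric V 2^-1)))%:E) ?ltry//.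
  rewrite -EFin_lim//; congr (limn _); apply/funext => n.
  by rewrite /= sumEFin.
have aeG : {ae mu, forall x, G x}.
  have : mu.-integrable setT (fun x => \sum_(k <oo) w k x)%E.
    apply/integrableP; split => //; move: iW; congr (_ < _)%E.
    by apply: eq_integral => x _; rewrite gee0_abs//; exact: nneseries_ge0.
  move=> /(integrable_ae measurableT); apply: filterS => x /(_ I).
  by rewrite ge0_fin_numE//; exact: nneseries_ge0.
have mG : measurable G.
  rewrite -[G]setTI; apply: emeasurable_fun_infty_o => //.
pose S' k x : C := (\1_G x)%:C * S k x.
have mS' k : cmeasurable (S' k).
  by apply: cmeasurableM => //; apply: cmeasurable_real; exact: measurable_indic.
have cS x : G x -> exists z : C, complex.Re (S k x) @[k --> \oo] --> complex.Re z /\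
    complex.Im (S k x) @[k --> \oo] --> complex.Im z.
  move=> Gx; pose M := Num.sqrt (fine (\sum_(k <oo) w k x)%E).
  have DM k : cabs (D k x) <= geometric M 2^-1 k.
    have : (w k x <= \sum_(k <oo) w k x)%E.
      rewrite (nneseries_split 0 k.+1)// add0n big_nat_recr//= -[leLHS]adde0 -addeA.
      rewrite -[leLHS]add0e; apply: leeD; first exact: sume_ge0.
      by rewrite leeD2l//; exact: nneseries_ge0.
    rewrite -[X in (_ <= X)%E -> _]fineK ?ge0_fin_numE ?nneseries_ge0// lee_fin => h.
    rewrite /geometric/= -(@ler_pXn2r _ 2%N) ?nnegrE ?cabs_ge0 ?mulr_ge0 ?sqrtr_ge0 ?exprn_ge0//.
    rewrite exprMn sqr_sqrtr; last by rewrite fine_ge0//; exact: nneseries_ge0.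
    rewrite -exprM mulnC exprM [2^-1 ^+ 2]exprVn.
    rewrite (_ : (2 ^+ 2)^-1 = 4^-1 :> R); last by congr (_^-1); ring.
    by rewrite exprVn -ler_pdivrMr ?invr_gt0 ?exprn_gt0// invrK mulrC.
  have gc : cvgn (series (geometric M 2^-1)).
    by apply: is_cvg_geometric_series; rewrite ger0_norm// invf_lt1// ltr1n.
  have conv (p : C -> R) : (forall z, `|p z| <= cabs z) ->
      (forall z z', p (z - z') = p z - p z') -> cvgn (fun k => p (S k x)).
    move=> pc pB.
    have h1 : cvgn (series (fun k => p (D k x))).
      apply: normed_cvg; apply: (series_le_cvg _ _ _ gc) => k //=.
      - by rewrite mulr_ge0 ?sqrtr_ge0// exprn_ge0.
      - exact: le_trans (pc _) (DM k).
    have -> : (fun k => p (S k x)) = (fun k => p (S 0%N x) + series (fun k => p (D k x)) k).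
      apply/funext => k; rewrite /series/= (eq_bigr (fun k => p (S k.+1 x) - p (S k x))).
        by rewrite telescope_sumr// addrC subrK.
      by move=> i _; rewrite /D pB.
    by apply: is_cvgD => //; exact: is_cvg_cst.
  have c1 := conv (@complex.Re R) (@cabs_Re R) (fun z z' => etrans (cReD z (- z')) (congr1 _ (cReN z'))).
  have c2 := conv (@complex.Im R) (@cabs_Im R) (fun z z' => etrans (cImD z (- z')) (congr1 _ (cImN z'))).
  by exists (limn (fun k => complex.Re (S k x)) +i* limn (fun k => complex.Im (S k x))).
have [F cF] : exists F, ccvg S' F.
  suff /choice[F HF] : forall x, exists z : C, complex.Re (S' k x) @[k --> \oo] --> complex.Re z /\
    complex.Im (S' k x) @[k --> \oo] --> complex.Im z by exists F.
  move=> x; have [Gx|nG] := pselect (G x).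
    have [z [z1 z2]] := cS x Gx; exists z.
    have e1 k : S' k x = S k x by rewrite /S' indicE mem_set//= mul1r.
    by split; under eq_fun do rewrite e1.
  exists 0; have e1 k : S' k x = 0 by rewrite /S' indicE memNset//= mul0r.
  by split; under eq_fun do rewrite e1; exact: cvg_cst.
have mF := ccvg_cmeasurable mS' cF.
have S'S k : {ae mu, forall x, S' k x = S k x}.
  by apply: filterS aeG => x Gx; rewrite /S' indicE mem_set//= mul1r.
have sqS' k : sqn (S' k) = sqn (S k) by apply: ae_eq_sqn.
have sqF : (sqn F <= V%:E * W)%E.
  apply: (sqn_fatou mS' cF) => n; rewrite sqS' sqn_epoly// EFinM.
  apply: lee_wpmul2l; first by rewrite lee_fin ltW.
  by rewrite -sumEFin; exact: esum_ge_fset.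
have LF : L2 F.
  split=> //; apply: le_lt_trans sqF _; rewrite lte_mul_pinfty ?lee_fin ?ltW//.
have LS' k : L2 (S' k).
  by split=> //; rewrite sqS'; have [] := L2_epoly a b0 c (A k).
have sqFS k : (sqn (fun x => F x - S' k x)%R <= (V * e k)%:E)%E.
  apply: (@sqn_fatou _ _ (fun n x => S' (n + k)%N x - S' k x)).
  - by move=> n; have [] := L2B (LS' (n + k)%N) (LS' k).
  - move=> x; have [h1 h2] := cF x; split.
      under eq_fun do rewrite cReD; rewrite cReD; apply: cvgD; last exact: cvg_cst.
      by rewrite (cvg_shiftn k (fun n => complex.Re (S' n x))).
    under eq_fun do rewrite cImD; rewrite cImD; apply: cvgD; last exact: cvg_cst.
    by rewrite (cvg_shiftn k (fun n => complex.Im (S' n x))).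
  - move=> n; rewrite (_ : sqn _ = sqn (fun x => S (n + k)%N x - S k x)) ?sqS//.
    apply: ae_eq_sqn.
    + by have [] := L2B (LS' (n + k)%N) (LS' k).
    + by have [] := L2B (L2_epoly a b0 c (A (n + k)%N)) (L2_epoly a b0 c (A k)).
    by apply: filterS2 (S'S (n + k)%N) (S'S k) => x -> ->.
exists F; split => //.
  move=> x nB; have [h1 h2] := cF x.
  have e1 k : S' k x = 0 by rewrite /S' /S epoly_off// mulr0.
  apply: ceqP.
    apply: (cvg_unique (@Rhausdorff R) h1).
    rewrite (_ : (fun n => complex.Re (S' n x)) = cst 0); first exact: cvg_cst.
    by apply/funext => k; rewrite e1.
  apply: (cvg_unique (@Rhausdorff R) h2).
  rewrite (_ : (fun n => complex.Im (S' n x)) = cst 0); first exact: cvg_cst.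
  by apply/funext => k; rewrite e1.
move=> m; apply/eqP; rewrite -subr_eq0; apply/eqP; apply: cabs_eq0.
apply/eqP; rewrite eq_le cabs_ge0 andbT.
(* The m-th coefficient of F differs from that of S_k by at most 2 V 2^-k, and
   that of S_k is V c_m unless m is outside of A_k, where |c_m| <= 2^-k. *)
apply: (@geometric_small _ (3 * V)) => k.
rewrite -[inner F _](subrK (inner (S' k) (ebox a b m))) -addrA.
rewrite (le_trans (cabsD _ _))// (_ : 3 * V = 2 * V + V) ?mulrDl; last by ring.
have Le := L2_ebox a b0 m.
apply: lerD.
  rewrite -innerBl// -lee_fin.
  have k2 : (0 : R) < 2 ^+ k by rewrite exprn_gt0.
  apply: le_trans (inner_le (L2B LF (LS' k)) Le k2) _.
  rewrite sqn_ebox// -EFinM.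
  apply: (@le_trans _ _ ((2 ^+ k)%:E * (V * e k)%:E + ((2 ^+ k)^-1 * V)%:E)%E).
    by rewrite leeD2r// lee_wpmul2l// lee_fin ltW.
  rewrite -EFinM -EFinD lee_fin [2^-1 ^+ k]exprVn.
  have -> : 2 ^+ k * (V * e k) = V * 4^-1 ^+ k.
    by rewrite mulrCA /e -exprMn; congr (_ * _ ^+ _); field.
  have : 4^-1 ^+ k <= (2 ^+ k)^-1 :> R.
    by rewrite -exprVn lerXn2r ?nnegrE ?invr_ge0// lef_pV2 ?posrE// ler_nat.
  by move=> uv; rewrite !mul1r [_^-1 * V]mulrC lerD// ler_pM2l.
have -> : inner (S' k) (ebox a b m) = inner (S k) (ebox a b m).
  by apply: ae_eq_inner; [exact: mS'|exact: mS|exact: cmeasurable_ebox|exact: S'S].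
rewrite inner_epoly//; case: (boolP (m \in A k)) => mA.
  by rewrite subrr cabs0; apply: mulr_ge0; [exact: ltW|exact: exprn_ge0].
rewrite sub0r cabsN cabsM cabs_real gtr0_norm// mulrC ler_pM2l//.
rewrite -(@ler_pXn2r _ 2%N) ?nnegrE ?cabs_ge0 ?exprn_ge0//.
have := tail k [fset m]%fset; rewrite big_seq_fset1 => h.
apply: (@le_trans _ _ (e k)).
  by apply: h => m'; rewrite inE => /eqP ->.
rewrite -exprM mulnC exprM /e lerXn2r ?nnegrE ?exprn_ge0 ?invr_ge0//.
by rewrite exprVn lef_pV2 ?posrE ?exprn_gt0// expr2 -natrM ler_nat.
Qed.

End riesz_fischer.

(** * Parseval's identity on a box *)

Section parseval.
Variables (R : realType) (d : nat).
Local Notation E := 'rV[R]_d.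
Local Notation Z := 'rV[int]_d.
Local Notation mu := (rV_lebesgue R d).
Local Notation C := R[i].
Local Notation cabs := (@Normc.normc R).
Variables (a : E) (b : R).
Hypothesis b0 : 0 < b.
Local Notation B := (obox a b^-1).
Local Notation V := (b^-1 ^+ d).

Let V0 : 0 < V. Proof. by rewrite exprn_gt0// invr_gt0. Qed.

Lemma cRe_mulr (F : E -> C) (u : E -> R) x :
  cRe (fun x => F x * (u x)%:C) x = cRe F x * u x.
Proof.
transitivity (complex.Re (F x * (u x)%:C)); first by [].
by rewrite cReM /= mulr0 subr0.
Qed.

Lemma cIm_mulr (F : E -> C) (u : E -> R) x :
  cIm (fun x => F x * (u x)%:C) x = cIm F x * u x.
Proof.
transitivity (complex.Im (F x * (u x)%:C)); first by [].
by rewrite cImM /= mulr0 add0r.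
Qed.

(** The real and imaginary parts of F have vanishing cosine and sine
    coefficients, because the coefficients of frequencies m and -m of F both
    vanish. *)
Lemma box_uniqueness (F : E -> C) : L2 F -> (forall x, ~ B x -> F x = 0) ->
  (forall m, inner F (ebox a b m) = 0) -> {ae mu, forall x, F x = 0}.
Proof.
move=> LF F0 Fm.
have iFe m : cintegrable (fun x => F x * (ebox a b m x)^*).
  by apply: inner_integrable => //; exact: L2_ebox.
have ee m x : F x * expi b m x = F x * (ebox a b (- m) x)^*.
  have [Bx|/F0 ->] := pselect (B x); last by rewrite !mul0r.
  rewrite /ebox indicE mem_set//= mul1r; congr (_ * _).
  by rewrite /expi phaseN cosN sinN; apply: ceqP => /=; rewrite ?opprK.
have iF : cintegrable F.
  have := iFe 0; congr cintegrable; apply/funext => x.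
  by rewrite -[X in ebox _ _ X]oppr0 -ee expi0 mulr1.
have eFm m : cint (fun x => F x * expi b m x) = 0.
  by rewrite (eq_cint (ee m)); exact: Fm.
have iFm m : cintegrable (fun x => F x * expi b m x).
  by have := iFe (- m); congr cintegrable; apply/funext => x; rewrite ee.
have cosE m : cint (fun x => F x * (cos (phase b m x))%:C) = 0.
  transitivity (cint (fun x => 2^-1%:C * (F x * expi b m x + F x * expi b (- m) x))).
    apply: eq_cint => x; rewrite -mulrDr mulrCA; congr (_ * _).
    by rewrite /expi phaseN cosN sinN; apply: ceqP => /=; field.
  by rewrite cintZ ?cintD ?eFm ?addr0 ?mulr0//; exact: cintegrableD.
have sinE m : cint (fun x => F x * (sin (phase b m x))%:C) = 0.
  transitivity (cint (fun x => (0 -i* 2^-1) * (F x * expi b m x + (-1) * (F x * expi b (- m) x)))).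
    apply: eq_cint => x; rewrite mulN1r -mulrBr mulrCA; congr (_ * _).
    by rewrite /expi phaseN cosN sinN; apply: ceqP => /=; field.
  rewrite cintZ ?cintD ?cintZ ?eFm ?mulr0 ?addr0 ?mulr0//; first exact: cintegrableZ.
  by apply: cintegrableD => //; exact: cintegrableZ.
have re : {ae mu, forall x, cRe F x = 0}.
  apply: (fourier_uniqueness b0 iF.1).
  - by move=> x /F0 Fx; rewrite /cRe Fx.
  - move=> m; have := congr1 (@complex.Re R) (cosE m); rewrite /cint/= => e.
    by rewrite -[RHS]e; apply: eq_Rintegral => x _; exact: esym (cRe_mulr F (fun x => cos (phase b m x)) x).
  - move=> m; have := congr1 (@complex.Re R) (sinE m); rewrite /cint/= => e.
    by rewrite -[RHS]e; apply: eq_Rintegral => x _; exact: esym (cRe_mulr F (fun x => sin (phase b m x)) x).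
have im : {ae mu, forall x, cIm F x = 0}.
  apply: (fourier_uniqueness b0 iF.2).
  - by move=> x /F0 Fx; rewrite /cIm Fx.
  - move=> m; have := congr1 (@complex.Im R) (cosE m); rewrite /cint/= => e.
    by rewrite -[RHS]e; apply: eq_Rintegral => x _; exact: esym (cIm_mulr F (fun x => cos (phase b m x)) x).
  - move=> m; have := congr1 (@complex.Im R) (sinE m); rewrite /cint/= => e.
    by rewrite -[RHS]e; apply: eq_Rintegral => x _; exact: esym (cIm_mulr F (fun x => sin (phase b m x)) x).
by apply: filterS2 re im => x; rewrite /cRe /cIm => r i; exact: ceqP.
Qed.

Lemma box_coef_inj (F F' : E -> C) : L2 F -> L2 F' ->
  (forall x, ~ B x -> F x = 0) -> (forall x, ~ B x -> F' x = 0) ->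
  (forall m, inner F (ebox a b m) = inner F' (ebox a b m)) ->
  {ae mu, forall x, F x = F' x}.
Proof.
move=> LF LF' F0 F'0 FF'.
have : {ae mu, forall x, F x - F' x = 0}.
  apply: box_uniqueness; first exact: L2B.
    by move=> x nB; rewrite F0// F'0// subr0.
  by move=> m; rewrite innerBl// ?FF' ?subrr//; exact: L2_ebox.
by apply: filterS => x /eqP; rewrite subr_eq0 => /eqP.
Qed.

(** Bessel's inequality is one half. For the other, a function with the same
    coefficients as F and with a squared norm at most the sum is given by the
    Riesz-Fischer theorem, and it equals F almost everywhere. *)
Lemma parseval (F : E -> C) : L2 F -> (forall x, ~ B x -> F x = 0) ->
  (\esum_(m in [set: Z]) (cabs (inner F (ebox a b m)) ^+ 2)%:E = V%:E * sqn F)%E.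
Proof.
move=> LF F0; apply/eqP; rewrite eq_le bessel//=.
pose c m : C := (V^-1)%:C * inner F (ebox a b m).
set W := (\esum_(m in _) _)%E.
have cE m : ((cabs (c m) ^+ 2)%:E = (V^-1 ^+ 2)%:E * (cabs (inner F (ebox a b m)) ^+ 2)%:E)%E.
  by rewrite /c cabsM cabs_real exprMn EFinM ger0_norm// invr_ge0 ltW.
have cW : (\esum_(m in [set: Z]) (cabs (c m) ^+ 2)%:E <= (V^-1 ^+ 2)%:E * W)%E.
  under eq_esum do rewrite cE.
  by apply: esumZ_le; rewrite ?sqr_ge0// => m; rewrite lee_fin sqr_ge0.
have Woo : (W < +oo)%E.
  by apply: le_lt_trans (bessel a b0 LF) _; apply: lte_mul_pinfty; rewrite ?lee_fin ?ltW//; case: LF.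
have W0 : (0 <= W)%E by apply: esum_ge0 => m _; rewrite lee_fin sqr_ge0.
have [|F' [LF' F'0 sF' cF']] := @riesz_fischer R d a b b0 c.
  apply: le_lt_trans cW _; apply: lte_mul_pinfty => //.
  by rewrite lee_fin sqr_ge0.
have VV : V%:C * (V^-1)%:C = 1 :> C by rewrite -rmorphM mulfV ?gt_eqF.
have FF' : {ae mu, forall x, F x = F' x}.
  apply: box_coef_inj => // m; rewrite cF' /c mulrAC [(V^-1)%:C * _]mulrC VV mul1r //.
have -> : sqn F = sqn F' by apply: ae_eq_sqn => //; [case: LF|case: LF'].
apply: (@le_trans _ _ (V%:E * (V%:E * ((V^-1 ^+ 2)%:E * W)))%E).
  apply: lee_wpmul2l; first by rewrite lee_fin ltW.
  apply: le_trans sF' _; apply: lee_wpmul2l => //.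
  by rewrite lee_fin ltW.
rewrite !muleA -!EFinM (_ : V * V * _ = 1) ?mul1e//.
by rewrite -expr2 -exprMn mulfV ?expr1n// gt_eqF.
Qed.

End parseval.

(** * Smooth functions *)

Section smooth_functions.
Variables (R : realType) (d : nat).
Local Notation E := 'rV[R]_d.
Implicit Types (f g : E -> R) (s t : seq 'I_d).
Local Notation e_ i := (delta_mx ord0 i : E).

Lemma smooth_derivable f s x v : smooth f -> derivable (partials s f) x v.
Proof. by move=> sf; apply: diff_derivable. Qed.

Lemma smooth_measurable f : smooth f -> measurable_fun setT f.
Proof. by move=> sf; apply: continuous_measurable_rV => x; exact: differentiable_continuous (sf [::] x). Qed.

Lemma partials_cst c s : partials s (cst c : E -> R) = if s is [::] then cst c else cst 0.
Proof.
elim: s => // i s IH; rewrite /= -/(partials s _) IH.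
by apply/funext => x; case: (s) => [|? ?]; rewrite derive_cst.
Qed.

Lemma smooth_cst c : smooth (cst c : E -> R).
Proof.
move=> s x; rewrite partials_cst; case: s => [|? ?]; exact: differentiable_cst.
Qed.

Lemma partialsD f g s : smooth f -> smooth g ->
  partials s (fun x => f x + g x) = (fun x => partials s f x + partials s g x).
Proof.
move=> sf sg; elim: s => // i s IH; rewrite /= -/(partials s _) IH.
by apply/funext => x; rewrite deriveD//; exact: smooth_derivable.
Qed.

Lemma smoothD f g : smooth f -> smooth g -> smooth (fun x => f x + g x).
Proof.
move=> sf sg s x; rewrite partialsD//; apply: differentiableD; [exact: sf|exact: sg].
Qed.

(** The terms of the Leibniz rule for an iterated partial derivative: each
    differentiation applies to one of the two factors. *)
Fixpoint leibniz s : seq (seq 'I_d * seq 'I_d) :=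
  if s is i :: s' then
    [seq (i :: p.1, p.2) | p <- leibniz s'] ++ [seq (p.1, i :: p.2) | p <- leibniz s']
  else [:: ([::], [::])].

Lemma size_leibniz s p : p \in leibniz s -> (size p.1 + size p.2 = size s)%N.
Proof.
elim: s p => [|i s IH] p /=; first by rewrite inE => /eqP ->.
rewrite mem_cat => /orP[] /mapP[q qs ->] /=; first by rewrite addSn IH.
by rewrite addnS IH.
Qed.

Lemma size_leibnizE s : size (leibniz s) = (2 ^ size s)%N.
Proof.
by elim: s => //= i s IH; rewrite size_cat !size_map IH expnS mul2n addnn.
Qed.

Lemma partialsM f g s : smooth f -> smooth g ->
  partials s (fun x => f x * g x) =
  (fun x => \sum_(p <- leibniz s) partials p.1 f x * partials p.2 g x).
Proof.
move=> sf sg; elim: s => [|i s IH].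
  by apply/funext => x; rewrite /= big_seq1.
rewrite [LHS]/= -/(partials s _) IH.
apply/funext => x; rewrite [in RHS]/= big_cat !big_map/=.
have H (r : seq (seq 'I_d * seq 'I_d)) :
  is_derive x (e_ i) (fun y => \sum_(p <- r) partials p.1 f y * partials p.2 g y)
   (\sum_(p <- r) (partials (i :: p.1) f x * partials p.2 g x +
                   partials p.1 f x * partials (i :: p.2) g x)).
  elim: r => [|p r IHr].
    under eq_fun do rewrite big_nil; rewrite big_nil; exact: is_derive_cst.
  under eq_fun do rewrite big_cons; rewrite big_cons; apply: is_deriveD.
  have df := @smooth_derivable f p.1 x (e_ i) sf; have dg := @smooth_derivable g p.2 x (e_ i) sg.
  apply: (is_derive_eq (is_deriveM (derivableP df) (derivableP dg))).
  by rewrite addrC /GRing.scale/= mulrC.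
by have [_ ->] := H (leibniz s); rewrite big_split.
Qed.

Lemma differentiable_bigsum (I : Type) (r : seq I) (F : I -> E -> R) x :
  (forall i, differentiable (F i) x) ->
  differentiable (fun y => \sum_(i <- r) F i y) x.
Proof.
move=> dF; elim: r => [|i r IH].
  by under eq_fun do rewrite big_nil; exact: differentiable_cst.
by under eq_fun do rewrite big_cons; exact: differentiableD.
Qed.

Lemma smoothM f g : smooth f -> smooth g -> smooth (fun x => f x * g x).
Proof.
move=> sf sg s x; rewrite partialsM//; apply: differentiable_bigsum => p.
by apply: differentiableM; [exact: sf|exact: sg].
Qed.

Lemma smoothZ c f : smooth f -> smooth (fun x => c * f x).
Proof. by move=> sf; apply: smoothM => //; exact: (smooth_cst c). Qed.

Lemma smooth_sum (I : Type) (r : seq I) (F : I -> E -> R) :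
  (forall i, smooth (F i)) -> smooth (fun x => \sum_(i <- r) F i x).
Proof.
move=> sF; elim: r => [|i r IH].
  by under eq_fun do rewrite big_nil; exact: (smooth_cst 0).
by under eq_fun do rewrite big_cons; exact: smoothD.
Qed.

Lemma partials_near f g s x : {near x, f =1 g} -> partials s f x = partials s g x.
Proof.
elim: s x => [|i s IH] x fg /=; first exact: (nbhs_singleton fg).
apply: near_eq_derive.
by move: (near_join fg); apply: filterS => y; exact: IH.
Qed.

Lemma partials_off_supp f s x : ~ supp f x -> partials s f x = 0.
Proof.
move=> nsx.
have : {near x, f =1 cst 0}.
  have oS : open (~` supp f) by apply: closed_openC; exact: closed_closure.
  have H : nbhs x (~` supp f) by exact: open_nbhs_nbhs.
  near=> y; apply: contrapT => fy.
  have : (~` supp f) y by near: y.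
  by apply; apply: subset_closure; apply/eqP.
by move/(partials_near s) ->; rewrite partials_cst; case: s.
Unshelve. all: by end_near. Qed.

Lemma differentiable_phase b (m : 'rV[int]_d) x : differentiable (phase b m : E -> R) x.
Proof.
rewrite /phase; apply: differentiableM; first exact: differentiable_cst.
apply: differentiable_bigsum => i; apply: differentiableM; first exact: differentiable_cst.
exact: differentiable_coord.
Qed.

Lemma phase_line b (m : 'rV[int]_d) (t : R) (v x : E) :
  phase b m (t *: v + x) = t * phase b m v + phase b m x.
Proof.
rewrite /phase mulrCA -mulrDr; congr (_ * _); rewrite mulr_sumr -big_split/=.
by apply: eq_bigr => i _; rewrite !mxE mulrDr mulrCA.
Qed.

Lemma derive_line f x v : 'D_v f x = 'D_1 (fun t : R => f (t *: v + x)) 0.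
Proof.
rewrite /derive; set G := (fun h : R => h^-1 *: ((f \o shift x) _ - _)).
rewrite (_ : (fun h : R => h^-1 *: (_ - f (0 *: v + x))) = G)//.
apply/funext => h; rewrite /G /=.
by rewrite scale0r add0r addr0 /GRing.scale/= mulr1.
Qed.

(** The span of cos and sin of a fixed phase is stable under all partial
    derivatives, hence consists of smooth functions. *)
Definition wave (A B : R) b m (x : E) := A * cos (phase b m x) + B * sin (phase b m x).

Lemma differentiable_wave A B b m x : differentiable (wave A B b m) x.
Proof.
have dc (k : R -> R) : (forall y : R, derivable k y 1) ->
    differentiable (fun y => k (phase b m y)) x.
  move=> dk; apply: (differentiable_comp (f := phase b m)).
    exact: differentiable_phase.
  exact/derivable1_diffP.
by apply: differentiableD; (apply: differentiableM; first exact: differentiable_cst);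
  apply: dc => y; [exact: derivable_cos|exact: derivable_sin].
Qed.

Lemma derive_wave A B b m i x : 'D_(e_ i) (wave A B b m) x =
  wave (B * phase b m (e_ i)) (- A * phase b m (e_ i)) b m x.
Proof.
rewrite derive_line; set c := phase b m (e_ i); set p := phase b m x.
rewrite (_ : (fun u : R => _) = (fun u : R => A * cos (u * c + p) + B * sin (u * c + p))); last first.
  by apply/funext => u; rewrite /wave phase_line.
have H : is_derive (0 : R) 1 (fun u : R => A * cos (u * c + p) + B * sin (u * c + p))
   (B * c * cos p + - A * c * sin p).
  apply: is_derive_eq; rewrite /GRing.scale/= !mul0r !add0r.
  by ring.
by have [_ ->] := H.
Qed.

Lemma smooth_wave A B b m : smooth (wave A B b m).
Proof.
move=> s x.
have [A' [B' ->]] : exists A' B', partials s (wave A B b m) = wave A' B' b m.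
  elim: s => [|i s [A' [B' IH]]]; first by exists A, B.
  rewrite /= -/(partials s _) IH.
  by do 2 eexists; apply/funext => y; exact: derive_wave.
exact: differentiable_wave.
Qed.

Lemma differentiable_dil f r x : differentiable f (r *: x) ->
  differentiable (fun y => f (r *: y)) x.
Proof.
by move=> df; apply: (differentiable_comp (f := fun y : E => r *: y)).
Qed.

Lemma derive_dil f r x v : differentiable f (r *: x) ->
  'D_v (fun y => f (r *: y)) x = r * 'D_v f (r *: x).
Proof.
move=> df; rewrite deriveE; last exact: differentiable_dil.
rewrite (diff_comp (f := fun y : E => r *: y))//.
have -> : 'd (fun y : E => r *: y) x = ( *:%R r) :> (E -> E) by exact: diff_val.
by rewrite /= linearZ/= -deriveE.
Qed.

Lemma partials_dil f r s : smooth f -> partials s (fun y => f (r *: y)) =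
  (fun x => r ^+ size s * partials s f (r *: x)).
Proof.
move=> sf; elim: s => [|i s IH]; first by apply/funext => x; rewrite /= mul1r.
rewrite [LHS]/= -/(partials s _) IH; apply/funext => x.
rewrite deriveMl; last by apply: diff_derivable; apply: differentiable_dil; exact: sf.
by rewrite derive_dil ?exprSr ?mulrA//=; exact: sf.
Qed.

Lemma smooth_dil f r : smooth f -> smooth (fun y => f (r *: y)).
Proof.
move=> sf s x; rewrite partials_dil//; apply: differentiableM; first exact: differentiable_cst.
by apply: differentiable_dil; exact: sf.
Qed.

End smooth_functions.

(** * Test functions and Schwartz functions *)

Section euclidean_norm.
Variables (R : realType) (d : nat).
Local Notation E := 'rV[R]_d.
Implicit Types (x y : E).

Lemma enorm_ge0 x : 0 <= enorm x. Proof. exact: sqrtr_ge0. Qed.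

Lemma coord_le_enorm x i : `|x ord0 i| <= enorm x.
Proof.
rewrite -sqrtr_sqr ler_wsqrtr// (bigD1 i)//= lerDl sumr_ge0// => j _.
exact: sqr_ge0.
Qed.

Lemma enorm_le_sum x : enorm x <= \sum_i `|x ord0 i|.
Proof.
have s0 : 0 <= \sum_i `|x ord0 i| by exact: sumr_ge0.
rewrite -[leRHS]ger0_norm// -sqrtr_sqr ler_wsqrtr//.
rewrite [leRHS]expr2 mulr_suml; apply: ler_sum => i _.
rewrite -[x ord0 i ^+ 2]real_normK ?num_real// expr2 ler_wpM2l//.
by rewrite (bigD1 i)//= lerDl sumr_ge0.
Qed.

Lemma enormZ r x : enorm (r *: x) = `|r| * enorm x.
Proof.
rewrite /enorm -sqrtr_sqr -sqrtrM ?sqr_ge0// mulr_sumr; congr Num.sqrt.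
by apply: eq_bigr => i _; rewrite !mxE exprMn.
Qed.

Lemma enorm_continuous : continuous (@enorm R d).
Proof.
move=> x; rewrite /enorm.
apply: (@continuous_comp _ _ _ (fun x : E => \sum_i x ord0 i ^+ 2) Num.sqrt); last exact: sqrt_continuous.
apply: differentiable_continuous; apply: differentiable_bigsum => i.
rewrite (_ : (fun _ => _) = (fun y : E => y ord0 i * y ord0 i)); last first.
  by apply/funext => y; rewrite expr2.
by apply: differentiableM; exact: differentiable_coord.
Qed.

Lemma open_enorm_lt r : open [set x : E | enorm x < r].
Proof.
have -> : [set x : E | enorm x < r] = (@enorm R d) @^-1` [set y | y < r] by [].
by apply: open_comp; [move=> x _; exact: enorm_continuous|exact: open_lt].
Qed.

End euclidean_norm.

Section test_functions.
Variables (R : realType) (d : nat).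
Local Notation E := 'rV[R]_d.
Local Notation C := R[i].
Local Notation cabs := (@Normc.normc R).
Implicit Types (f : E -> R) (phi : E -> C) (s : seq 'I_d).

Lemma supp_sub (U V : zmodType) (h : E -> U) (k : E -> V) :
  (forall x, h x != 0 -> k x != 0) -> supp h `<=` supp k.
Proof. by move=> hk; apply: closure_subset => x /= /hk. Qed.

Lemma compact_supp_sub (U V : zmodType) (h : E -> U) (k : E -> V) :
  (forall x, h x != 0 -> k x != 0) -> compact (supp k) -> compact (supp h).
Proof.
by move=> hk ck; apply: subclosed_compact ck (supp_sub hk); exact: closed_closure.
Qed.

Lemma off_supp (U : zmodType) (h : E -> U) x : ~ supp h x -> h x = 0.
Proof.
by move=> nh; apply: contrapT => hx; apply: nh; apply: subset_closure; apply/eqP.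
Qed.

Lemma supp_cRe phi : supp (cRe phi) `<=` supp phi.
Proof. by apply: supp_sub => x; apply: contra_neq; rewrite /cRe => ->. Qed.

Lemma supp_cIm phi : supp (cIm phi) `<=` supp phi.
Proof. by apply: supp_sub => x; apply: contra_neq; rewrite /cIm => ->. Qed.

Lemma csmooth_cmeasurable phi : csmooth phi -> cmeasurable phi.
Proof. by move=> [h1 h2]; split; exact: smooth_measurable. Qed.

Lemma csmooth_real f : smooth f -> csmooth (fun x => (f x)%:C).
Proof. by move=> sf; split; [exact: sf|exact: (@smooth_cst R d 0)]. Qed.

Lemma cRe_rmul f phi : cRe (fun x => (f x)%:C * phi x) = fun x => f x * cRe phi x.
Proof. by apply/funext => x; rewrite /cRe cReM /= mul0r subr0. Qed.

Lemma cIm_rmul f phi : cIm (fun x => (f x)%:C * phi x) = fun x => f x * cIm phi x.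
Proof. by apply/funext => x; rewrite /cIm cImM /= mul0r addr0. Qed.

Lemma csmoothM f phi : smooth f -> csmooth phi -> csmooth (fun x => (f x)%:C * phi x).
Proof.
by move=> sf [s1 s2]; split; rewrite ?cRe_rmul ?cIm_rmul; exact: smoothM.
Qed.

Lemma cpartialsM f phi s x : smooth f -> csmooth phi ->
  cpartials s (fun x => (f x)%:C * phi x) x =
  \sum_(p <- leibniz s) (partials p.1 f x)%:C * cpartials p.2 phi x.
Proof.
move=> sf [s1 s2]; rewrite /cpartials cRe_rmul cIm_rmul !partialsM//.
elim: (leibniz s) => [|p r IH]; first by rewrite !big_nil.
rewrite !big_cons -IH; apply: ceqP => /=; ring.
Qed.

Lemma test_mul f phi : smooth f -> test_function phi ->
  test_function (fun x => (f x)%:C * phi x).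
Proof.
move=> sf [sp cp]; split; first exact: csmoothM.
by apply: compact_supp_sub cp => x; apply: contra_neq => ->; rewrite mulr0.
Qed.

Lemma test_mulr f phi : smooth f -> compact (supp f) -> csmooth phi ->
  test_function (fun x => (f x)%:C * phi x).
Proof.
move=> sf cf sp; split; first exact: csmoothM.
by apply: compact_supp_sub cf => x; apply: contra_neq => ->; rewrite mul0r.
Qed.

Lemma test_real f : smooth f -> compact (supp f) -> test_function (fun x => (f x)%:C).
Proof.
move=> sf cf; split; first exact: csmooth_real.
by apply: compact_supp_sub cf => x; apply: contra_neq => ->.
Qed.

(** There are finitely many multi-indices of bounded length, so bounds for
    each of them give a common bound. *)
Lemma words_bound (P : seq 'I_d -> R -> Prop) :
  (forall s M M', P s M -> M <= M' -> P s M') ->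
  (forall s, exists M, P s M) ->
  forall k : nat, exists2 M, 0 <= M & forall s, (size s <= k)%N -> P s M.
Proof.
move=> Pmon /choice[M HM]; elim=> [|k [N N0 IH]].
  exists `|M [::]| => //; case=> // _.
  by apply: Pmon (HM _) _; exact: ler_norm.
exists (N + \sum_(t : k.+1.-tuple 'I_d) `|M t|).
  by rewrite addr_ge0// sumr_ge0.
move=> s; rewrite leq_eqVlt => /orP[/eqP sk|]; last first.
  by rewrite ltnS => /IH h; apply: Pmon h _; rewrite lerDl sumr_ge0.
apply: Pmon (HM s) _; rewrite (le_trans (ler_norm _))//.
have ss : size s == k.+1 by apply/eqP.
by rewrite (bigD1 (Tuple ss))//= addrCA lerDl addr_ge0// sumr_ge0.
Qed.

Lemma schwartz_norm_ub k phi s x : (size s <= k)%N ->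
  (((1 + enorm x) ^+ k * cabs (cpartials s phi x))%:E <= schwartz_norm k phi)%E.
Proof. by move=> sk; apply: ereal_sup_ubound; exists x => //; exists s. Qed.

Lemma schwartz_norm_ge0 k phi : (0 <= schwartz_norm k phi)%E.
Proof.
apply: le_trans (@schwartz_norm_ub k phi [::] 0 _) => //.
by rewrite lee_fin mulr_ge0 ?cabs_ge0// exprn_ge0// addr_ge0// enorm_ge0.
Qed.

Lemma schwartz_norm_le k phi M :
  (forall s x, (size s <= k)%N -> (1 + enorm x) ^+ k * cabs (cpartials s phi x) <= M) ->
  (schwartz_norm k phi <= M%:E)%E.
Proof. by move=> H; apply: ge_ereal_sup => _ [x _ [s sk] <-]; rewrite lee_fin H. Qed.

Lemma continuous_compact_bounded (f : E -> R) (K : set E) : continuous f -> compact K ->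
  (forall x, ~ K x -> f x = 0) -> exists M, forall x, `|f x| <= M.
Proof.
move=> cf cK f0.
have [K0|/set0P nK] := eqVneq K set0.
  by exists 0 => x; rewrite f0 ?normr0// K0.
have cn : {within K, continuous (fun x => `|f x|)}.
  apply: continuous_subspaceT => x; apply: (@continuous_comp _ _ _ f (@Num.norm _ R)).
    exact: cf.
  exact: norm_continuous.
have [x Kx xmax] := compact_EVT_max nK cK cn.
exists `|f x| => y; have [Ky|nKy] := pselect (K y); first exact: xmax (mem_set Ky).
by rewrite f0// normr0.
Qed.

Lemma test_schwartz phi : test_function phi -> schwartz phi.
Proof.
move=> [[s1 s2] cp]; split => // k.
have bw : continuous (fun x : E => (1 + enorm x) ^+ k).
  move=> x; apply: (@continuous_comp _ _ _ (fun x : E => 1 + enorm x) (fun y : R => y ^+ k)).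
    by apply: continuousD; [exact: cst_continuous|exact: enorm_continuous].
  exact: exprn_continuous.
have bnd h s : smooth h -> supp h `<=` supp phi ->
    exists M, forall x, `|(1 + enorm x) ^+ k * partials s h x| <= M.
  move=> sh hp.
  apply: (continuous_compact_bounded _ cp).
    by move=> x; exact: (cvgM (bw x) (differentiable_continuous (sh s x))).
  by move=> x nx; rewrite partials_off_supp ?mulr0// => /hp.
have [] := @words_bound (fun s M => forall x,
  (1 + enorm x) ^+ k * cabs (cpartials s phi x) <= M) _ _ k.
- by move=> s M M' H MM' x; exact: le_trans (H x) MM'.
- move=> s; have [M1 H1] := bnd _ s s1 (@supp_cRe phi).
  have [M2 H2] := bnd _ s s2 (@supp_cIm phi).
  exists (M1 + M2) => x.
  have k0 : 0 <= (1 + enorm x) ^+ k by rewrite exprn_ge0// addr_ge0// enorm_ge0.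
  apply: le_trans (lerD (H1 x) (H2 x)).
  by rewrite !normrM -mulrDr !(ger0_norm k0) ler_wpM2l//; exact: cabs_le.
move=> M M0 HM; apply: (@le_lt_trans _ _ M%:E); last exact: ltry.
by apply: schwartz_norm_le => s x /HM.
Qed.

(** A factor with bounded derivatives that vanishes on the ball of radius rho
    gains 1 / (1 + rho): where the product does not vanish, the weight of the
    next Schwartz norm has an additional factor 1 + |x| >= 1 + rho. The
    Leibniz rule has 2^k terms at most. *)
Lemma schwartz_mul f phi k (M rho : R) : smooth f -> schwartz phi -> 0 <= rho ->
  (forall s x, (size s <= k)%N -> `|partials s f x| <= M) ->
  (forall s x, enorm x < rho -> partials s f x = 0) ->
  (schwartz_norm k (fun x => (f x)%:C * phi x)%R <=
     (2 ^+ k * M / (1 + rho))%:E * schwartz_norm k.+1 phi)%E.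
Proof.
move=> sf [sp pk] rho0 fM f0; set N := schwartz_norm k.+1 phi.
have M0 : 0 <= M by exact: le_trans (fM [::] 0 _).
have N0 : (0 <= N)%E by exact: schwartz_norm_ge0.
have Nfin : N \is a fin_num by rewrite ge0_fin_numE//; exact: pk.
rewrite -(fineK Nfin) -EFinM; apply: schwartz_norm_le => s x sk.
rewrite cpartialsM//.
have w0 : 0 < 1 + enorm x by rewrite ltr_pwDl// enorm_ge0.
have term p : p \in leibniz s ->
    (1 + enorm x) ^+ k * cabs ((partials p.1 f x)%:C * cpartials p.2 phi x) <=
    M / (1 + rho) * fine N.
  move=> /size_leibniz ps.
  have p1 : (size p.1 <= k)%N by rewrite (leq_trans _ sk)// -ps leq_addr.
  have p2 : (size p.2 <= k.+1)%N by rewrite (leq_trans _ (leqW sk))// -ps leq_addl.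
  rewrite cabsM cabs_real.
  have [xr|rx] := ltP (enorm x) rho.
    rewrite f0// normr0 mul0r mulr0 mulr_ge0 ?fine_ge0// divr_ge0// addr_ge0//.
  have := @schwartz_norm_ub k.+1 phi p.2 x p2; rewrite -/N -(fineK Nfin) lee_fin => h.
  rewrite mulrCA -mulrA; apply: ler_pM => //.
  - by rewrite mulr_ge0 ?exprn_ge0 ?cabs_ge0// ltW.
  - exact: fM.
  rewrite [leRHS]mulrC ler_pdivlMr ?ltr_pwDl//.
  apply: le_trans h; rewrite exprSr -!mulrA ler_wpM2l ?exprn_ge0 ?(ltW w0)//.
  by rewrite mulrC ler_wpM2r ?cabs_ge0// lerD2l.
apply: (@le_trans _ _ (\sum_(p <- leibniz s) M / (1 + rho) * fine N)).
  apply: (@le_trans _ _ ((1 + enorm x) ^+ k * \sum_(p <- leibniz s) cabs ((partials p.1 f x)%:C * cpartials p.2 phi x))).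
    by rewrite ler_wpM2l ?exprn_ge0 ?(ltW w0)//; exact: cabs_sum.
  by rewrite mulr_sumr big_seq [leRHS]big_seq; apply: ler_sum => p; exact: term.
rewrite big_const_seq count_predT iter_addr_0 size_leibnizE.
rewrite -[leLHS]mulr_natl natrX -!mulrA; apply: ler_wpM2r.
  by rewrite mulr_ge0// mulr_ge0 ?fine_ge0// invr_ge0 addr_ge0.
by rewrite ler_eXn2l// ltr1n.
Qed.

End test_functions.

(** * Separated points have summable weights *)

Section separated_points.
Variables (R : realType) (d : nat) (I : choiceType).
Local Notation E := 'rV[R]_d.

Lemma sum_inj_le (F : finType) (A : {fset I}) (c : I -> F) (w : F -> R) :
  {in A &, injective c} -> (forall x, 0 <= w x) ->
  \sum_(n <- A) w (c n) <= \sum_x w x.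
Proof.
move=> cinj w0; rewrite -(big_map c xpredT w) big_uniq/=; last first.
  by rewrite map_inj_in_uniq.
by rewrite [leRHS](bigID (mem (map c A)))/= lerDl sumr_ge0.
Qed.

(** The bound 2 - 1/(N+1) is what a telescoping sum gives. *)
Lemma sum_inv_squares (N : nat) :
  \sum_(j < N.+1) ((1 + (j : nat)%:R) ^+ 2)^-1 <= 2 - N.+1%:R^-1 :> R.
Proof.
elim: N => [|N IH].
  by rewrite big_ord_recl big_ord0/= !addr0 expr1n invr1; lra.
rewrite big_ord_recr/= (le_trans (lerD IH (lexx _)))// nat1r.
have N1 : (0 : R) < N.+1%:R by [].
have N2 : (0 : R) < N.+2%:R by [].
rewrite -subr_ge0.
have -> : 2 - N.+2%:R^-1 - (2 - N.+1%:R^-1 + (N.+2%:R ^+ 2)^-1) =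
   (N.+1%:R * N.+2%:R ^+ 2)^-1 :> R.
  have -> : N.+2%:R = N.+1%:R + 1 :> R by rewrite natr1.
  move: N1; set x := N.+1%:R => x0; have x1 : 0 < x + 1 by rewrite addr_gt0.
  by field; rewrite !gt_eqF.
by rewrite invr_ge0 mulr_ge0// sqr_ge0.
Qed.

Variables (a : I -> E) (delta : R).
Hypotheses (d0 : (0 < d)%N) (delta0 : 0 < delta)
  (sep : forall n n', n != n' -> delta <= enorm (a n - a n')).

Let D := d%:R / delta.
Let z n i : int := Num.floor (a n ord0 i * D).

Let D0 : 0 < D. Proof. by rewrite divr_gt0// ltr0n. Qed.

Let z_inj n n' : (forall i, z n i = z n' i) -> n = n'.
Proof.
move=> zz; apply/eqP; apply: contraT => nn'.
have := sep nn'; rewrite leNgt => /negP; case.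
apply: le_lt_trans (enorm_le_sum _) _.
apply: (@lt_le_trans _ _ (\sum_(i < d) D^-1)); last first.
  rewrite sumr_const card_ord -mulr_natl /D invf_div mulrCA mulfV ?mulr1//.
  by rewrite pnatr_eq0 -lt0n.
apply: ltr_sum; first by apply/hasP; exists (Ordinal d0); rewrite ?mem_index_enum.
move=> i _; rewrite !mxE -[ltRHS]mul1r -ltr_pdivrMr ?invr_gt0// invrK.
rewrite -[X in _ * X < _](gtr0_norm D0) -normrM mulrBl.
have /andP[h1 h2] := floor_itv (a n ord0 i * D).
have /andP[h3 h4] := floor_itv (a n' ord0 i * D).
rewrite -/(z n i) in h1 h2; rewrite -/(z n' i) -zz in h3 h4.
rewrite intrD in h2 h4; rewrite ltr_norml; apply/andP; split; lra.
Qed.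

Let z_le n i : 1 + `|z n i|%:R <= (D + 2) * (1 + enorm (a n)).
Proof.
have := coord_le_enorm (a n) i; have := enorm_ge0 (a n).
set u := enorm _ => u0 au.
rewrite natr_absz.
have /andP[h1 h2] := floor_itv (a n ord0 i * D).
rewrite -/(z n i) in h1 h2; rewrite intrD in h2.
have zz : `|(z n i)%:~R| <= `|a n ord0 i| * D + 1.
  rewrite -[X in _ * X + _](gtr0_norm D0) -normrM ler_norml.
  have := ler_norm (a n ord0 i * D); have := ler_norm (- (a n ord0 i * D)).
  rewrite normrN => n1 n2; apply/andP; split; lra.
have uD : `|a n ord0 i| * D <= u * D by rewrite ler_wpM2r// ltW.
by rewrite intr_norm; have := D0; lra.
Qed.

(** Rounding the coordinates of a_n in units of delta / d is injective by
    separation, so the sum is dominated by a sum over the lattice Z^d of a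
    product of the summable functions (1 + |z_i|)^-2, one for each coordinate. *)
Lemma summable_omega :
  (\esum_(n in [set: I]) (((1 + enorm (a n)) ^+ (2 * d))^-1)%:E < +oo)%E.
Proof.
pose K := (D + 2) ^+ (2 * d) * 4 ^+ d.
apply: (@le_lt_trans _ _ K%:E); last exact: ltry.
apply: esum_le_fset => A; rewrite sumEFin lee_fin.
pose N := (\max_(n <- A) \max_(i < d) `|z n i|)%N.
have zN n i : n \in A -> (`|z n i| < N.+1)%N.
  move=> nA; rewrite ltnS /N (bigD1_seq n)//= leq_max; apply/orP; left.
  by apply: (leq_bigmax (F := fun i => `|z n i|%N)).
(* The lattice points that occur have coordinates of absolute value at most N;
   they are coded by absolute values and signs, and the signs contribute a
   factor 2^d. *)
pose F : finType := {ffun 'I_d -> 'I_N.+1 * bool}.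
pose c n : F := [ffun i => (inord `|z n i|%N, z n i < 0)].
pose w (f : F) : R := \prod_i ((1 + ((f i).1 : nat)%:R) ^+ 2)^-1.
have cinj : {in A &, injective c}.
  move=> n n' nA n'A /ffunP cc; apply: z_inj => i.
  have := cc i; rewrite !ffunE => -[/(congr1 val)/=].
  rewrite !inordK ?zN// => e1 e2.
  by rewrite (intEsign (z n i)) (intEsign (z n' i)) e1 e2.
have w0 f : 0 <= w f by apply: prodr_ge0 => i _; rewrite invr_ge0 sqr_ge0.
have wc n : n \in A -> ((1 + enorm (a n)) ^+ (2 * d))^-1 <= (D + 2) ^+ (2 * d) * w (c n).
  move=> nA; have u1 : 0 < 1 + enorm (a n) by rewrite ltr_pwDl// enorm_ge0.
  have D2 : 0 < D + 2 by rewrite addr_gt0.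
  rewrite -ler_pdivrMl ?exprn_gt0// -invfM -exprMn.
  rewrite /w prodfV lef_pV2 ?posrE ?exprn_gt0 ?mulr_gt0//; last first.
    by apply: prodr_gt0 => i _; rewrite exprn_gt0// ltr_pwDl.
  rewrite exprM; have -> : (((D + 2) * (1 + enorm (a n))) ^+ 2) ^+ d =
      \prod_(i < d) ((D + 2) * (1 + enorm (a n))) ^+ 2.
    by rewrite prodr_const card_ord.
  apply: ler_prod => i _.
  rewrite sqr_ge0/= lerXn2r ?nnegrE ?addr_ge0//; first by rewrite mulr_ge0// ltW.
  by rewrite ffunE/= inordK ?zN// z_le.
apply: (@le_trans _ _ (\sum_(n <- A) (D + 2) ^+ (2 * d) * w (c n))).
  by rewrite big_seq [leRHS]big_seq; apply: ler_sum => n; exact: wc.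
have D2 : 0 <= D + 2 by rewrite addr_ge0// ltW.
rewrite -mulr_sumr /K ler_wpM2l ?exprn_ge0//.
apply: le_trans (sum_inj_le cinj w0) _.
rewrite /w -(bigA_distr_bigA (fun (i : 'I_d) (p : 'I_N.+1 * bool) => ((1 + (p.1 : nat)%:R) ^+ 2)^-1 : R)).
rewrite prodr_const card_ord lerXn2r ?nnegrE//.
  by apply: sumr_ge0 => p _; rewrite invr_ge0 sqr_ge0.
rewrite -(pair_bigA _ (fun (j : 'I_N.+1) (_ : bool) => ((1 + (j : nat)%:R) ^+ 2)^-1 : R))/=.
under eq_bigr do rewrite sumr_const card_bool.
rewrite sumrMnl -mulr_natl.
have := sum_inv_squares N; have : 0 <= N.+1%:R^-1 :> R by rewrite invr_ge0.
set S := \sum_(_ < _) _; set t := _^-1; lra.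
Qed.

Lemma omega_finite (M : R) : exists A : {fset I}, forall n, 1 + enorm (a n) <= M -> n \in A.
Proof.
have [M0|M0] := leP M 0.
  exists fset0 => n /le_trans => /(_ _ M0); have := enorm_ge0 (a n); lra.
have e0 : 0 < (M ^+ (2 * d))^-1 / 2 by rewrite divr_gt0 ?invr_gt0 ?exprn_gt0.
have pos n : (0 <= (((1 + enorm (a n)) ^+ (2 * d))^-1)%:E)%E.
  by rewrite lee_fin invr_ge0 exprn_ge0// addr_ge0// enorm_ge0.
have [A HA] := esum_tail pos summable_omega e0.
exists A => n nM; apply: contraT => nA.
have := HA [fset n]%fset; rewrite big_seq_fset1 lee_fin => H.
have {H} : ((1 + enorm (a n)) ^+ (2 * d))^-1 <= (M ^+ (2 * d))^-1 / 2.
  by apply: H => i; rewrite inE => /eqP ->.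
have u1 : 0 < 1 + enorm (a n) by rewrite ltr_pwDl// enorm_ge0.
have : (M ^+ (2 * d))^-1 <= ((1 + enorm (a n)) ^+ (2 * d))^-1.
  by rewrite lef_pV2 ?posrE ?exprn_gt0// lerXn2r// nnegrE ltW.
have : 0 < (M ^+ (2 * d))^-1 by rewrite invr_gt0 exprn_gt0.
lra.
Qed.

End separated_points.

(** * The covering by cubes *)

Section ae_countable.
Context dd (T : measurableType dd) (R : realType) (mu : {measure set T -> \bar R}).

Lemma ae_forall_countable (I : countType) (P : I -> T -> Prop) :
  (forall i, {ae mu, forall x, P i x}) -> {ae mu, forall x, forall i, P i x}.
Proof.
move=> H.
have : {ae mu, forall x, forall n : nat,
    if choice.unpickle n is Some i then P i x else True}.
  apply: ae_foralln => n; case: (choice.unpickle n) => [i|]; first exact: H.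
  exact: aeW.
apply: filterS => x Hx i; have := Hx (choice.pickle i).
by rewrite choice.pickleK.
Qed.

End ae_countable.

Lemma cabs_sum_sq (R : realType) (I : choiceType) (A : {fset I}) (z : I -> R[i]) :
  Normc.normc (\sum_(j <- A) z j) ^+ 2 <= #|` A|%:R * \sum_(j <- A) Normc.normc (z j) ^+ 2.
Proof.
(* Cauchy-Schwarz against the constant family. *)
have sq0 (w : I -> R) (s : seq I) : (forall j, 0 <= w j) ->
    (\sum_(j <- s) w j) ^+ 2 <= (size s)%:R * \sum_(j <- s) w j ^+ 2.
  move=> w0; elim: s => [|j s IH]; first by rewrite !big_nil mulr0 expr0n.
  rewrite !big_cons /= -natr1.
  have S0 : 0 <= \sum_(j <- s) w j by exact: sumr_ge0.
  case: s IH S0 => [|j' s'] IH S0; first by rewrite !big_nil/= !addr0 add0r mul1r.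
  have n0 : (0 : R) < (size (j' :: s'))%:R by [].
  move: IH S0 n0; set n := (size _)%:R; set S := \sum_(_ <- _) w _; set Q := \sum_(_ <- _) _.
  move=> IH S0 n0; have wj := w0 j; set u := w j in wj *.
  have : 2 * u * S <= n * u ^+ 2 + Q.
    have Qn : S ^+ 2 / n <= Q by rewrite ler_pdivrMr// mulrC.
    apply: le_trans (lerD (lexx _) Qn).
    have -> : n * u ^+ 2 + S ^+ 2 / n = 2 * u * S + n^-1 * (n * u - S) ^+ 2.
      by field; rewrite gt_eqF.
    by rewrite lerDl mulr_ge0 ?sqr_ge0// invr_ge0 ltW.
  by move: IH; rewrite sqrrD -mulr_natl; nra.
apply: le_trans (sq0 (fun j => Normc.normc (z j)) A (fun j => cabs_ge0 (z j))).
by rewrite lerXn2r ?nnegrE ?cabs_ge0//; [apply: sumr_ge0 => j _; exact: cabs_ge0|exact: cabs_sum].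
Qed.

Section painless_geometry.
Variables (R : realType) (d : nat).
Local Notation E := 'rV[R]_d.
Local Notation Z := 'rV[int]_d.
Local Notation mu := (rV_lebesgue R d).
Local Notation C := R[i].
Local Notation cabs := (@Normc.normc R).
Variables (g : Z -> E -> R) (a : Z -> E) (b : Z -> R) (Cs : R).
Hypothesis (d_gt0 : (0 < d)%N) (painless : painless_NSGF g a b Cs).
Local Notation cube := (cube a b Cs).
Local Notation omega := (omega a).

Lemma b_gt0 n : 0 < b n. Proof. by have [[]] := painless. Qed.
Lemma Cs_gt0 : 0 < Cs. Proof. by have [_ [[]]] := painless. Qed.
Lemma bV_gt0 n : 0 < (b n)^-1. Proof. by rewrite invr_gt0 b_gt0. Qed.
Lemma eps_gt0 n : 0 < Cs / b n. Proof. by rewrite divr_gt0 ?Cs_gt0 ?b_gt0. Qed.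

Lemma omega_gt0 n : 0 < omega n.
Proof. by rewrite /Defs.omega ltr_pwDl// enorm_ge0. Qed.

Lemma omega_ge1 n : 1 <= omega n.
Proof. by rewrite /Defs.omega lerDl enorm_ge0. Qed.

Definition corner n : E := \row_i (a n ord0 i - Cs / b n).
(** The frequency for which the cube is a period cell of the exponentials, so
    that the Fourier uniqueness theorem also applies on the cube. *)
Definition cfreq n : R := ((b n)^-1 + 2 * (Cs / b n))^-1.

Lemma cfreq_gt0 n : 0 < cfreq n.
Proof. by rewrite invr_gt0 addr_gt0 ?bV_gt0// mulr_gt0// eps_gt0. Qed.

Lemma cubeE n : cube n = obox (corner n) (cfreq n)^-1.
Proof.
by apply/seteqP; split => x h i; have := h i; rewrite mxE invrK;
  move=> /andP[h1 h2]; apply/andP; split; lra.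
Qed.

Lemma measurable_cube n : measurable (cube n).
Proof. by rewrite cubeE; exact: measurable_obox. Qed.

Lemma a_in_cube n : cube n (a n).
Proof.
move=> i; rewrite subrr; have := bV_gt0 n; have := eps_gt0 n => h1 h2.
by apply/andP; split; lra.
Qed.

(** The interior of the box that contains the support of g_n. *)
Definition wbox n : set E := obox (a n) (b n)^-1.

Lemma wbox_cube n : wbox n `<=` cube n.
Proof.
move=> x h i; have /andP[h1 h2] := h i; have := eps_gt0 n => h3.
by apply/andP; split; lra.
Qed.

Lemma moderate : exists K : R, 1 <= K /\ forall n x y, cube n x -> cube n y ->
  1 + enorm x <= K * (1 + enorm y).
Proof.
have [_ [_ _ [K [K0 HK]] _]] := painless; exists (K + 1); split; first lra.
move=> n x y cx cy; apply: le_trans (HK n x y cx cy) _.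
by rewrite ler_wpM2r ?addr_ge0 ?enorm_ge0//; lra.
Qed.

Lemma separated : exists2 delta : R, 0 < delta &
  forall n n', n != n' -> delta <= enorm (a n - a n').
Proof.
have [_ [_ i0 _ _]] := painless; exists (inf [set enorm (a p.1 - a p.2) | p in [set p : Z * Z | p.1 != p.2]]) => //.
move=> n n' nn'; apply: ge_inf; last by exists (n, n').
by exists 0 => _ [p _ <-]; exact: enorm_ge0.
Qed.

Lemma esum_omega : (\esum_(n in [set: Z]) ((omega n ^+ (2 * d))^-1)%:E < +oo)%E.
Proof. by have [delta d0 H] := separated; exact: summable_omega d_gt0 d0 H. Qed.

(** If I_n meets a ball then a_n lies in a larger ball, by moderateness, and
    this happens for finitely many n, by separation. *)
Lemma cubes_locally_finite (M : R) : exists A : {fset Z},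
  forall n x, cube n x -> enorm x <= M -> n \in A.
Proof.
have [K [K1 HK]] := moderate; have [delta d0 H] := separated.
have [A HA] := omega_finite d_gt0 d0 H (K * (1 + M)).
exists A => n x cx xM; apply: HA.
apply: le_trans (HK n _ _ (a_in_cube n) cx) _.
by rewrite ler_wpM2l ?lerD2l// (le_trans _ K1).
Qed.

Definition cells (x : E) : {fset Z} := fset_set [set n | cube n x].

Lemma mem_cells n x : (n \in cells x) = (n \in [set n | cube n x]).
Proof.
rewrite in_fset_set//.
have [A HA] := cubes_locally_finite (enorm x).
by apply: (sub_finite_set _ (finite_fset A)) => k ck /=; exact: HA ck _.
Qed.

Lemma cellsP n x : reflect (cube n x) (n \in cells x).
Proof. by rewrite mem_cells; apply: (iffP idP); rewrite inE. Qed.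

Definition nb (n : Z) : {fset Z} := fset_set [set n' | cube n' `&` cube n !=set0].

Lemma card_nb : exists n0 : nat, forall n, (#|` nb n| <= n0)%N.
Proof.
have [_ [[_ [n0 H]] _ _ _]] := painless; exists n0 => n.
exact: geq_card_fset_set (H n).
Qed.

Lemma mem_nb n n' : (n' \in nb n) = (n' \in [set k | cube k `&` cube n !=set0]).
Proof.
have [_ [[_ [n0 H]] _ _ _]] := painless.
by rewrite in_fset_set//; apply/finite_set_leP; exists n0; exact: H.
Qed.

Lemma nbP n n' : reflect (cube n' `&` cube n !=set0) (n' \in nb n).
Proof. by rewrite mem_nb; apply: (iffP idP); rewrite inE. Qed.

Lemma nb_sym n n' : (n' \in nb n) = (n \in nb n').
Proof. by apply/nbP/nbP; rewrite setIC. Qed.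

Lemma cube_nb n n' x : cube n x -> cube n' x -> n' \in nb n.
Proof. by move=> cn cn'; apply/nbP; exists x. Qed.

Lemma omega_nb : exists K : R, 1 <= K /\ forall n n', n' \in nb n -> omega n <= K * omega n'.
Proof.
have [K [K1 HK]] := moderate; have K0 : 0 <= K by rewrite (le_trans _ K1).
exists (K * K); split; first by rewrite -[1]mulr1 ler_pM.
move=> n n' /nbP[x [xn' xn]].
apply: le_trans (HK n _ _ (a_in_cube n) xn) _; rewrite -mulrA ler_wpM2l//.
exact: HK xn' (a_in_cube n').
Qed.

(** The sum over all n, if k n vanishes outside of I_n. *)
Definition patchwork (V : nmodType) (k : Z -> E -> V) (x : E) : V :=
  \sum_(n <- cells x) k n x.

Lemma patchworkE (V : nmodType) (k : Z -> E -> V) (A : {fset Z}) x :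
  (forall n, ~ cube n x -> k n x = 0) ->
  (forall n, cube n x -> n \in A) -> patchwork k x = \sum_(n <- A) k n x.
Proof.
move=> k0 HA; apply: big_fset_incl; first by apply/fsubsetP => n /cellsP /HA.
by move=> n _ nc; apply: k0; apply/cellsP.
Qed.

Lemma cmeasurable_patchwork (k : Z -> E -> C) : (forall n, cmeasurable (k n)) ->
  (forall n x, ~ cube n x -> k n x = 0) -> cmeasurable (patchwork k).
Proof.
move=> mk k0.
have /choice[A HA] := fun N : nat => cubes_locally_finite N%:R.
pose H (N : nat) x := \sum_(n <- A N) k n x.
apply: (@ccvg_cmeasurable _ _ H); first by move=> N; exact: cmeasurable_sum.
move=> x; have near_eq : \forall N \near \oo, H N x = patchwork k x.
  have [N _ HN] := nbhs_infty_ger (enorm x).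
  exists N => // M NM /=; rewrite /H (@patchworkE _ _ (A M))//.
    by move=> n; exact: k0.
  by move=> n cn; apply: HA cn _; exact: HN.
by split; apply: cvg_near_cst; apply: filterS near_eq => N ->.
Qed.

Variable psi : Z -> E -> R.
Hypothesis bapu : BAPU a b Cs psi.

Lemma psi_ge0 n x : 0 <= psi n x. Proof. by have [] := bapu. Qed.
Lemma psi_smooth n : smooth (psi n). Proof. by have [] := bapu. Qed.
Lemma psi_compact n : compact (supp (psi n)). Proof. by have [_ _ /(_ n)[]] := bapu. Qed.
Lemma psi_off n x : ~ cube n x -> psi n x = 0.
Proof.
move=> nc; apply: off_supp => sx; apply: nc; have [_ _ /(_ n)[_ h] _] := bapu.
exact: h.
Qed.

Lemma psi_sum x (A : {fset Z}) : (forall n, cube n x -> n \in A) ->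
  \sum_(n <- A) psi n x = 1.
Proof.
move=> HA; have [_ _ _ /(_ x)] := bapu.
rewrite (@esum_fin_supp _ _ _ A); first by rewrite sumEFin => -[].
  by move=> n; rewrite lee_fin psi_ge0.
move=> n nA; rewrite psi_off// => /HA; exact/negP.
Qed.

Lemma psi_le1 n x : psi n x <= 1.
Proof.
have [cn|nc] := pselect (cube n x); last by rewrite psi_off.
rewrite -(@psi_sum x (cells x)); last by move=> k ck; apply/cellsP.
rewrite (big_fsetD1 n)/=; last exact/cellsP.
by rewrite lerDl sumr_ge0// => k _; exact: psi_ge0.
Qed.

Lemma cabs_psi_le n x (z : C) : cabs ((psi n x)%:C * z) <= cabs z.
Proof.
rewrite cabsM cabs_real ger0_norm ?psi_ge0//.
by rewrite ler_piMl ?cabs_ge0// psi_le1.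
Qed.

Lemma psi_pos x : exists n, 0 < psi n x.
Proof.
apply: contrapT => H.
have := @psi_sum x (cells x) (fun n cn => introT (cellsP n x) cn).
rewrite big1 => [/eqP|n _]; first by rewrite eq_sym oner_eq0.
apply/eqP; rewrite eq_le psi_ge0 andbT leNgt; apply/negP => h.
by apply: H; exists n.
Qed.

Lemma psi_measurable n : measurable_fun setT (psi n).
Proof. exact: smooth_measurable (psi_smooth n). Qed.

Lemma cmeasurable_psi n (f : E -> C) : cmeasurable f ->
  cmeasurable (fun x => (psi n x)%:C * f x).
Proof.
by move=> mf; apply: cmeasurableM => //; apply: cmeasurable_real; exact: psi_measurable.
Qed.

(** On I_n the function f is the sum of the psi_j f over the neighbours j of
    n. *)
Lemma sqn_cube_le (f : E -> C) n : cmeasurable f ->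
  (sqn (fun x => (\1_(cube n) x)%:C * f x)%R <=
   #|` nb n|%:R%:E * \sum_(j <- nb n) sqn (fun x => (psi j x)%:C * f x)%R)%E.
Proof.
move=> mf; rewrite /sqn -ge0_integral_sum//; last 2 first.
- by move=> j; apply: emeasurable_cabs2; exact: cmeasurable_psi.
- by move=> j x _; rewrite lee_fin sqr_ge0.
rewrite -ge0_integralZl_EFin//; last 2 first.
- by move=> x _; apply: sume_ge0 => j _; rewrite lee_fin sqr_ge0.
- by apply: emeasurable_sum => j; apply: emeasurable_cabs2; exact: cmeasurable_psi.
apply: ge0_le_integral => //.
- by move=> x _; rewrite lee_fin sqr_ge0.
- apply: emeasurable_cabs2; apply: cmeasurableM => //; apply: cmeasurable_real.
  by apply: measurable_indic; exact: measurable_cube.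
- by apply: measurable_funeM; apply: emeasurable_sum => j; apply: emeasurable_cabs2; exact: cmeasurable_psi.
move=> x _; rewrite sumEFin -EFinM lee_fin.
have [cx|nc] := pselect (cube n x); last first.
  rewrite indicE memNset//= mul0r cabs0 expr0n/= mulr_ge0// sumr_ge0// => j _.
  exact: sqr_ge0.
rewrite indicE mem_set// mul1r.
apply: le_trans (cabs_sum_sq _ _); rewrite -mulr_suml -rmorph_sum/=.
by rewrite psi_sum ?mul1r// => k ck; exact: cube_nb cx ck.
Qed.

End painless_geometry.

(** * Functions that are locally in L^2 *)

Section pairing.
Variables (R : realType) (d : nat).
Local Notation E := 'rV[R]_d.
Local Notation Z := 'rV[int]_d.
Local Notation mu := (rV_lebesgue R d).
Local Notation C := R[i].
Local Notation cabs := (@Normc.normc R).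
Variables (g : Z -> E -> R) (a : Z -> E) (b : Z -> R) (Cs : R).
Hypothesis (d_gt0 : (0 < d)%N) (painless : painless_NSGF g a b Cs).
Variable psi : Z -> E -> R.
Hypothesis bapu : BAPU a b Cs psi.
Local Notation cube := (cube a b Cs).
Local Notation omega := (omega a).
Local Notation lpsi n f := (fun x => (psi n x)%:C * f x).

(** A form of [inL2loc] adapted to the norms of the decomposition spaces. *)
Definition locL2 (f : E -> C) := cmeasurable f /\ forall n, L2 (lpsi n f).

Lemma locL2D f f' : locL2 f -> locL2 f' -> locL2 (fun x => f x + f' x).
Proof.
move=> [mf Lf] [mf' Lf']; split=> [|n]; first exact: cmeasurableD.
by have := L2D (Lf n) (Lf' n); congr L2; apply/funext => x; rewrite mulrDr.
Qed.

Lemma locL2Z c f : locL2 f -> locL2 (fun x => c * f x).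
Proof.
move=> [mf Lf]; split=> [|n]; first by apply: cmeasurableM => //; exact: cmeasurable_cst.
by have := L2Z c (Lf n); congr L2; apply/funext => x; rewrite mulrCA.
Qed.

Lemma L2_locL2 h : L2 h -> locL2 h.
Proof.
move=> [mh h2]; split=> // n; split; first exact: (cmeasurable_psi bapu).
apply: le_lt_trans h2; apply: le_sqn => //; first exact: (cmeasurable_psi bapu).
by move=> x; exact: (cabs_psi_le d_gt0 painless bapu).
Qed.

Lemma cube_measure n : mu (cube n) = ((cfreq b Cs n)^-1 ^+ d)%:E.
Proof. by rewrite cubeE obox_measure// (cfreq_gt0 painless). Qed.

Lemma mu_cube_lty n : (mu (cube n) < +oo)%E.
Proof. by rewrite cube_measure ltry. Qed.

(** Comparing 1 + |x| with omega_n at two points x of the cube whose first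
    coordinates differ by half a side bounds the side by a multiple of
    omega_n. *)
Lemma cube_side_le : exists K : R, 0 <= K /\ forall n, (cfreq b Cs n)^-1 <= K * omega n.
Proof.
have [K [K1 HK]] := moderate painless.
exists (4 * K); split; first lra.
move=> n; set L := (cfreq b Cs n)^-1.
have L0 : 0 < L by rewrite invr_gt0 (cfreq_gt0 painless).
pose pt (t : R) : E := \row_i (corner a b Cs n ord0 i + t * L).
have cpt t : 0 < t < 1 -> cube n (pt t).
  move=> /andP[t0 t1]; rewrite cubeE => i; rewrite !mxE [_ + t * L]addrC addrK.
  by rewrite mulr_gt0//= gtr_pMl.
have h t : 0 < t < 1 -> enorm (pt t) <= K * omega n - 1.
  by move=> t01; rewrite lerBrDl; exact: HK (cpt t t01) (a_in_cube painless n).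
have := coord_le_enorm (pt (3 / 4)) (Ordinal d_gt0).
have := coord_le_enorm (pt (1 / 4)) (Ordinal d_gt0).
have := h (3 / 4) ltac:(by lra); have := h (1 / 4) ltac:(by lra).
rewrite !mxE; set c := a n _ _ - _.
have := ler_norm (c + 3 / 4 * L); have := ler_norm (- (c + 1 / 4 * L)).
rewrite normrN; lra.
Qed.

Lemma L2_cube_bounded n (phi : E -> C) P : cmeasurable phi -> (forall x, cabs (phi x) <= P) ->
  L2 (fun x => (\1_(cube n) x)%:C * phi x).
Proof.
move=> mphi phiP; have P0 : 0 <= P by apply: le_trans (phiP 0); exact: cabs_ge0.
have m1 : cmeasurable (fun x => (\1_(cube n) x)%:C * phi x).
  apply: cmeasurableM => //; apply: cmeasurable_real; apply: measurable_indic.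
  exact: measurable_cube.
split => //.
apply: (@le_lt_trans _ _ (\int[mu]_x ((P ^+ 2)%:E * (\1_(cube n) x)%:E))%E).
  apply: ge0_le_integral => //.
  - by move=> x _; rewrite lee_fin sqr_ge0.
  - exact: emeasurable_cabs2.
  - by apply: measurable_funeM; apply/measurable_EFinP; apply: measurable_indic; exact: measurable_cube.
  move=> x _; rewrite -EFinM lee_fin cabsM cabs_real exprMn ger0_norm// indicE.
  case: (_ \in _); rewrite ?expr1n ?expr0n/= ?mul1r ?mulr1 ?mul0r ?mulr0//.
  by rewrite lerXn2r ?nnegrE ?cabs_ge0.
rewrite ge0_integralZl_EFin ?sqr_ge0//; last first.
  by apply/measurable_EFinP; apply: measurable_indic; exact: measurable_cube.
rewrite integral_indic//; last exact: measurable_cube.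
by rewrite setIT lte_mul_pinfty ?lee_fin ?sqr_ge0// mu_cube_lty.
Qed.

Lemma locL2_piece n (f phi : E -> C) P : locL2 f -> cmeasurable phi ->
  (forall x, cabs (phi x) <= P) -> cintegrable (fun x => (psi n x)%:C * f x * phi x).
Proof.
move=> [mf Lf] mphi phiP.
have := L2M_cintegrable (Lf n) (L2_cube_bounded n mphi phiP).
congr cintegrable; apply/funext => x.
have [cx|nc] := pselect (cube n x); first by rewrite indicE mem_set//= mul1r.
by rewrite (psi_off bapu nc) !mul0r.
Qed.

Lemma compact_enorm_bounded (K : set E) : compact K -> exists M : R, forall x, K x -> enorm x <= M.
Proof.
move=> cK; have [K0|/set0P nK] := eqVneq K set0; first by exists 0 => x; rewrite K0.
have ce : {within K, continuous (@enorm R d)}.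
  by apply: continuous_subspaceT; exact: enorm_continuous.
have [x Kx xmax] := compact_EVT_max nK cK ce.
by exists (enorm x) => y Ky; exact: xmax (mem_set Ky).
Qed.

Lemma compact_cells (K : set E) : compact K ->
  exists A : {fset Z}, forall n x, cube n x -> K x -> n \in A.
Proof.
move=> /compact_enorm_bounded[M HM].
have [A HA] := cubes_locally_finite d_gt0 painless M.
by exists A => n x cx Kx; apply: HA cx (HM x Kx).
Qed.

Lemma test_bounded (phi : E -> C) : test_function phi -> exists P, forall x, cabs (phi x) <= P.
Proof.
move=> tp; have [_ /(_ 0%N)] := test_schwartz tp => h.
have sfin : schwartz_norm 0 phi \is a fin_num by rewrite ge0_fin_numE ?schwartz_norm_ge0.
exists (fine (schwartz_norm 0 phi)) => x.
have := @schwartz_norm_ub R d 0 phi [::] x (leqnn _).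
rewrite -(fineK sfin) lee_fin expr0 mul1r.
by congr (_ <= _); congr cabs; exact: ceqP.
Qed.

Lemma test_split (f phi : E -> C) (A : {fset Z}) :
  (forall n x, cube n x -> supp phi x -> n \in A) ->
  (fun x => f x * phi x) = (fun x => \sum_(n <- A) (psi n x)%:C * f x * phi x) :> (E -> C).
Proof.
move=> HA; apply/funext => x.
have [sx|/off_supp ->] := pselect (supp phi x); last first.
  by rewrite mulr0 big1// => n _; rewrite mulr0.
rewrite -!mulr_suml -rmorph_sum (psi_sum bapu) ?mul1r//.
by move=> n cn; exact: HA cn sx.
Qed.

Lemma locL2_test_integrable (f phi : E -> C) : locL2 f -> test_function phi ->
  cintegrable (fun x => f x * phi x).
Proof.
move=> Lf tp; have [A HA] := compact_cells tp.2.
rewrite (test_split f HA); apply: cintegrable_sum => n.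
have [P HP] := test_bounded tp.
apply: locL2_piece Lf _ HP; exact: csmooth_cmeasurable tp.1.
Qed.

Lemma inL2loc_locL2 (f : E -> C) : inL2loc f -> locL2 f.
Proof.
move=> [mf Lf]; split=> // n; split; first exact: (cmeasurable_psi bapu).
have cK : compact (supp (psi n)) by exact: (psi_compact bapu).
have mK := compact_measurable_rV cK.
apply: le_lt_trans (Lf _ cK); rewrite [leRHS]integral_mkcond.
apply: ge0_le_integral => //.
- by move=> x _; rewrite lee_fin sqr_ge0.
- by apply: emeasurable_cabs2; exact: (cmeasurable_psi bapu).
- apply/(measurable_restrictT _ mK); apply: measurable_funTS.
  exact: emeasurable_cabs2.
move=> x _; rewrite patchE; case: ifP => sx.
  rewrite lee_fin lerXn2r ?nnegrE ?cabs_ge0//.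
  exact: (cabs_psi_le d_gt0 painless bapu).
rewrite off_supp ?mul0r ?cabs0 ?expr0n//.
by move/mem_set; rewrite sx.
Qed.

Lemma locL2_inL2loc (f : E -> C) : locL2 f -> inL2loc f.
Proof.
move=> [mf Lf]; split=> // K cK; have [A HA] := compact_cells cK.
have mK := compact_measurable_rV cK.
pose B : R := #|` A|%:R.
apply: (@le_lt_trans _ _ (B%:E * \sum_(n <- A) sqn (lpsi n f))%E); last first.
  apply: lte_mul_pinfty; rewrite ?lee_fin//.
  by apply: lte_sum_pinfty => n _; have [] := Lf n.
rewrite integral_mkcond /sqn -ge0_integral_sum//; last 2 first.
- by move=> j; apply: emeasurable_cabs2; exact: (cmeasurable_psi bapu).
- by move=> j x _; rewrite lee_fin sqr_ge0.
rewrite -ge0_integralZl_EFin//; last 2 first.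
- by move=> x _; apply: sume_ge0 => j _; rewrite lee_fin sqr_ge0.
- by apply: emeasurable_sum => j; apply: emeasurable_cabs2; exact: (cmeasurable_psi bapu).
apply: ge0_le_integral => //.
- by move=> x _; rewrite patchE; case: ifP => // _; rewrite lee_fin sqr_ge0.
- apply/(measurable_restrictT _ mK); apply: measurable_funTS.
  exact: emeasurable_cabs2.
- by apply: measurable_funeM; apply: emeasurable_sum => j; apply: emeasurable_cabs2; exact: (cmeasurable_psi bapu).
move=> x _; rewrite sumEFin -EFinM patchE; case: ifPn => Kx; last first.
  by rewrite lee_fin mulr_ge0// sumr_ge0// => j _; exact: sqr_ge0.
rewrite lee_fin; apply: le_trans (cabs_sum_sq _ _).
rewrite -mulr_suml -rmorph_sum/= (psi_sum bapu) ?mul1r//.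
by move=> k ck; apply: HA ck _; rewrite inE in Kx.
Qed.

Lemma test_expi n m : test_function (lpsi n (fun x => (expi (cfreq b Cs n) m x)^* : C)).
Proof.
apply: test_mulr; [exact: (psi_smooth bapu)|exact: (psi_compact bapu)|].
set be := cfreq b Cs n; split.
  have := @smooth_wave R d 1 0 be m; congr smooth; apply/funext => x.
  by rewrite /wave /cRe cReJ /expi/= mul1r mul0r addr0.
have := @smooth_wave R d 0 (-1) be m; congr smooth; apply/funext => x.
by rewrite /wave /cIm cImJ /expi/= mul0r mulN1r add0r.
Qed.

(** The fundamental lemma of the calculus of variations. The functions psi_n
    exp(-2 pi i m.x), with frequencies adapted to the cube I_n, are test
    functions; hence all Fourier coefficients of psi_n f on I_n vanish. *)
Lemma locL2_test_eq0 f : locL2 f ->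
  (forall phi, test_function phi -> cint (fun x => f x * phi x) = 0) ->
  {ae mu, forall x, f x = 0}.
Proof.
move=> Lf f0.
have pf0 n : {ae mu, forall x, (psi n x)%:C * f x = 0}.
  have off x : ~ obox (corner a b Cs n) (cfreq b Cs n)^-1 x -> (psi n x)%:C * f x = 0.
    by rewrite -cubeE => /(psi_off bapu) ->; rewrite mul0r.
  apply: (box_uniqueness (cfreq_gt0 painless n) (Lf.2 n) off) => m.
  rewrite inner_ebox_off// -[RHS](f0 _ (test_expi n m)).
  by apply: eq_cint => x; rewrite [_ * f x]mulrC mulrA.
have := ae_forall_countable pf0; apply: filterS => x Hx.
have [n pn] := psi_pos d_gt0 painless bapu x.
have /eqP := Hx n; rewrite mulf_eq0 => /orP[|/eqP//].
by rewrite (inj_eq (@complexI R)) gt_eqF.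
Qed.

Lemma locL2_test_eq f f' : locL2 f -> locL2 f' ->
  (forall phi, test_function phi -> dist_of f phi = dist_of f' phi) ->
  {ae mu, forall x, f x = f' x}.
Proof.
move=> Lf Lf' ff'.
have : {ae mu, forall x, f x + -1 * f' x = 0}.
  apply: locL2_test_eq0; first by apply: locL2D => //; exact: locL2Z.
  move=> phi tp; have i1 := locL2_test_integrable Lf tp.
  have i2 := locL2_test_integrable Lf' tp.
  rewrite (_ : (fun x => _) = (fun x => f x * phi x - f' x * phi x)); last first.
    by apply/funext => x; rewrite mulrDl mulN1r mulNr.
  by rewrite cintB//; apply/eqP; rewrite subr_eq0; apply/eqP; exact: ff'.
by apply: filterS => x /eqP; rewrite mulN1r subr_eq0 => /eqP.
Qed.

(** The integral of |psi_n f phi| is at most sup_(I_n) |phi| times ||psi_n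
    f||^2 + |I_n|, which grows at most like a power of omega_n. As phi
    decreases faster than any power, the sum over n is dominated by the sum of
    omega_n^(-2d). *)
Lemma growth_pairing f (M : R) (r : nat) : locL2 f -> 0 <= M ->
  (forall n, (sqn (lpsi n f) <= (M * omega n ^+ r)%:E)%E) ->
  exists (k : nat) (K : R), 0 <= K /\ forall phi P, cmeasurable phi ->
    (forall x, (1 + enorm x) ^+ k * cabs (phi x) <= P) ->
    cintegrable (fun x => f x * phi x) /\
    cabs (cint (fun x => f x * phi x)) <= K * P.
Proof.
move=> [mf Lf] M0 fM.
have [L [L0 HL]] := cube_side_le; have [W [W1 HW]] := moderate painless.
have W0 : 0 <= W by rewrite (le_trans _ W1).
pose k := (r + d + 2 * d)%N.
pose c := W ^+ k * (M + L ^+ d).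
have c0 : 0 <= c by rewrite mulr_ge0 ?exprn_ge0// addr_ge0// exprn_ge0.
have So := esum_omega d_gt0 painless.
set S := (\esum_(n in _) _)%E in So.
have S0 : (0 <= S)%E.
  by apply: esum_ge0 => n _; rewrite lee_fin invr_ge0 exprn_ge0// ltW// omega_gt0.
have Sfin : S \is a fin_num by rewrite ge0_fin_numE.
exists k, (2 * (c * fine S)); split.
  by rewrite mulr_ge0// mulr_ge0// fine_ge0.
move=> phi P mphi phiP.
have P0 : 0 <= P.
  by apply: le_trans (phiP 0); rewrite mulr_ge0 ?cabs_ge0// exprn_ge0// addr_ge0// enorm_ge0.
have mfp : cmeasurable (fun x => f x * phi x) by exact: cmeasurableM.
have pc n x : cube n x -> cabs (phi x) <= P * W ^+ k / omega n ^+ k.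
  move=> cx; have o0 := omega_gt0 a n.
  have x0 : 0 < 1 + enorm x by rewrite ltr_pwDl// enorm_ge0.
  rewrite ler_pdivlMr ?exprn_gt0//.
  apply: (@le_trans _ _ (cabs (phi x) * (W * (1 + enorm x)) ^+ k)).
    rewrite ler_wpM2l ?cabs_ge0// lerXn2r ?nnegrE ?(ltW o0)//.
      by rewrite mulr_ge0// ltW.
    exact: HW (a_in_cube painless n) cx.
  by rewrite exprMn mulrCA mulrC ler_wpM2r ?exprn_ge0// mulrC.
pose F n x := (cabs ((psi n x)%:C * f x * phi x))%:E.
have mF n : measurable_fun setT (F n).
  apply/measurable_EFinP; apply: cmeasurable_cabs; apply: cmeasurableM => //.
  exact: (cmeasurable_psi bapu).
have FE x : ((cabs (f x * phi x))%:E = \esum_(n in [set: Z]) F n x)%E.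
  rewrite (@esum_fin_supp _ _ _ (cells a b Cs x)); last 2 first.
  - by move=> n; rewrite lee_fin cabs_ge0.
  - move=> n /(cellsP d_gt0 painless) nc.
    by rewrite /F (psi_off bapu nc) !mul0r cabs0.
  rewrite sumEFin; congr EFin; under eq_bigr do rewrite -mulrA cabsM cabs_real.
  rewrite -mulr_suml; under eq_bigr do rewrite ger0_norm ?(psi_ge0 bapu)//.
  rewrite (psi_sum bapu) ?mul1r//.
  by move=> n cn; apply/(cellsP d_gt0 painless).
have Fn n : (\int[mu]_x F n x <= (c * P)%:E * ((omega n ^+ (2 * d))^-1)%:E)%E.
  have o0 := omega_gt0 a n; have o1 := omega_ge1 a n.
  pose p := P * W ^+ k / omega n ^+ k.
  have p0 : 0 <= p.
    apply: divr_ge0; last by apply: exprn_ge0; exact: ltW.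
    by apply: mulr_ge0 => //; apply: exprn_ge0.
  have mI : measurable_fun setT (fun x => ((\1_(cube n) x : R)%:E)).
    by apply/measurable_EFinP; apply: measurable_indic; exact: measurable_cube.
  have ms : measurable_fun setT (fun x => (cabs ((psi n x)%:C * f x) ^+ 2)%:E).
    by apply: emeasurable_cabs2; exact: (cmeasurable_psi bapu).
  apply: (@le_trans _ _ (\int[mu]_x (p%:E * ((cabs ((psi n x)%:C * f x) ^+ 2)%:E + (\1_(cube n) x)%:E)))%E).
    apply: ge0_le_integral => //.
    - by move=> x _; rewrite lee_fin cabs_ge0.
    - by apply: measurable_funeM; exact: emeasurable_funD.
    move=> x _; rewrite -EFinD -EFinM lee_fin.
    have [cx|nc] := pselect (cube n x); last first.
      rewrite (psi_off bapu nc) !mul0r cabs0 expr0n/= add0r mulr_ge0//.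
    rewrite cabsM mulrC; apply: ler_pM; rewrite ?cabs_ge0//; first exact: pc.
    rewrite indicE mem_set//=; set u := cabs _.
    by have := sqr_ge0 (u - 1); have := sqr_ge0 u; rewrite sqrrB; nra.
  rewrite ge0_integralZl_EFin//; last 2 first.
  - by move=> x _; rewrite -EFinD lee_fin addr_ge0// sqr_ge0.
  - exact: emeasurable_funD.
  rewrite ge0_integralD//; last by move=> x _; rewrite lee_fin sqr_ge0.
  rewrite integral_indic ?setIT//; last exact: measurable_cube.
  apply: (@le_trans _ _ (p%:E * ((M * omega n ^+ r)%:E + ((L * omega n) ^+ d)%:E))%E).
    apply: lee_wpmul2l; rewrite ?lee_fin//; apply: leeD; first exact: fM.
    rewrite [leLHS]cube_measure lee_fin lerXn2r ?nnegrE ?mulr_ge0 ?(ltW o0)//.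
    by rewrite invr_ge0 ltW// (cfreq_gt0 painless).
  rewrite -EFinD -!EFinM lee_fin.
  apply: (@le_trans _ _ (p * ((M + L ^+ d) * omega n ^+ (r + d)))).
    rewrite ler_wpM2l// mulrDl exprMn lerD// ler_wpM2l ?exprn_ge0//.
      by apply: ler_weXn2l => //; exact: leq_addr.
    by apply: ler_weXn2l => //; exact: leq_addl.
  rewrite le_eqVlt; apply/orP; left; apply/eqP.
  rewrite /p /c /k [omega n ^+ (r + d + 2 * d)]exprD.
  have := lt0r_neq0 (exprn_gt0 (r + d) o0); have := lt0r_neq0 (exprn_gt0 (2 * d) o0).
  set u := omega n ^+ (r + d); set v := omega n ^+ (2 * d) => v0 u0.
  by field; rewrite v0 u0.
have tot : (\int[mu]_x (cabs (f x * phi x))%:E <= (c * P * fine S)%:E)%E.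
  under eq_integral do rewrite FE.
  rewrite integral_esum//; last by move=> n x; rewrite lee_fin cabs_ge0.
  apply: le_trans (le_esum (fun n _ => Fn n)) _.
  apply: le_trans (esumZ_le _ _) _; first by rewrite mulr_ge0.
    by move=> n; rewrite lee_fin invr_ge0 exprn_ge0// ltW// omega_gt0.
  by rewrite -/S -[in leLHS](fineK Sfin) -EFinM.
have ia : mu.-integrable setT (EFin \o (fun x => cabs (f x * phi x))).
  apply/integrableP; split; first by apply/measurable_EFinP; exact: cmeasurable_cabs.
  apply: le_lt_trans (ltry (c * P * fine S)); apply: le_trans tot.
  under eq_integral do rewrite /= ger0_norm ?cabs_ge0//; exact: lexx.
have ic : cintegrable (fun x => f x * phi x) by exact: le_cintegrable ia _.
split=> //; apply: le_trans (cint_le ic) _.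
rewrite -mulrA ler_wpM2l// -lee_fin /Rintegral fineK; last exact: integrable_fin_num.
by apply: le_trans tot _; rewrite lee_fin mulrAC.
Qed.

End pairing.

(** * Tempered distributions given by locally square integrable functions *)

Lemma le_poweR (R : realType) (r : R) (x y : \bar R) : 0 <= r -> (0 <= x)%E -> (x <= y)%E ->
  (x `^ r <= y `^ r)%E.
Proof.
move=> r0 x0 xy; apply: gt0_ler_poweR => //; rewrite in_itv/= leey andbT//.
exact: le_trans xy.
Qed.

Lemma partialsZ (R : realType) (d : nat) (c : R) (f : 'rV[R]_d -> R) s : smooth f ->
  partials s (fun x => c * f x) = (fun x => c * partials s f x).
Proof.
move=> sf; elim: s => // i s IH; rewrite [LHS]/= -/(partials s _) IH.
by apply/funext => x; rewrite deriveMl//; exact: smooth_derivable.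
Qed.

Section tempered_distributions.
Variables (R : realType) (d : nat).
Local Notation E := 'rV[R]_d.
Local Notation Z := 'rV[int]_d.
Local Notation mu := (rV_lebesgue R d).
Local Notation C := R[i].
Local Notation cabs := (@Normc.normc R).
Local Notation dist := ((E -> C) -> C).
Variables (g : Z -> E -> R) (a : Z -> E) (b : Z -> R) (Cs : R).
Hypothesis (d_gt0 : (0 < d)%N) (painless : painless_NSGF g a b Cs).
Variable psi : Z -> E -> R.
Hypothesis bapu : BAPU a b Cs psi.
Local Notation cube := (cube a b Cs).
Local Notation omega := (omega a).
Local Notation lpsi n f := (fun x => (psi n x)%:C * f x).
Local Notation locL2 := (locL2 psi).

Lemma inLp2 (h : E -> C) : inLp 2 h <-> L2 h.
Proof.
rewrite /inLp /L2 LpN2E; split=> -[mh h2]; split=> //.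
  by apply: lty_poweRy h2; rewrite invr_eq0.
exact: poweR_lty.
Qed.

Lemma inf_test_zero (z Q : R) : (forall j : nat, z <= Q / (1 + j%:R)) -> z <= 0.
Proof.
move=> H; have [Q0|Q0] := leP Q 0.
  by have := H 0%N; rewrite addr0 divr1 => /le_trans; exact.
rewrite leNgt; apply/negP => z0.
have := H (Num.truncn (Q / z)); rewrite leNgt => /negP; case.
rewrite ltr_pdivrMr ?ltr_pwDl// -ltr_pdivrMl// mulrC [1 + _]addrC natr1.
exact: truncnS_gt.
Qed.

Lemma supp_sum_compact (s : seq Z) : compact (supp (fun x => \sum_(n <- s) psi n x)).
Proof.
elim: s => [|n s IH].
  apply: (compact_supp_sub (k := psi 0)); last exact: (psi_compact bapu).
  by move=> x; rewrite big_nil eqxx.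
apply: (subclosed_compact _ (compactU (psi_compact bapu (n := n)) IH)).
  exact: closed_closure.
rewrite /supp -closureU; apply: closure_subset => x /=.
rewrite big_cons; have [->|nz] := eqVneq (psi n x) 0; last by left.
by rewrite add0r; right.
Qed.

Lemma cutoff : exists chi : E -> R, [/\ smooth chi, compact (supp chi) &
  forall x, enorm x < 1 -> chi x = 1].
Proof.
have [A HA] := cubes_locally_finite d_gt0 painless 1.
exists (fun x => \sum_(n <- A) psi n x); split.
- by apply: smooth_sum => n; exact: (psi_smooth bapu).
- exact: supp_sum_compact.
- by move=> x x1; apply: (psi_sum bapu) => n cn; apply: HA cn _; exact: ltW.
Qed.

Lemma schwartz0 : schwartz (fun _ : E => 0 : C).
Proof.
apply: test_schwartz; apply: (@test_real _ _ (fun=> 0)); first exact: smooth_cst.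
rewrite (_ : supp _ = set0); first exact: compact0.
apply/seteqP; split => // x; rewrite /supp (_ : [set _ | _] = set0) ?closure0//.
by apply/seteqP; split => // y /=; rewrite eqxx.
Qed.

(** Test functions are dense: chi(x/r) phi is a test function, and (1 -
    chi(x/r)) phi tends to 0 in every Schwartz norm as r grows, because its
    first factor vanishes on the ball of radius r. *)
Lemma tempered_test_eq (u v : dist) : tempered u -> tempered v ->
  (forall phi, test_function phi -> u phi = v phi) -> eq_dist u v.
Proof.
move=> [ul [k1 [M1 uM]]] [vl [k2 [M2 vM]]] uv phi sp.
have [chi [schi cchi chi1]] := cutoff.
pose f : E -> R := fun x => 1 + -1 * chi x.
have sf : smooth f by apply: smoothD; [exact: smooth_cst|exact: smoothZ].
have f0 s x : enorm x < 1 -> partials s f x = 0.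
  move=> x1; have : {near x, f =1 cst 0}.
    have : nbhs x [set y : E | enorm y < 1].
      by apply: open_nbhs_nbhs; split => //; exact: open_enorm_lt.
    by apply: filterS => y /= y1; rewrite /f chi1// mulN1r subrr.
  by move/(partials_near s) ->; rewrite partials_cst; case: s.
have fb k : exists2 M, 0 <= M & forall s, (size s <= k)%N -> forall x, `|partials s f x| <= M.
  apply: (@words_bound _ _ (fun s M => forall x, `|partials s f x| <= M)).
    by move=> s M M' H MM' x; exact: le_trans (H x) MM'.
  move=> s; have [M HM] : exists M, forall x, `|partials s chi x| <= M.
    apply: (continuous_compact_bounded _ cchi).
      by move=> x; exact: differentiable_continuous (schi s x).
    by move=> x; exact: partials_off_supp.
  exists (1 + M) => x.
  rewrite /f partialsD//; [|exact: (@smooth_cst _ _ 1)|exact: smoothZ].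
  rewrite (le_trans (ler_normD _ _))// lerD//.
    rewrite -/(cst 1) partials_cst; case: s {HM} => [|? ?] /=; rewrite ?normr1 ?normr0//.
  by rewrite partialsZ// normrM normrN1 mul1r.
(* Dilations by j+1 >= 1 do not increase the bounds for the derivatives. *)
pose fr (j : nat) x := f (j.+1%:R^-1 *: x).
have sfr j : smooth (fr j) by exact: smooth_dil.
have frb j k M : (forall s, (size s <= k)%N -> forall x, `|partials s f x| <= M) ->
    forall s x, (size s <= k)%N -> `|partials s (fr j) x| <= M.
  move=> HM s x sk; rewrite /fr partials_dil// normrM.
  apply: le_trans (HM s sk (j.+1%:R^-1 *: x)); rewrite ler_piMl//.
  by rewrite normrX exprn_ile1// ger0_norm ?invr_ge0// invf_le1// ler1n.
have fr0 j s x : enorm x < j.+1%:R -> partials s (fr j) x = 0.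
  move=> xj; rewrite /fr partials_dil// f0 ?mulr0//.
  by rewrite enormZ ger0_norm ?invr_ge0// mulrC ltr_pdivrMr// mul1r.
have main k M j : (forall s, (size s <= k)%N -> forall x, `|partials s f x| <= M) ->
    (schwartz_norm k (fun x => (fr j x)%:C * phi x)%R <=
     (2 ^+ k * M / (1 + j.+1%:R))%:E * schwartz_norm k.+1 phi)%E.
  move=> HM; apply: schwartz_mul => //.
  - by move=> s x sk; exact: (frb j k M HM).
  - by move=> s x; exact: fr0.
have snfin k : schwartz_norm k phi \is a fin_num.
  by rewrite ge0_fin_numE ?schwartz_norm_ge0//; case: sp.
have sfrp j : schwartz (fun x => (fr j x)%:C * phi x).
  split; first by apply: csmoothM => //; case: sp.
  move=> k; have [M _ HM] := fb k.
  apply: le_lt_trans (main k M j HM) _.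
  by rewrite -(fineK (snfin k.+1)) -EFinM ltry.
have tcp j : test_function (fun x => (chi (j.+1%:R^-1 *: x))%:C * phi x).
  apply: test_mulr; [exact: smooth_dil| |by case: sp].
  have cm : {within supp chi, continuous (fun y : E => j.+1%:R *: y)}.
    by apply: continuous_subspaceT => y; exact: scaler_continuous.
  apply: (subclosed_compact _ (continuous_compact cm cchi)); first exact: closed_closure.
  have j1 : j.+1%:R != 0 :> R by rewrite pnatr_eq0.
  have ci : closed ((fun y : E => j.+1%:R *: y) @` supp chi).
    by apply: compact_closed; [exact: norm_hausdorff|exact: continuous_compact].
  rewrite [X in _ `<=` X](iffLR (closure_id _) ci) /supp; apply: closure_subset => x cx.
  exists (j.+1%:R^-1 *: x); first exact: subset_closure.
  by rewrite scalerA mulfV// scale1r.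
have split_phi j : phi = (fun x => 1 * ((chi (j.+1%:R^-1 *: x))%:C * phi x) + (fr j x)%:C * phi x).
  apply/funext => x; rewrite mul1r -mulrDl -rmorphD /fr /f mulN1r addrC subrK.
  by rewrite rmorph1 mul1r.
have Mabs (w : dist) k M : (forall phi, schwartz phi ->
     ((cabs (w phi))%:E <= M%:E * schwartz_norm k phi)%E) ->
  exists Q, forall j : nat, cabs (w (fun x => (fr j x)%:C * phi x)) <= Q / (1 + j%:R).
  move=> wM; have [B B0 HB] := fb k.
  exists (`|M| * (2 ^+ k * B * fine (schwartz_norm k.+1 phi))) => j.
  have h1 := wM _ (sfrp j); have h2 := main k B j HB.
  rewrite -lee_fin; apply: le_trans h1 _.
  apply: (@le_trans _ _ (`|M|%:E * ((2 ^+ k * B / (1 + j.+1%:R))%:E * schwartz_norm k.+1 phi))%E).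
    apply: (@le_trans _ _ (`|M|%:E * schwartz_norm k (fun x => (fr j x)%:C * phi x)%R)%E).
      by apply: lee_wpmul2r; rewrite ?schwartz_norm_ge0// lee_fin ler_norm.
    by apply: lee_wpmul2l => //; rewrite lee_fin.
  rewrite -(fineK (snfin k.+1)) -!EFinM lee_fin -!mulrA; do 3 (apply: ler_wpM2l; first by rewrite ?exprn_ge0).
  rewrite mulrC ler_wpM2l//.
    by rewrite fine_ge0// schwartz_norm_ge0.
  by rewrite lef_pV2 ?posrE ?ltr_pwDl// lerD2l ler_nat.
have [Q1 HQ1] := Mabs u k1 M1 uM; have [Q2 HQ2] := Mabs v k2 M2 vM.
apply/eqP; rewrite -subr_eq0; apply/eqP; apply: cabs_eq0.
apply/eqP; rewrite eq_le cabs_ge0 andbT.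
apply: (@inf_test_zero _ (Q1 + Q2)) => j.
rewrite (split_phi j) ul ?vl//; [|exact: test_schwartz..].
rewrite uv// opprD addrACA subrr add0r mulrDl (le_trans (cabsD _ _))// cabsN.
exact: lerD (HQ1 j) (HQ2 j).
Qed.

Lemma schwartz_pairing (f : E -> C) (M : R) (r : nat) : locL2 f -> 0 <= M ->
  (forall n, (sqn (lpsi n f) <= (M * omega n ^+ r)%:E)%E) ->
  exists (k : nat) (K : R), forall phi, schwartz phi ->
    cintegrable (fun x => f x * phi x) /\
    ((cabs (dist_of f phi))%:E <= K%:E * schwartz_norm k phi)%E.
Proof.
move=> Lf M0 fM; have [k [K [K0 HK]]] := growth_pairing d_gt0 painless bapu Lf M0 fM.
exists k, K => phi [sp pk].
have sfin : schwartz_norm k phi \is a fin_num by rewrite ge0_fin_numE ?schwartz_norm_ge0.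
have [] := HK phi (fine (schwartz_norm k phi)) (csmooth_cmeasurable sp).
  move=> x; rewrite -lee_fin fineK//.
  apply: le_trans (@schwartz_norm_ub R d k phi [::] x _) => //.
  by rewrite lee_fin (_ : cpartials [::] phi x = phi x)//; exact: ceqP.
move=> h1 h2; split => //.
by rewrite -(fineK sfin) -EFinM lee_fin.
Qed.

Lemma dist_of_linear (f : E -> C) (z : C) (phi psi' : E -> C) :
  cintegrable (fun x => f x * phi x) -> cintegrable (fun x => f x * psi' x) ->
  dist_of f (fun x => z * phi x + psi' x) = z * dist_of f phi + dist_of f psi'.
Proof.
move=> i1 i2; rewrite /dist_of -cintZ// -cintD//; last exact: cintegrableZ.
by apply: eq_cint => x; rewrite mulrDr mulrCA.
Qed.

Lemma tempered_dist_of (f : E -> C) (M : R) (r : nat) : locL2 f -> 0 <= M ->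
  (forall n, (sqn (lpsi n f) <= (M * omega n ^+ r)%:E)%E) ->
  tempered (dist_of f).
Proof.
move=> Lf M0 fM; have [k [K pair]] := schwartz_pairing Lf M0 fM.
split; last by exists k, K => phi /pair[].
by move=> c phi psi' /pair[i1 _] /pair[i2 _]; exact: dist_of_linear.
Qed.

Lemma tempered_sum (u : dist) (phi : E -> C) (s : seq Z) : tempered u -> test_function phi ->
  u (fun x => \sum_(n <- s) (psi n x)%:C * phi x) = \sum_(n <- s) u (lpsi n phi).
Proof.
move=> [ul _] tp.
have u0 : u (fun _ => 0) = 0.
  have := ul 1 _ _ schwartz0 schwartz0; rewrite mul1r.
  rewrite (_ : (fun _ => _) = (fun _ => 0)); last by apply/funext => x; rewrite ?mulr0 ?mul1r addr0.
  by rewrite ?mul1r => /eqP; rewrite -subr_eq0 opprD addrA subrr sub0r oppr_eq0 => /eqP.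
elim: s => [|n s IH].
  by rewrite big_nil -[RHS]u0; congr u; apply/funext => x; rewrite big_nil.
rewrite big_cons -IH -[u (lpsi n phi)]mul1r -ul; last 2 first.
- by apply: test_schwartz; apply: test_mul => //; exact: (psi_smooth bapu).
- apply: test_schwartz; rewrite (_ : (fun _ => _) = (fun x => (\sum_(n <- s) psi n x)%:C * phi x)).
    by apply: test_mul => //; apply: smooth_sum => k; exact: (psi_smooth bapu).
  by apply/funext => x; rewrite rmorph_sum mulr_suml.
by congr u; apply/funext => x; rewrite big_cons mul1r.
Qed.

Lemma schwartz_psi_test n (phi : E -> C) : schwartz phi -> test_function (lpsi n phi).
Proof.
move=> [sp _]; apply: test_mulr => //; [exact: (psi_smooth bapu)|exact: (psi_compact bapu)].
Qed.

(** Let h_n represent psi_n u. Since psi_j psi_n u is represented by psi_j h_n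
    and by psi_n h_j, these agree almost everywhere; so h_n vanishes outside
    of I_n, and the sum of the h_n represents sum_n psi_n u = u. *)
Lemma L2loc_representation (u : dist) : tempered u ->
  (forall n, (dist_LpN 2 (dist_mul (psi n) u) < +oo)%E) ->
  exists f, locL2 f /\ forall phi, test_function phi -> u phi = dist_of f phi.
Proof.
move=> tu uoo.
have /choice[h Hh] : forall n, exists h, L2 h /\ eq_dist (dist_mul (psi n) u) (dist_of h).
  move=> n; have /ereal_inf_lt[_ [h [hp hu] <-] _] := uoo n.
  by exists h; split => //; apply/inLp2.
have Lh n : L2 (h n) by case: (Hh n).
have uh n phi : test_function phi -> u (lpsi n phi) = dist_of (h n) phi.
  by move=> tp; have [_ /(_ _ (test_schwartz tp)) <-] := Hh n.
have Lph j n : L2 (lpsi j (h n)).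
  split; first by apply: (cmeasurable_psi bapu); case: (Lh n).
  apply: le_lt_trans (Lh n).2; apply: le_sqn.
  - by apply: (cmeasurable_psi bapu); case: (Lh n).
  - by case: (Lh n).
  - by move=> x; exact: (cabs_psi_le d_gt0 painless bapu).
have comm j n : {ae mu, forall x, (psi j x)%:C * h n x = (psi n x)%:C * h j x}.
  apply: (locL2_test_eq d_gt0 painless bapu).
  - exact: (L2_locL2 d_gt0 painless bapu).
  - exact: (L2_locL2 d_gt0 painless bapu).
  move=> phi tp.
  have e i k : dist_of (lpsi i (h k)) phi = u (lpsi k (lpsi i phi)).
    rewrite uh; last by apply: test_mul => //; exact: (psi_smooth bapu).
    by apply: eq_cint => x; rewrite mulrCA mulrA.
  rewrite !e; congr u; apply/funext => x; rewrite mulrCA//.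
have hoff : {ae mu, forall x, forall n, ~ cube n x -> h n x = 0}.
  have := ae_forall_countable (fun j => ae_forall_countable (comm j)).
  apply: filterS => x Hx n nc.
  have [j pj] := psi_pos d_gt0 painless bapu x.
  have := Hx j n; rewrite (psi_off bapu nc) mul0r => /eqP.
  by rewrite mulf_eq0 => /orP[|/eqP//]; rewrite (inj_eq (@complexI R)) gt_eqF.
(* Cutting h_n to the cube changes it on a null set only, and makes the sum
   locally finite at every point. *)
pose k n x := (\1_(cube n) x)%:C * h n x.
have mk n : cmeasurable (k n).
  apply: cmeasurableM; last by case: (Lh n).
  by apply: cmeasurable_real; apply: measurable_indic; exact: measurable_cube.
have koff n x : ~ cube n x -> k n x = 0.
  by move=> nc; rewrite /k indicE memNset//= mul0r.
have kh n : {ae mu, forall x, h n x = k n x}.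
  apply: filterS hoff => x Hx; have [cx|nc] := pselect (cube n x).
    by rewrite /k indicE mem_set//= mul1r.
  by rewrite koff// Hx.
have kle n x : cabs (k n x) <= cabs (h n x).
  by rewrite /k cabsM cabs_real ger0_norm// ler_piMl ?cabs_ge0.
pose f := patchwork a b Cs k.
have mf : cmeasurable f by exact: (cmeasurable_patchwork d_gt0 painless).
have Lf : locL2 f.
  split => // n.
  rewrite (_ : (fun x => _) = (fun x => \sum_(j <- nb a b Cs n) (psi n x)%:C * k j x)).
    apply: L2_sum => j; split; first exact: (cmeasurable_psi bapu).
    apply: le_lt_trans (Lh j).2; apply: le_sqn.
    - exact: (cmeasurable_psi bapu).
    - by case: (Lh j).
    - move=> x; apply: le_trans (kle j x); exact: (cabs_psi_le d_gt0 painless bapu).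
  apply/funext => x; rewrite -mulr_sumr; have [cx|nc] := pselect (cube n x).
    congr (_ * _); apply: (patchworkE d_gt0 painless) => [j|j cj]; first exact: koff.
    exact: (cube_nb painless cx cj).
  by rewrite (psi_off bapu nc) !mul0r.
exists f; split=> // phi tp.
have [A HA] := compact_cells d_gt0 painless tp.2.
have -> : u phi = \sum_(n <- A) u (lpsi n phi).
  rewrite -tempered_sum//; congr u; apply/funext => x.
  have h1 : 1 * phi x = \sum_(n <- A) (psi n x)%:C * 1 * phi x :=
    congr1 (fun F => F x) (test_split bapu (fun=> 1) HA).
  by rewrite -[LHS]mul1r h1; apply: eq_bigr => n _; rewrite mulr1.
have mphi : cmeasurable phi by exact: csmooth_cmeasurable tp.1.
have e n : u (lpsi n phi) = cint (fun x => k n x * phi x).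
  rewrite uh//; apply: ae_eq_cint.
  - by apply: cmeasurableM => //; case: (Lh n).
  - exact: cmeasurableM.
  - by apply: filterS (kh n) => x ->.
under eq_bigr do rewrite e.
rewrite -cint_sum; last first.
  move=> n; have Lk : L2 (k n).
    split=> //; apply: le_lt_trans (Lh n).2; apply: le_sqn => //.
    by case: (Lh n).
  by apply: (locL2_test_integrable d_gt0 painless bapu) => //; exact: (L2_locL2 d_gt0 painless bapu).
apply: eq_cint => x; rewrite -mulr_suml.
have [sx|/off_supp ->] := pselect (supp phi x); last by rewrite !mulr0.
congr (_ * _); symmetry; apply: (patchworkE d_gt0 painless) => [n|n cn]; first exact: koff.
exact: HA cn sx.
Qed.

Lemma L2loc_reprP (u : dist) : tempered u ->
  (forall n, (dist_LpN 2 (dist_mul (psi n) u) < +oo)%E) ->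
  locL2 (L2loc_repr u) /\
  forall phi, test_function phi -> u phi = dist_of (L2loc_repr u) phi.
Proof.
move=> tu uoo; have [f [Lf uf]] := L2loc_representation tu uoo.
have /(@xgetPex _ (fun=> 0)) : exists h, inL2loc h /\
    forall phi, test_function phi -> u phi = dist_of h phi.
  by exists f; split=> //; exact: (locL2_inL2loc d_gt0 painless bapu).
by move=> [/(inL2loc_locL2 d_gt0 painless bapu)].
Qed.

Lemma dist_LpN_psi_le (u : dist) (f : E -> C) n : locL2 f ->
  (forall phi, test_function phi -> u phi = dist_of f phi) ->
  (dist_LpN 2 (dist_mul (psi n) u) <= LpN 2 (lpsi n f))%E.
Proof.
move=> Lf uf; apply: ereal_inf_lbound; exists (lpsi n f) => //; split.
  by apply/inLp2; exact: Lf.2.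
move=> phi sp; rewrite /dist_mul uf; last exact: schwartz_psi_test.
by apply: eq_cint => x; rewrite mulrCA mulrA.
Qed.

(** Test functions separate square integrable functions up to null sets, so
    all the functions in the infimum that defines [dist_LpN] have the same
    norm. *)
Lemma dist_LpN_psi (u : dist) (f : E -> C) n : locL2 f ->
  (forall phi, test_function phi -> u phi = dist_of f phi) ->
  dist_LpN 2 (dist_mul (psi n) u) = LpN 2 (lpsi n f).
Proof.
move=> Lf uf; apply/eqP; rewrite eq_le dist_LpN_psi_le//=.
apply: le_ereal_inf_tmp => _ [h [/inLp2 Lh uh] <-].
rewrite !LpN2E; suff -> : sqn (lpsi n f) = sqn h by [].
apply: ae_eq_sqn; [by case: (Lf.2 n)|by case: Lh|].
apply: (locL2_test_eq d_gt0 painless bapu).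
- by apply: (L2_locL2 d_gt0 painless bapu); exact: Lf.2.
- exact: (L2_locL2 d_gt0 painless bapu).
move=> phi tp; rewrite -uh; last exact: test_schwartz.
rewrite /dist_mul uf; last by apply: schwartz_psi_test; exact: test_schwartz.
by apply: eq_cint => x; rewrite -mulrA mulrCA.
Qed.

End tempered_distributions.

(** * The frame bounds control the windows pointwise *)

Section frame_bounds.
Variables (R : realType) (d : nat).
Local Notation E := 'rV[R]_d.
Local Notation Z := 'rV[int]_d.
Local Notation mu := (rV_lebesgue R d).
Local Notation C := R[i].
Local Notation cabs := (@Normc.normc R).
Variables (g : Z -> E -> R) (a : Z -> E) (b : Z -> R) (Cs : R).
Hypothesis (d_gt0 : (0 < d)%N) (painless : painless_NSGF g a b Cs).
Local Notation cube := (cube a b Cs).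
Local Notation omega := (omega a).
Local Notation wbox := (wbox a b).
Local Notation wg n f := (fun x => (g n x)%:C * f x).

Lemma g_continuous n : continuous (g n).
Proof. by have [_ [_ _ _ [H _]]] := painless; exact: H. Qed.

Lemma g_measurable n : measurable_fun setT (g n).
Proof. by apply: continuous_measurable_rV; exact: g_continuous. Qed.

(** The window g_n is continuous and vanishes outside of the closed box, hence
    also on its boundary. *)
Lemma g_off n x : ~ wbox n x -> g n x = 0.
Proof.
move=> nx; apply: contrapT => /eqP gx; apply: nx.
have [[_ _ gsupp _] _] := painless.
have closed_in y : g n y != 0 -> forall i, 0 <= y ord0 i - a n ord0 i <= (b n)^-1.
  move=> gy i; have sy : supp (g n) y by apply: subset_closure.
  exact: gsupp n _ sy i.
have nz : \forall y \near x, g n y != 0.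
  have cg : g n y @[y --> x] --> g n x := @g_continuous n x.
  exact: (cvgr_neq0 _ cg gx).
have /nbhs_rVP[e e0 eU] := nz.
move=> i; have e2 : 0 < e / 2 by rewrite divr_gt0.
pose y (t : R) : E := \row_j (x ord0 j + (j == i)%:R * t).
have gy t : `|t| < e -> 0 <= x ord0 i + t - a n ord0 i <= (b n)^-1.
  move=> te; have := closed_in (y t) _ i; rewrite mxE eqxx mul1r; apply.
  apply: eU => j; rewrite mxE opprD addNKr normrN.
  by case: (j == i); rewrite ?mul1r// mul0r normr0.
have /andP[h1 _] := gy (- (e / 2)) ltac:(by rewrite normrN gtr0_norm//; lra).
have /andP[_ h2] := gy (e / 2) ltac:(by rewrite gtr0_norm//; lra).
by apply/andP; split; lra.
Qed.

Lemma g_off_cube n x : ~ cube n x -> g n x = 0.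
Proof. by move=> nc; apply: g_off => /(wbox_cube painless). Qed.

Lemma compact_obox_closed (c : E) l : compact [set x : E | forall i, c ord0 i <= x ord0 i <= c ord0 i + l].
Proof.
have := @rV_compact _ d (fun i => `[c ord0 i, c ord0 i + l]%classic) (fun i => @segment_compact R _ _).
congr compact; apply/seteqP; split => x h i; have := h i; rewrite /= in_itv//.
Qed.

Lemma g_bounded n : exists M, forall x, `|g n x| <= M.
Proof.
apply: (continuous_compact_bounded (@g_continuous n) (@compact_obox_closed (a n) (b n)^-1)).
move=> x nx; apply: g_off => wx; apply: nx => i; have /andP[h1 h2] := wx i.
by apply/andP; split; lra.
Qed.

Lemma L2_wg n f : L2 f -> L2 (wg n f).
Proof.
move=> [mf f2]; have [M HM] := g_bounded n.
have M0 : 0 <= M by apply: le_trans (HM 0).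
have m1 : cmeasurable (wg n f).
  by apply: cmeasurableM => //; apply: cmeasurable_real; exact: g_measurable.
have [_] := L2Z M%:C (conj mf f2); split=> //; apply: le_lt_trans b0.
apply: le_sqn => //; first by apply: cmeasurableM => //; exact: cmeasurable_cst.
by move=> x; rewrite !cabsM !cabs_real ler_wpM2r ?cabs_ge0// (ger0_norm M0).
Qed.

(** The coefficients of f are the Fourier coefficients of g_n f on the box of
    g_n. *)
Lemma inner_gmod f m n : inner f (gmod g b m n) = inner (wg n f) (ebox (a n) (b n) m).
Proof.
rewrite inner_ebox_off; last by move=> x /g_off ->; rewrite mul0r.
apply: eq_cint => x; rewrite /gmod conjcM cconj_real mulrCA mulrA.
by congr (_ * _).
Qed.

Lemma gmod_parseval f n : L2 (wg n f) ->
  (\esum_(m in [set: Z]) (cabs (inner f (gmod g b m n)) ^+ 2)%:E =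
   ((b n)^-1 ^+ d)%:E * sqn (wg n f))%E.
Proof.
move=> Lf; under eq_esum do rewrite inner_gmod.
apply: parseval => //; first exact: (b_gt0 painless).
by move=> x /g_off ->; rewrite mul0r.
Qed.

Definition Gsum (A : {fset Z}) (x : E) : R := \sum_(n <- A) b n ^- d * `|g n x| ^+ 2.

Lemma Gterm_ge0 n x : 0 <= b n ^- d * `|g n x| ^+ 2.
Proof. by rewrite mulr_ge0 ?sqr_ge0// invr_ge0 exprn_ge0// ltW// (b_gt0 painless). Qed.

Lemma GfunE (A : {fset Z}) x : (forall n, cube n x -> n \in A) -> Gfun g b x = Gsum A x.
Proof.
move=> HA; rewrite /Gfun (@esum_fin_supp _ _ _ A).
- by rewrite sumEFin.
- by move=> n; rewrite lee_fin; exact: Gterm_ge0.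
- move=> n nA; rewrite g_off_cube ?normr0 ?expr0n ?mulr0// => /HA; exact/negP.
Qed.

Lemma Gsum_continuous A : continuous (Gsum A).
Proof.
rewrite /Gsum; elim: (A : seq Z) => [|n s IH] x.
  by under eq_fun do rewrite big_nil; exact: cst_continuous.
under eq_fun do rewrite big_cons.
apply: (@continuousD _ _ _ (fun x => b n ^- d * `|g n x| ^+ 2) (fun x => \sum_(j <- s) b j ^- d * `|g j x| ^+ 2)); last exact: IH.
apply: (@continuousM _ _ (fun=> b n ^- d) (fun x => `|g n x| ^+ 2)); first exact: cst_continuous.
apply: (@continuous_comp _ _ _ (fun x => `|g n x|) (fun y : R => y ^+ 2)).
  have cg : g n y @[y --> x] --> g n x := @g_continuous n x.
  exact: cvg_norm cg.
exact: exprn_continuous.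
Qed.

Lemma LpN2_sq (f : E -> C) : L2 f -> (LpN 2 f ^+ 2 = sqn f)%E.
Proof.
move=> [_ f2]; have f0 := sqn_ge0 f; rewrite LpN2E.
have ffin : sqn f \is a fin_num by rewrite ge0_fin_numE.
rewrite -(fineK ffin) poweR_EFin expe2 -EFinM powR12_sqrt ?fine_ge0//.
by rewrite -expr2 sqr_sqrtr// fine_ge0.
Qed.

Lemma frame_local (f : E -> C) (A : {fset Z}) : L2 f ->
  (forall n x, cube n x -> f x != 0 -> n \in A) ->
  (\esum_(k in [set: Z * Z]) (cabs (inner f (gmod g b k.1 k.2)) ^+ 2)%:E =
   \sum_(n <- A) ((b n)^-1 ^+ d)%:E * sqn (wg n f))%E.
Proof.
move=> Lf HA.
pose F m n := (cabs (inner f (gmod g b m n)) ^+ 2)%:E.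
have F0 m n : (0 <= F m n)%E by rewrite lee_fin sqr_ge0.
transitivity (\esum_(m in [set: Z]) \esum_(n in [set: Z]) F m n)%E.
  rewrite esum_esum; last by move=> *; exact: F0.
  by congr esum; apply/seteqP; split.
under eq_esum => m _.
  rewrite (@esum_fin_supp _ _ _ A)//; last first.
    move=> n nA; rewrite /F inner_gmod (_ : wg n f = (fun=> 0)).
      rewrite (_ : inner _ _ = 0) ?cabs0 ?expr0n//.
      by rewrite /inner; under eq_fun do rewrite mul0r; rewrite cint0.
    apply/funext => x; have [cx|/g_off_cube ->] := pselect (cube n x); last by rewrite mul0r.
    suff -> : f x = 0 by rewrite mulr0.
    by apply/eqP; apply: contraNT nA => fx; exact: HA cx fx.
  over.
rewrite esum_sum//; apply: eq_bigr => n _.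
by rewrite gmod_parseval//; exact: L2_wg.
Qed.

Lemma Gsum_integral (U : set E) (A : {fset Z}) : measurable U ->
  (\sum_(n <- A) ((b n)^-1 ^+ d)%:E * sqn (wg n (fun x => (\1_U x)%:C))%R =
   \int[mu]_x ((\1_U x * Gsum A x)%:E))%E.
Proof.
move=> mU; under eq_integral => x _ do rewrite /Gsum mulr_sumr -sumEFin.
have mt n : measurable_fun setT (fun x => (cabs ((g n x)%:C * (\1_U x)%:C) ^+ 2)%:E).
  apply: emeasurable_cabs2; apply: cmeasurableM; apply: cmeasurable_real; first exact: g_measurable.
  exact: measurable_indic.
have e n x : (\1_U x * (b n ^- d * `|g n x| ^+ 2))%:E =
    (((b n)^-1 ^+ d)%:E * (cabs ((g n x)%:C * (\1_U x)%:C) ^+ 2)%:E)%E.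
  rewrite -EFinM; congr EFin; rewrite cabsM !cabs_real exprMn exprVn mulrCA; congr (_ * _).
  by rewrite mulrC indicE; case: (_ \in _); rewrite ?normr1 ?normr0 ?expr1n ?expr0n.
under eq_integral do under eq_bigr do rewrite e.
rewrite ge0_integral_sum//; last 2 first.
- by move=> n; apply: measurable_funeM; exact: mt.
- move=> n x _; rewrite mule_ge0 ?lee_fin ?sqr_ge0// exprn_ge0// ltW//.
  exact: (bV_gt0 painless).
apply: eq_bigr => n _; rewrite ge0_integralZl_EFin//.
- by move=> x _; rewrite lee_fin sqr_ge0.
- by rewrite exprn_ge0// ltW// (bV_gt0 painless).
Qed.

Lemma nbhs_box (x : E) (U : set E) : nbhs x U -> exists (c : E) (e : R),
  0 < e /\ obox c e^-1 `<=` U.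
Proof.
move=> /nbhs_rVP[e e0 eU].
exists (\row_i (x ord0 i - e / 2)), e^-1; split; first by rewrite invr_gt0.
move=> y hy; apply: eU => i.
by have := hy i; rewrite mxE invrK => /andP[h1 h2]; rewrite ltr_norml; apply/andP; split; lra.
Qed.

Lemma locally_finite_near (x : E) : exists A : {fset Z},
  \forall y \near x, forall n, cube n y -> n \in A.
Proof.
have [A HA] := cubes_locally_finite d_gt0 painless (enorm x + 1).
exists A; have : nbhs x [set y : E | enorm y < enorm x + 1].
  by apply: open_nbhs_nbhs; split; [exact: open_enorm_lt|rewrite /= ltrDl].
by apply: filterS => y /= yx n cn; apply: HA cn _; exact: ltW.
Qed.

(** For the indicator of a small box U the frame sum is the integral of G over
    U, by Parseval's identity on each window. *)
Lemma frame_box (c : E) (e : R) (A : {fset Z}) : 0 < e ->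
  (forall n y, obox c e^-1 y -> cube n y -> n \in A) ->
  let U := obox c e^-1 in
  [/\ L2 (fun x => (\1_U x)%:C), sqn (fun x => (\1_U x)%:C) = mu U,
    (0 < mu U < +oo)%E &
   (\esum_(k in [set: Z * Z]) (cabs (inner (fun x => (\1_U x)%:C) (gmod g b k.1 k.2)) ^+ 2)%:E =
   \int[mu]_x ((\1_U x * Gsum A x)%:E))%E].
Proof.
move=> e0 HA U; have mU : measurable U by exact: measurable_obox.
have sU : sqn (fun x => (\1_U x)%:C) = mu U.
  rewrite /sqn; transitivity (\int[mu]_x (\1_U x)%:E)%E.
    apply: eq_integral => x _; rewrite cabs_real indicE.
    by case: (_ \in _); rewrite ?normr1 ?normr0 ?expr1n ?expr0n.
  by rewrite integral_indic ?setIT.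
have V0 : 0 < e^-1 ^+ d by rewrite exprn_gt0// invr_gt0.
have LU : L2 (fun x => (\1_U x)%:C).
  split; last by rewrite sU obox_measure// ltry.
  by apply: cmeasurable_real; exact: measurable_indic.
split => //; first by rewrite obox_measure// lte_fin V0 ltry.
rewrite (frame_local (A := A))// ?Gsum_integral// => n x cn.
have [Ux _|nU] := pselect (U x); first exact: HA Ux cn.
by rewrite indicE memNset//= eqxx.
Qed.

(** If G were below A at a point then, by continuity, it would be below some
    A_1 < A on a small box, against the lower frame inequality for the
    indicator of that box; similarly for the upper bound. *)
Lemma frame_window : exists A B : R, 0 < A /\ forall x, A <= Gfun g b x <= B.
Proof.
have [[_ _ _ [A0 [B0 [A0gt0 frame]]]] _] := painless.
exists A0, B0; split => // x.
have [F HF] := locally_finite_near x.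
have GF : Gfun g b x = Gsum F x by apply: GfunE; exact: (nbhs_singleton HF).
have cG := @Gsum_continuous F x.
have mterm (U : set E) : measurable U -> measurable_fun setT (fun x => (\1_U x * Gsum F x)%:E).
  move=> mU; apply/measurable_EFinP; apply: measurable_funM; first exact: measurable_indic.
  by apply: continuous_measurable_rV; exact: Gsum_continuous.
have G0 y : 0 <= Gsum F y by apply: sumr_ge0 => n _; exact: Gterm_ge0.
apply/andP; split; rewrite leNgt GF; apply/negP => Gx.
  pose A1 := (Gsum F x + A0) / 2.
  have GA1 : Gsum F x < A1 by rewrite /A1; lra.
  have A1A0 : A1 < A0 by rewrite /A1; lra.
  have nG : \forall y \near x, Gsum F y < A1 by apply: cvgr_lt cG _ GA1.
  have [c [e [e0 eU]]] := nbhs_box (filterI HF nG).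
  have HA n y : obox c e^-1 y -> cube n y -> n \in F by move=> /eU[h _]; exact: h.
  have [LU sU /andP[mU0 mUoo] eU'] := frame_box e0 HA.
  set U := obox c e^-1 in LU sU mU0 mUoo eU'.
  have mU : measurable U by exact: measurable_obox.
  have /frame/andP[+ _] : inLp 2 (fun x => (\1_U x)%:C) by apply/inLp2.
  rewrite LpN2_sq// sU eU' => h.
  have : (\int[mu]_x (\1_U x * Gsum F x)%:E <= A1%:E * mu U)%E.
    rewrite (_ : mu U = \int[mu]_x (\1_U x)%:E)%E; last by rewrite integral_indic ?setIT.
    rewrite -ge0_integralZl_EFin//; last 2 first.
    - by apply/measurable_EFinP; exact: measurable_indic.
    - by apply: ltW; apply: le_lt_trans GA1.
    apply: ge0_le_integral => //.
    - by move=> y _; rewrite lee_fin mulr_ge0.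
    - exact: mterm.
    - by apply: measurable_funeM; apply/measurable_EFinP; exact: measurable_indic.
    move=> y _; rewrite -EFinM lee_fin mulrC indicE.
    have [Uy|nU] := pselect (U y); last by rewrite memNset// !mulr0.
    by rewrite mem_set// !mulr1; apply: ltW; have [] := eU _ Uy.
  move=> /(le_trans h); rewrite leNgt => /negP; apply.
  by rewrite lte_pmul2r// ge0_fin_numE// ltW.
pose B1 := (Gsum F x + B0) / 2.
have GB1 : B1 < Gsum F x by rewrite /B1; lra.
have B0B1 : B0 < B1 by rewrite /B1; lra.
have nG : \forall y \near x, B1 < Gsum F y by apply: cvgr_gt cG _ GB1.
have [c [e [e0 eU]]] := nbhs_box (filterI HF nG).
have HA n y : obox c e^-1 y -> cube n y -> n \in F by move=> /eU[h _]; exact: h.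
have [LU sU /andP[mU0 mUoo] eU'] := frame_box e0 HA.
set U := obox c e^-1 in LU sU mU0 mUoo eU'.
have mU : measurable U by exact: measurable_obox.
have /frame/andP[_] : inLp 2 (fun x => (\1_U x)%:C) by apply/inLp2.
rewrite LpN2_sq// sU eU' => h.
have Ufin : mu U \is a fin_num by rewrite ge0_fin_numE// ltW.
have B1U : (B1%:E * mu U <= \int[mu]_x (\1_U x * Gsum F x)%:E)%E.
  have [B1n|B1p] := leP B1 0.
    apply: (@le_trans _ _ 0%E); first by rewrite mule_le0_ge0// ltW.
    by apply: integral_ge0 => y _; rewrite lee_fin mulr_ge0.
  rewrite (_ : mu U = \int[mu]_x (\1_U x)%:E)%E; last by rewrite integral_indic ?setIT.
    rewrite -ge0_integralZl_EFin//; last 2 first.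
  - by apply/measurable_EFinP; exact: measurable_indic.
  - exact: ltW.
  apply: ge0_le_integral => //.
  - by move=> y _; rewrite -EFinM lee_fin mulr_ge0// ltW.
  - by apply: measurable_funeM; apply/measurable_EFinP; exact: measurable_indic.
  - exact: mterm.
  move=> y _; rewrite -EFinM lee_fin mulrC indicE.
  have [Uy|nU] := pselect (U y); last by rewrite memNset// !mul0r.
  by rewrite mem_set// !mul1r; apply: ltW; have [] := eU _ Uy.
have := le_trans B1U h; rewrite leNgt => /negP; apply.
by rewrite lte_pmul2r.
Qed.

(** The sum G dominates each of its terms. *)
Lemma g_sq_le (B : R) : (forall x, Gfun g b x <= B) -> forall n x, `|g n x| ^+ 2 <= B * b n ^+ d.
Proof.
move=> HB n x; rewrite -ler_pdivrMr ?exprn_gt0 ?(b_gt0 painless)// mulrC.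
have [cx|nc] := pselect (cube n x).
  apply: le_trans (HB x); rewrite (@GfunE (cells a b Cs x)); last first.
    by move=> k ck; apply/(cellsP d_gt0 painless).
  rewrite /Gsum (big_fsetD1 n)/=; last exact/(cellsP d_gt0 painless).
  by rewrite lerDl; apply: sumr_ge0 => k _; exact: Gterm_ge0.
rewrite g_off_cube// normr0 expr0n mulr0; apply: le_trans (HB x).
rewrite (@GfunE (cells a b Cs x)); last first.
  by move=> k ck; apply/(cellsP d_gt0 painless).
by apply: sumr_ge0 => k _; exact: Gterm_ge0.
Qed.

Lemma Gfun_measurable : measurable_fun setT (Gfun g b).
Proof.
have -> : Gfun g b = fun x => complex.Re (patchwork a b Cs (fun n y => (b n ^- d * `|g n y| ^+ 2)%:C) x).
  apply/funext => x; rewrite (@GfunE (cells a b Cs x)); last first.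
    by move=> k ck; apply/(cellsP d_gt0 painless).
  by rewrite /patchwork -rmorph_sum.
apply: (@proj1 _ _ (cmeasurable_patchwork d_gt0 painless (k := fun n y => (b n ^- d * `|g n y| ^+ 2)%:C) _ _)).
- move=> n; apply: cmeasurable_real; apply: measurable_funM => //.
  by apply: measurable_funX; apply: measurableT_comp => //; exact: g_measurable.
- by move=> n x nc; rewrite g_off_cube// normr0 expr0n mulr0.
Qed.

End frame_bounds.

(** * Weighted l^q sums *)

Section weighted_lq.
Variables (R : realType) (I : choiceType).
Implicit Types (W : I -> R) (X Y : I -> \bar R) (A : {fset I}).

Lemma poweR_addD (r : R) (x y : \bar R) : 0 <= r -> (0 <= x)%E -> (0 <= y)%E ->
  ((x + y) `^ r <= (2 `^ r)%:E * (x `^ r + y `^ r))%E.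
Proof.
move=> r0; wlog xy : x y / (x <= y)%E.
  move=> H x0 y0; have [/H|/ltW /H] := leP x y; first exact.
  by rewrite addeC [X in (_ * X)%E]addeC; exact.
move=> x0 y0; apply: (@le_trans _ _ ((2%:E * y) `^ r)%E).
  apply: le_poweR => //; first exact: adde_ge0.
  by rewrite mule_natl mule2n leeD2r.
rewrite poweRM// poweR_EFin; apply: lee_wpmul2l; first by rewrite lee_fin powR_ge0.
by rewrite leeDr// poweR_ge0.
Qed.

Lemma poweR_sum_le (r : R) (s : seq I) (Y : I -> \bar R) : 0 < r -> (forall i, 0 <= Y i)%E ->
  ((\sum_(j <- s) Y j) `^ r <= ((2 `^ r) ^+ size s)%:E * \sum_(j <- s) Y j `^ r)%E.
Proof.
move=> r0 Y0; have t1 : 1 <= 2 `^ r :> R.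
  by have := ler_powR (ler1n R 2) (ltW r0); rewrite powRr0.
elim: s => [|j s IH]; first by rewrite !big_nil poweR0r ?gt_eqF// mule0.
rewrite !big_cons; apply: le_trans (poweR_addD (ltW r0) (Y0 j) _) _.
  exact: sume_ge0.
have p0 : (0 <= Y j `^ r)%E by exact: poweR_ge0.
have S0 : (0 <= \sum_(j <- s) Y j `^ r)%E by apply: sume_ge0 => i _; exact: poweR_ge0.
rewrite /= exprS EFinM -muleA; apply: lee_wpmul2l; first by rewrite lee_fin powR_ge0.
rewrite ge0_muleDr//; apply: leeD => //.
by rewrite lee_pemull// lee_fin exprn_ege1.
Qed.

(** For X_n the square of the norm of the n-th block and r = q / 2, this is
    the q-th power of a weighted l^q norm of the blocks. *)
Definition lqw W (r : R) X : \bar R := (\esum_(n in [set: I]) ((W n)%:E * X n `^ r))%E.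

Lemma lqw_term_ge0 W r X n : (forall n, 0 < W n) -> (0 <= (W n)%:E * X n `^ r)%E.
Proof. by move=> W0; rewrite mule_ge0 ?poweR_ge0// lee_fin ltW. Qed.

Lemma lqw_ge0 W r X : (forall n, 0 < W n) -> (0 <= lqw W r X)%E.
Proof. by move=> W0; apply: esum_ge0 => n _; exact: lqw_term_ge0. Qed.

Lemma lqw_term W r X n (L : R) : (forall n, 0 < W n) -> 0 < r -> (0 <= X n)%E ->
  (lqw W r X <= L%:E)%E -> (X n <= ((L / W n) `^ r^-1)%:E)%E.
Proof.
move=> W0 r0 X0 XL.
have h := le_trans (esum_ge1 n (fun i => lqw_term_ge0 r X i W0)) XL.
have : (X n `^ r <= (L / W n)%:E)%E.
  rewrite -(@lee_pmul2l _ (W n)%:E)//; last by rewrite lte_fin.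
  by rewrite -EFinM mulrC divfK ?gt_eqF.
move/(@le_poweR _ r^-1 _ _ _ (poweR_ge0 _ _)); rewrite -poweRrM divff ?gt_eqF//.
by rewrite poweRe1// poweR_EFin; apply; rewrite invr_ge0 ltW.
Qed.

Lemma lqw_fineK W r X : (forall n, 0 < W n) -> (lqw W r X < +oo)%E ->
  lqw W r X = (fine (lqw W r X))%:E.
Proof. by move=> W0 Xoo; rewrite fineK// ge0_fin_numE// lqw_ge0. Qed.

Lemma lqw_term_lty W r X n : (forall n, 0 < W n) -> 0 < r -> (0 <= X n)%E ->
  (lqw W r X < +oo)%E -> (X n < +oo)%E.
Proof.
move=> W0 r0 X0 Xoo; apply: le_lt_trans (ltry _); apply: (lqw_term (r := r) W0 r0 X0).
by rewrite (lqw_fineK W0 Xoo).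
Qed.

Lemma le_lqw W r X Y : (forall n, 0 < W n) -> 0 <= r -> (forall n, 0 <= X n <= Y n)%E ->
  (lqw W r X <= lqw W r Y)%E.
Proof.
move=> W0 r0 XY; apply: le_esum => n _; apply: lee_wpmul2l; first by rewrite lee_fin ltW.
by have /andP[X0 ?] := XY n; exact: le_poweR.
Qed.

Lemma lqwD W r X Y : (forall n, 0 < W n) -> 0 < r -> (forall n, 0 <= X n)%E ->
  (forall n, 0 <= Y n)%E -> (lqw W r X < +oo)%E -> (lqw W r Y < +oo)%E ->
  (lqw W r (fun n => X n + Y n) < +oo)%E.
Proof.
move=> W0 r0 X0 Y0 Xoo Yoo.
have := @esumZ_le _ _ (fun n => (W n)%:E * X n `^ r + (W n)%:E * Y n `^ r)%E (2 `^ r) (powR_ge0 _ _).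
rewrite esumD => [H||]; [|by move=> n _; exact: lqw_term_ge0..].
have {}H := H (fun n => adde_ge0 (lqw_term_ge0 r X n W0) (lqw_term_ge0 r Y n W0)).
apply: (@le_lt_trans _ _ ((2 `^ r)%:E * (lqw W r X + lqw W r Y))%E).
  apply: le_trans H; apply: le_esum => n _.
  rewrite -ge0_muleDr ?poweR_ge0// muleCA; apply: lee_wpmul2l; first by rewrite lee_fin ltW.
  by apply: poweR_addD => //; exact: ltW.
rewrite lte_mul_pinfty ?lee_fin ?powR_ge0// ?lte_add_pinfty//.
Qed.

Lemma lqwZ W r X (k : R) : (forall n, 0 < W n) -> 0 <= k -> (forall n, 0 <= X n)%E ->
  (lqw W r (fun n => k%:E * X n) <= (k `^ r)%:E * lqw W r X)%E.
Proof.
move=> W0 k0 X0; apply: le_trans (esumZ_le _ _); last 2 first.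
- exact: powR_ge0.
- by move=> n; exact: lqw_term_ge0.
by apply: le_esum => n _; rewrite poweRM ?lee_fin// poweR_EFin muleCA.
Qed.

Variables (nb : I -> {fset I}) (n0 : nat).
Hypotheses (nb_sym : forall n n', (n' \in nb n) = (n \in nb n'))
  (card_nb : forall n, (#|` nb n| <= n0)%N).

(** By symmetry, X_j occurs once for each neighbour of j. *)
Lemma esum_nb_le X : (forall n, 0 <= X n)%E ->
  (\esum_(n in [set: I]) \sum_(j <- nb n) X j <= n0%:R%:E * \esum_(n in [set: I]) X n)%E.
Proof.
move=> X0; apply: esum_le_fset => A.
pose B := seq_fset tt (flatten [seq (nb n : seq I) | n <- A]).
have inB n j : n \in A -> j \in nb n -> j \in B.
  move=> nA jn; rewrite seq_fsetE; apply/flattenP; exists (nb n : seq I) => //.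
  by apply/mapP; exists n.
have -> : (\sum_(n <- A) \sum_(j <- nb n) X j = \sum_(n <- A) \sum_(j <- B | j \in nb n) X j)%E.
  rewrite [LHS]big_seq [RHS]big_seq; apply: eq_bigr => n nA; rewrite -[RHS]big_filter; apply: perm_big.
  apply: uniq_perm; [exact: fset_uniq|by rewrite filter_uniq|].
  by move=> j; rewrite mem_filter; case: (boolP (j \in nb n)) => // jn; rewrite (inB n).
rewrite (exchange_big_dep predT)//=.
apply: (@le_trans _ _ (\sum_(j <- B) n0%:R%:E * X j)%E).
  apply: lee_sum => j _; rewrite big_const_seq iter_addr_0.
  rewrite (_ : (X j *+ count _ _)%R = ((count (fun i => j \in nb i) A)%:R%:E * X j)%E); last by rewrite mule_natl.
   apply: lee_wpmul2r => //; rewrite lee_fin ler_nat.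
  apply: leq_trans (card_nb j); rewrite -size_filter.
  apply: (@uniq_leq_size _ _ (nb j : seq I)); first by rewrite filter_uniq.
  by move=> i; rewrite mem_filter nb_sym => /andP[].
rewrite -ge0_sume_distrr//; apply: lee_wpmul2l; first by rewrite lee_fin.
exact: esum_ge_fset.
Qed.

(** A discrete Schur test: the weights of neighbours are comparable, and an
    index has boundedly many neighbours. *)
Lemma lqw_schur W r L k : (forall n, 0 < W n) -> 0 < r -> 0 <= k -> 0 <= L ->
  (forall n j, j \in nb n -> W n <= L * W j) ->
  exists K : R, 0 <= K /\ forall X Y, (forall n, 0 <= X n)%E -> (forall n, 0 <= Y n)%E ->
    (forall n, X n <= k%:E * \sum_(j <- nb n) Y j)%E ->
    (lqw W r X <= K%:E * lqw W r Y)%E.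
Proof.
move=> W0 r0 k0 L0 WL; have t1 : 1 <= 2 `^ r :> R.
  by have := ler_powR (ler1n R 2) (ltW r0); rewrite powRr0.
pose K1 := k `^ r * ((2 `^ r) ^+ n0 * L).
have K10 : 0 <= K1 by rewrite !mulr_ge0 ?exprn_ge0 ?powR_ge0.
exists (K1 * n0%:R); split; first by rewrite mulr_ge0.
move=> X Y X0 Y0 XY; set Z := fun n => ((W n)%:E * Y n `^ r)%E.
have Z0 n : (0 <= Z n)%E by exact: lqw_term_ge0.
have S0 n : (0 <= \sum_(j <- nb n) Z j)%E by exact: sume_ge0.
apply: (@le_trans _ _ (\esum_(n in [set: I]) (K1%:E * \sum_(j <- nb n) Z j))%E).
  apply: le_esum => n _.
  apply: (@le_trans _ _ ((W n)%:E * ((k `^ r)%:E * ((2 `^ r) ^+ n0)%:E * \sum_(j <- nb n) Y j `^ r))%E).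
    apply: lee_wpmul2l; first by rewrite lee_fin ltW.
    apply: le_trans (le_poweR (ltW r0) (X0 n) (XY n)) _.
    rewrite poweRM ?lee_fin ?sume_ge0// poweR_EFin -muleA; apply: lee_wpmul2l.
      by rewrite lee_fin powR_ge0.
    apply: le_trans (poweR_sum_le _ r0 Y0) _; apply: lee_wpmul2r.
      by apply: sume_ge0 => j _; exact: poweR_ge0.
    by rewrite lee_fin ler_weXn2l// card_nb.
  rewrite muleCA -EFinM /K1 mulrA [in X in (_ <= X)%E]EFinM -muleA; apply: lee_wpmul2l.
    by rewrite lee_fin mulr_ge0 ?powR_ge0// exprn_ge0// powR_ge0.
  rewrite !ge0_sume_distrr//; last by move=> j _; exact: poweR_ge0.
  rewrite big_seq [X in (_ <= X)%E]big_seq; apply: lee_sum => j jn.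
  rewrite /Z muleA -EFinM; apply: lee_wpmul2r; first exact: poweR_ge0.
  by rewrite lee_fin WL.
apply: le_trans (esumZ_le K10 S0) _; rewrite (EFinM K1) -muleA; apply: lee_wpmul2l => //.
exact: esum_nb_le.
Qed.

End weighted_lq.

Section lq_tail.
Variables (R : realType) (M I : choiceType) (W : I -> R) (r : R) (y : M -> I -> \bar R).
Hypotheses (W0 : forall n, 0 < W n) (r0 : 0 < r) (y0 : forall m n, (0 <= y m n)%E).

(** Outside of a finite set N of blocks the sum is small; in each of the
    remaining finitely many blocks, all but finitely many entries contribute
    little. *)
Lemma lqw_tail (e : R) : (lqw W r (fun n => \esum_(m in [set: M]) y m n)%E < +oo)%E ->
  0 < e -> exists F0 : {fset M * I}, forall F : {fset M * I}, (F0 `<=` F)%fset ->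
    (lqw W r (fun n => \esum_(m in [set: M]) if (m, n) \in F then 0 else y m n)%E <= e%:E)%E.
Proof.
move=> yoo e0; pose X n := (\esum_(m in [set: M]) y m n)%E.
have X0 n : (0 <= X n)%E by exact: esum_ge0.
have e20 : 0 < e / 2 by rewrite divr_gt0.
have [N HN] := esum_tail (fun n => lqw_term_ge0 r X n W0) yoo e20.
have Xoo n : (X n < +oo)%E by exact: lqw_term_lty W0 r0 (X0 n) yoo.
pose delta := e / 2 / (#|` N|%:R + 1).
have d0 : 0 < delta by rewrite divr_gt0// ltr_wpDl.
(* A block n with X_n <= en n contributes at most delta, and N has fewer than
   (e / 2) / delta elements. *)
pose en n := (delta / W n) `^ r^-1.
have en0 n : 0 < en n by rewrite powR_gt0// divr_gt0.
have /choice[T HT] := fun n => esum_tail (y0 ^~ n) (Xoo n) (en0 n).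
pose F0 := seq_fset tt (flatten [seq [seq (m, n) | m <- (T n : seq M)] | n <- (N : seq I)]).
exists F0 => F F0F; pose y' m n := if (m, n) \in F then 0%E else y m n.
have y'0 m n : (0 <= y' m n)%E by rewrite /y'; case: ifP.
pose X' n := (\esum_(m in [set: M]) y' m n)%E.
have X'0 n : (0 <= X' n)%E by exact: esum_ge0.
have X'X n : (X' n <= X n)%E by apply: le_esum => m _; rewrite /y'; case: ifP.
have X'e n : n \in N -> (X' n <= (en n)%:E)%E.
  move=> nN; apply: esum_le_fset => A.
  have -> : (\sum_(m <- A) y' m n = \sum_(m <- [fset m in A | (m, n) \notin F]%fset) y m n)%E.
    rewrite big_fset/= [LHS](bigID (fun m => (m, n) \in F))/= [X in (X + _)%E]big1 ?add0e.
      by apply: eq_bigr => m; rewrite /y' => /negbTE ->.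
    by move=> m; rewrite /y' => ->.
  apply: HT => m; rewrite !inE/= => /andP[_]; apply: contraNN => mT.
  apply: (fsubsetP F0F); rewrite seq_fsetE; apply/flattenP.
  exists [seq (m, n) | m <- (T n : seq M)]; first by apply/mapP; exists n.
  by apply/mapP; exists m.
pose h n := if n \in N then delta%:E else 0%E.
have h0 n : (0 <= h n)%E by rewrite /h; case: ifP => // _; rewrite lee_fin ltW.
have hE : (\esum_(n in [set: I]) h n <= (e / 2)%:E)%E.
  rewrite (@esum_fin_supp _ _ _ N)//; last by move=> n /negbTE; rewrite /h => ->.
  rewrite big_seq (eq_bigr (fun=> delta%:E)); last by move=> n; rewrite /h => ->.
  rewrite -big_seq sumEFin lee_fin big_const_seq iter_addr_0 count_predT -[leLHS]mulr_natr /delta.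
  rewrite -(mulrA (e / 2)) ler_piMr ?(ltW e20)// mulrC ler_pdivrMr ?ltr_wpDl//.
  by rewrite mul1r lerDl.
apply: esum_le_fset => A; rewrite [e in X in (_ <= X)%E]splitr EFinD.
apply: (@le_trans _ _ (\sum_(n <- A) (h n + if n \in N then 0 else (W n)%:E * X n `^ r))%E).
  apply: lee_sum => n _; rewrite /h; case: ifPn => nN; last first.
    rewrite add0e; apply: lee_wpmul2l; first by rewrite lee_fin ltW.
    by apply: le_poweR (ltW r0) (X'0 n) (X'X n).
  rewrite adde0; apply: le_trans (_ : (W n)%:E * ((en n)%:E `^ r) <= _)%E.
    apply: lee_wpmul2l; first by rewrite lee_fin ltW.
    by apply: le_poweR (ltW r0) (X'0 n) (X'e n nN).
  rewrite poweR_EFin -EFinM lee_fin /en -powRrM mulVf ?gt_eqF// powRr1; last first.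
    by rewrite ltW// divr_gt0.
  by rewrite mulrC divfK// gt_eqF.
rewrite big_split; apply: leeD; first exact: le_trans (esum_ge_fset A h0) hE.
rewrite (bigID (mem N))/= big1 ?add0e; last by move=> n ->.
rewrite (eq_bigr (fun n => (W n)%:E * X n `^ r)%E); last by move=> n /negbTE ->.
have := HN [fset n in A | n \notin N]%fset; rewrite big_fset/=; apply => n.
by rewrite !inE/= => /andP[].
Qed.

End lq_tail.

(** * Synthesis *)

Section synthesis.
Variables (R : realType) (d : nat).
Local Notation E := 'rV[R]_d.
Local Notation Z := 'rV[int]_d.
Local Notation mu := (rV_lebesgue R d).
Local Notation C := R[i].
Local Notation cabs := (@Normc.normc R).
Variables (g : Z -> E -> R) (a : Z -> E) (b : Z -> R) (Cs : R).
Hypothesis (d_gt0 : (0 < d)%N) (painless : painless_NSGF g a b Cs).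
Variable psi : Z -> E -> R.
Hypothesis bapu : BAPU a b Cs psi.
Local Notation cube := (cube a b Cs).
Local Notation wbox := (wbox a b).
Local Notation G := (Gfun g b).
Local Notation wg n f := (fun x => (g n x)%:C * f x).
Local Notation lpsi n f := (fun x => (psi n x)%:C * f x).
Local Notation nb := (nb a b Cs).
Local Notation gd n H := (fun x => (g n x / G x)%:C * H x).

(** The squared l^2 norm of the n-th block of coefficients. *)
Definition sqc (c : Z -> Z -> C) (n : Z) : \bar R :=
  (\esum_(m in [set: Z]) (cabs (c m n) ^+ 2)%:E)%E.

(** The function f is the sum of the series with coefficients c, computed
    window by window: H_n stands for the sum over m of c_(m,n) e_(m,n) on the
    box of g_n, which is characterized by its Fourier coefficients. It is a
    relation because H_n is determined up to null sets only. *)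
Definition synth (c : Z -> Z -> C) (f : E -> C) := exists H : Z -> E -> C,
  [/\ forall n, L2 (H n), forall n x, ~ wbox n x -> H n x = 0,
      forall n m, inner (H n) (ebox (a n) (b n) m) = c m n * ((b n)^-1 ^+ d)%:C &
      forall x, f x = patchwork a b Cs (fun n => gd n (H n)) x].

Lemma sqc_ge0 c n : (0 <= sqc c n)%E.
Proof. by apply: esum_ge0 => m _; rewrite lee_fin sqr_ge0. Qed.

Lemma synth_exists c : (forall n, sqc c n < +oo)%E -> exists f, synth c f.
Proof.
move=> coo.
have /choice[H HH] := fun n => riesz_fischer (a n) (b_gt0 painless n) (coo n).
exists (patchwork a b Cs (fun n => gd n (H n))); exists H; split => //.
- by move=> n; have [] := HH n.
- by move=> n x; have [_ h _ _] := HH n; exact: h.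
- by move=> n m; have [_ _ _] := HH n.
Qed.

Lemma synth0 : synth (fun _ _ => 0) (fun=> 0).
Proof.
exists (fun _ _ => 0); split => //.
- by move=> n; exact: L2_0.
- by move=> n m; rewrite mul0r /inner; under eq_fun do rewrite mul0r; rewrite cint0.
- by move=> x; rewrite /patchwork big1// => n _; rewrite mulr0.
Qed.

Lemma synth_linear z c c' f f' : synth c f -> synth c' f' ->
  synth (fun m n => z * c m n + c' m n) (fun x => z * f x + f' x).
Proof.
move=> [H [LH H0 Hc Hf]] [H' [LH' H0' Hc' Hf']].
exists (fun n x => z * H n x + H' n x); split.
- by move=> n; apply: L2D => //; exact: L2Z.
- by move=> n x nx; rewrite H0// H0'// mulr0 addr0.
- move=> n m; rewrite innerDl//; [|exact: L2Z|exact: (L2_ebox _ (b_gt0 painless n))].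
  by rewrite innerZl//; [rewrite Hc Hc' mulrDl mulrA|exact: (L2_ebox _ (b_gt0 painless n))].
- move=> x; rewrite Hf Hf' /patchwork mulr_sumr -big_split; apply: eq_bigr => n _ /=.
  by rewrite mulrDr mulrCA.
Qed.

Lemma synth_gdual (k : Z * Z) :
  synth (fun m n => ((m, n) == k)%:R) (gdual g b k.1 k.2).
Proof.
case: k => m0 n0 /=; exists (fun n x => (n == n0)%:R * ebox (a n) (b n) m0 x); split.
- by move=> n; apply: L2Z; exact: (L2_ebox _ (b_gt0 painless n)).
- by move=> n x nx; rewrite ebox_off// mulr0.
- move=> n m; rewrite innerZl ?(inner_ebox _ (b_gt0 painless n))//; try exact: (L2_ebox _ (b_gt0 painless n)).
  + rewrite xpair_eqE andbC (eq_sym m0); case: (n == n0); last by rewrite !mul0r.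
    by case: (m == m0); rewrite ?mul1r ?mul0r.
- move=> x; rewrite (patchworkE d_gt0 painless (A := (n0 |` cells a b Cs x)%fset)).
  + rewrite (big_fsetD1 n0)/= ?fset1U1// big_seq big1 ?addr0.
      rewrite eqxx mul1r /gdual /ebox.
      have [wx|nw] := pselect (wbox n0 x); last by rewrite (g_off painless nw) mul0r !mul0r.
      by rewrite indicE mem_set//= mul1r.
    by move=> n; rewrite !inE => /andP[/negbTE -> _]; rewrite mul0r mulr0.
  + by move=> n nc; rewrite (g_off_cube painless nc) !mul0r.
  + by move=> n cn; rewrite !inE; apply/orP; right; exact/(cellsP d_gt0 painless).
Qed.

Definition psum (c : Z -> Z -> C) (s : seq (Z * Z)) (x : E) : C :=
  \sum_(k <- s) c k.1 k.2 * gdual g b k.1 k.2 x.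

Lemma synth_psum c (s : seq (Z * Z)) :
  synth (fun m n => \sum_(k <- s) c k.1 k.2 * ((m, n) == k)%:R) (psum c s).
Proof.
rewrite /psum; elim: s => [|k s IH].
  by have := synth0; congr synth; [apply/funext => m; apply/funext => n|apply/funext => x]; rewrite big_nil.
have := synth_linear (c k.1 k.2) (synth_gdual k) IH.
by congr synth; [apply/funext => m; apply/funext => n|apply/funext => x]; rewrite big_cons.
Qed.

(** By linearity, since a dual atom is synthesized from a unit coefficient. *)
Lemma synth_rest c f (F : {fset Z * Z}) : synth c f ->
  synth (fun m n => if (m, n) \in F then 0 else c m n) (fun x => f x - psum c F x).
Proof.
move=> cf; have := synth_linear (-1) (synth_psum c F) cf.
congr synth; last by apply/funext => x; rewrite mulN1r addrC.
apply/funext => m; apply/funext => n; rewrite mulN1r addrC; case: ifPn => mF.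
  rewrite (big_fsetD1 (m, n))//= eqxx mulr1 big_seq big1 ?addr0 ?subrr// => k.
  by rewrite !inE => /andP[/negbTE + _]; rewrite eq_sym => ->; rewrite mulr0.
rewrite big_seq big1 ?subr0// => k kF; case: eqP => [e|_]; last by rewrite mulr0.
by rewrite e kF in mF.
Qed.

Lemma synth_coef_le c (H : E -> C) n : L2 H -> (forall x, ~ wbox n x -> H x = 0) ->
  (forall m, inner H (ebox (a n) (b n) m) = c m n * ((b n)^-1 ^+ d)%:C) ->
  (sqn H <= ((b n)^-1 ^+ d)%:E * sqc c n)%E.
Proof.
move=> LH H0 Hc; set V := (b n)^-1 ^+ d.
have V0 : 0 < V by rewrite exprn_gt0// (bV_gt0 painless).
rewrite -(@lee_pmul2l _ V%:E) ?lte_fin//.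
have := parseval (b_gt0 painless n) LH H0; rewrite -/V => <-.
have := @esumZ_le _ _ (fun m => (cabs (c m n) ^+ 2)%:E) (V ^+ 2) (sqr_ge0 _).
move=> /(_ (fun m => _)); rewrite muleA -EFinM -expr2 => h.
apply: le_trans (h _); last by move=> m; rewrite lee_fin sqr_ge0.
apply: le_esum => m _; rewrite Hc cabsM cabs_real gtr0_norm// exprMn mulrC EFinM.
exact: lexx.
Qed.

(** On I_n only the neighbours j contribute to f, and |g_j / G|^2 <= (B / A^2)
    b_j^d compensates for the factor b_j^-d in the squared norm of H_j. *)
Lemma synth_local : exists kappa : R, 0 <= kappa /\ forall c f, synth c f ->
  cmeasurable f /\ forall n, L2 (lpsi n f) /\
    (sqn (lpsi n f) <= kappa%:E * \sum_(j <- nb n) sqc c j)%E.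
Proof.
have [A [B [A0 AB]]] := frame_window d_gt0 painless.
have [n0 Hn0] := card_nb painless.
have B0 : 0 <= B by have /andP[h1 h2] := AB 0; apply: le_trans (ltW A0) (le_trans h1 h2).
exists (n0%:R * (B / A ^+ 2)); split; first by rewrite !mulr_ge0// invr_ge0 sqr_ge0.
move=> c f [H [LH H0 Hc Hf]].
have mf : cmeasurable f.
  have -> : f = patchwork a b Cs (fun n => gd n (H n)) by apply/funext.
  apply: (cmeasurable_patchwork d_gt0 painless) => [n|n x nc]; last first.
    by rewrite (g_off_cube painless nc) !mul0r.
  apply: cmeasurableM; last by have [] := LH n.
  apply: cmeasurable_real; apply: measurable_funM; first exact: (g_measurable painless).
  have -> : (fun x => (G x)^-1) = (fun x => powR (G x) (-1)).
    by apply/funext => x; rewrite powR_inv1//; have /andP[GA _] := AB x; exact: le_trans (ltW A0) GA.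
  apply: (measurableT_comp (measurable_powR (-1))); exact: (Gfun_measurable d_gt0 painless).
split => // n; pose k j := n0%:R * (B / A ^+ 2) * b j ^+ d.
have k0 j : 0 <= k j.
  by rewrite !mulr_ge0// ?invr_ge0 ?sqr_ge0// exprn_ge0// ltW// (b_gt0 painless).
have bound : (sqn (lpsi n f) <= \sum_(j <- nb n) (k j)%:E * sqn (H j))%E.
  have mH j : measurable_fun setT (fun x => ((k j)%:E * (cabs (H j x) ^+ 2)%:E)%E).
    by apply: measurable_funeM; apply: emeasurable_cabs2; have [] := LH j.
  have nH j x : (0 <= (k j)%:E * (cabs (H j x) ^+ 2)%:E)%E by rewrite -EFinM lee_fin mulr_ge0// sqr_ge0.
  rewrite (eq_bigr (fun j => \int[mu]_x ((k j)%:E * (cabs (H j x) ^+ 2)%:E))%E); last first.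
    move=> j _; rewrite ge0_integralZl_EFin//; first by move=> x _; rewrite lee_fin sqr_ge0.
    by apply: emeasurable_cabs2; have [] := LH j.
  rewrite -ge0_integral_sum//.
  apply: ge0_le_integral => //.
  - by move=> x _; rewrite lee_fin sqr_ge0.
  - by apply: emeasurable_cabs2; exact: (cmeasurable_psi bapu).
  - exact: emeasurable_sum.
  move=> x _; under eq_bigr do rewrite -EFinM; rewrite sumEFin lee_fin.
  have [cx|nc] := pselect (cube n x); last first.
    by rewrite (psi_off bapu nc) mul0r cabs0 expr0n sumr_ge0// => j _; rewrite mulr_ge0// sqr_ge0.
  apply: (@le_trans _ _ (cabs (f x) ^+ 2)).
    by rewrite lerXn2r ?nnegrE ?cabs_ge0// (cabs_psi_le d_gt0 painless bapu).
  rewrite Hf (patchworkE d_gt0 painless (A := nb n)); last 2 first.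
  - by move=> j nc; rewrite (g_off_cube painless nc) !mul0r.
  - by move=> j cj; exact: (cube_nb painless cx cj).
  apply: le_trans (cabs_sum_sq _ _) _.
  rewrite mulr_sumr; apply: ler_sum => j _; rewrite cabsM exprMn.
  have -> : k j * cabs (H j x) ^+ 2 = n0%:R * (B / A ^+ 2 * b j ^+ d * cabs (H j x) ^+ 2).
    by rewrite /k !mulrA.
  have /andP[GA GB] := AB x; have G0 : 0 < G x by apply: lt_le_trans GA.
  apply: ler_pM => //.
  - by rewrite mulr_ge0 ?sqr_ge0.
  - by rewrite ler_nat.
  rewrite ler_wpM2r ?sqr_ge0// cabs_real normrM exprMn [leRHS]mulrAC.
  apply: ler_pM; rewrite ?sqr_ge0//.
    by apply: (g_sq_le d_gt0 painless) => y; have /andP[] := AB y.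
  rewrite normrV ?unitfE ?gt_eqF// gtr0_norm// exprVn lef_pV2 ?posrE ?exprn_gt0//.
  by rewrite lerXn2r ?nnegrE// ltW.
split.
  split; first exact: (cmeasurable_psi bapu).
  apply: le_lt_trans bound _; apply: lte_sum_pinfty => j _.
  by apply: lte_mul_pinfty; rewrite ?lee_fin//; have [] := LH j.
apply: le_trans bound _; rewrite ge0_sume_distrr; last by move=> j _; exact: sqc_ge0.
apply: lee_sum => j _.
apply: (@le_trans _ _ ((k j)%:E * (((b j)^-1 ^+ d)%:E * sqc c j))%E).
  apply: lee_wpmul2l; first by rewrite lee_fin.
  by apply: synth_coef_le => //; exact: H0.
rewrite muleA -EFinM /k -(mulrA _ (b j ^+ d)) exprVn divff ?mulr1// expf_neq0// gt_eqF//.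
exact: (b_gt0 painless).
Qed.

End synthesis.

(** * Analysis *)

Section analysis.
Variables (R : realType) (d : nat).
Local Notation E := 'rV[R]_d.
Local Notation Z := 'rV[int]_d.
Local Notation mu := (rV_lebesgue R d).
Local Notation C := R[i].
Local Notation cabs := (@Normc.normc R).
Variables (g : Z -> E -> R) (a : Z -> E) (b : Z -> R) (Cs : R).
Hypothesis (d_gt0 : (0 < d)%N) (painless : painless_NSGF g a b Cs).
Variable psi : Z -> E -> R.
Hypothesis bapu : BAPU a b Cs psi.
Local Notation cube := (cube a b Cs).
Local Notation wbox := (wbox a b).
Local Notation G := (Gfun g b).
Local Notation wg n f := (fun x => (g n x)%:C * f x).
Local Notation lpsi n f := (fun x => (psi n x)%:C * f x).
Local Notation nb := (nb a b Cs).
Local Notation locL2 := (locL2 psi).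
Local Notation synth := (synth g a b Cs).

Definition gcoef (f : E -> C) (m n : Z) : C := inner f (gmod g b m n).

(** The window satisfies |g_n|^2 <= B b_n^d and vanishes outside of I_n. *)
Lemma sqn_wg : exists kappa : R, 0 <= kappa /\ forall f, locL2 f -> forall n,
  L2 (wg n f) /\
  (sqn (wg n f) <= (kappa * b n ^+ d)%:E * \sum_(j <- nb n) sqn (lpsi j f))%E.
Proof.
have [A [B [A0 AB]]] := frame_window d_gt0 painless.
have [n0 Hn0] := card_nb painless.
have B0 : 0 <= B by have /andP[h1 h2] := AB 0; apply: le_trans (ltW A0) (le_trans h1 h2).
exists (B * n0%:R); split; first by rewrite mulr_ge0.
move=> f [mf Lf] n; set S := (\sum_(j <- nb n) sqn (lpsi j f))%E.
have S0 : (0 <= S)%E by apply: sume_ge0 => j _; exact: sqn_ge0.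
have Soo : (S < +oo)%E by apply: lte_sum_pinfty => j _; have [] := Lf j.
have bd0 : 0 <= b n ^+ d by rewrite exprn_ge0// ltW// (b_gt0 painless).
have mc : cmeasurable (fun x => (\1_(cube n) x)%:C * f x).
  apply: cmeasurableM => //; apply: cmeasurable_real; apply: measurable_indic.
  exact: measurable_cube.
have mw : cmeasurable (wg n f).
  by apply: cmeasurableM => //; apply: cmeasurable_real; exact: (g_measurable painless).
have h : (sqn (wg n f) <= (B * n0%:R * b n ^+ d)%:E * S)%E.
  apply: (@le_trans _ _ ((B * b n ^+ d)%:E * sqn (fun x => (\1_(cube n) x)%:C * f x)%R)%E).
    rewrite /sqn -ge0_integralZl_EFin//; last 3 first.
    - by move=> x _; rewrite lee_fin sqr_ge0.
    - exact: emeasurable_cabs2.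
    - by rewrite mulr_ge0.
    apply: ge0_le_integral => //.
    - by move=> x _; rewrite lee_fin sqr_ge0.
    - exact: emeasurable_cabs2.
    - by apply: measurable_funeM; exact: emeasurable_cabs2.
    move=> x _; rewrite -EFinM lee_fin.
    have [cx|nc] := pselect (cube n x); last first.
      by rewrite (g_off_cube painless nc) mul0r cabs0 expr0n/= mulr_ge0 ?sqr_ge0// mulr_ge0.
    rewrite indicE (mem_set cx) mul1r cabsM exprMn cabs_real; apply: ler_wpM2r; first exact: sqr_ge0.
    by apply: (g_sq_le d_gt0 painless) => y; have /andP[] := AB y.
  rewrite [X in (_ <= X%:E * _)%E]mulrAC [X in (_ <= X * _)%E]EFinM -muleA; apply: lee_wpmul2l.
    by rewrite lee_fin mulr_ge0.
  apply: (@le_trans _ _ (#|` nb n|%:R%:E * S)%E); first exact: (sqn_cube_le painless bapu n mf).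
  by apply: lee_wpmul2r => //; rewrite lee_fin ler_nat.
split => //; split => //; apply: le_lt_trans h _.
by apply: lte_mul_pinfty => //; rewrite lee_fin !mulr_ge0.
Qed.

(** By Parseval's identity the n-th block of coefficients has squared norm
    b_n^-d ||g_n f||^2. *)
Lemma sqc_gcoef : exists kappa : R, 0 <= kappa /\ forall f, locL2 f -> forall n,
  (sqc (gcoef f) n <= kappa%:E * \sum_(j <- nb n) sqn (lpsi j f))%E.
Proof.
have [kappa [k0 H]] := sqn_wg; exists kappa; split => // f Lf n.
have [Lw hw] := H f Lf n.
rewrite /sqc (gmod_parseval painless Lw).
apply: le_trans (lee_wpmul2l _ hw) _.
  by rewrite lee_fin exprn_ge0// ltW// (bV_gt0 painless).
rewrite muleA -EFinM mulrCA exprVn mulVf ?mulr1//.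
by rewrite expf_neq0// gt_eqF// (b_gt0 painless).
Qed.

(** The function with the coefficients b_n^-d <f, g_(m,n)> on the box of g_n
    is H_n = b_n^-d g_n f, and sum_n (g_n / G) H_n = f by the definition of G. *)
Lemma synth_gcoef f : locL2 f -> synth (gcoef f) f.
Proof.
move=> Lf; have [kappa [k0 H]] := sqn_wg.
have [A [B [A0 AB]]] := frame_window d_gt0 painless.
exists (fun n x => ((b n)^-1 ^+ d)%:C * (wg n f x)); split.
- by move=> n; apply: L2Z; have [] := H f Lf n.
- by move=> n x nw; rewrite (g_off painless nw) mul0r mulr0.
- move=> n m; rewrite innerZl; last 2 first.
  + by have [] := H f Lf n.
  + exact: (L2_ebox _ (b_gt0 painless n)).
  by rewrite mulrC /gcoef (inner_gmod painless).
- move=> x; have G0 : G x != 0 by have /andP[GA _] := AB x; rewrite gt_eqF// (lt_le_trans A0 GA).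
  rewrite /patchwork.
  have -> : \sum_(n <- cells a b Cs x) (g n x / G x)%:C * (((b n)^-1 ^+ d)%:C * wg n f x) =
      (\sum_(n <- cells a b Cs x) (b n ^- d * `|g n x| ^+ 2) / G x)%:C * f x.
    rewrite rmorph_sum mulr_suml; apply: eq_bigr => n _.
    rewrite mulrA mulrA -!rmorphM/=; congr (_%:C * _).
    rewrite real_normK ?num_real// exprVn; set w := b n ^- d.
    by field.
  rewrite -mulr_suml (_ : \sum_(n <- _) _ = G x) ?divff ?mul1r//.
  rewrite (GfunE painless (A := cells a b Cs x))// => n cn.
  exact/(cellsP d_gt0 painless).
Qed.

End analysis.

(** * The norms of the decomposition and coefficient spaces *)

Lemma powR_ratio_le (R : realType) (K x y t : R) : 1 <= K -> 0 < x -> 0 < y ->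
  x <= K * y -> y <= K * x -> x `^ t <= K `^ `|t| * y `^ t.
Proof.
move=> K1 x0 y0 xy yx; have K0 : 0 < K by apply: lt_le_trans K1.
have [t0|t0] := leP 0 t.
  rewrite (ger0_norm t0).
  rewrite -powRM; [|exact: ltW..]; apply: ge0_ler_powR => //; rewrite nnegrE ltW//.
  exact: mulr_gt0.
have [u u0 ->] : exists2 u, 0 <= u & t = - u.
  by exists (- t); rewrite ?opprK// oppr_ge0 ltW.
rewrite normrN (ger0_norm u0) !powRN ler_pdivlMr ?powR_gt0// mulrC ler_pdivrMr ?powR_gt0//.
rewrite -powRM; [|exact: ltW..]; apply: ge0_ler_powR => //; rewrite nnegrE ltW//.
exact: mulr_gt0.
Qed.

Section decomposition_norms.
Variables (R : realType) (d : nat).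
Local Notation E := 'rV[R]_d.
Local Notation Z := 'rV[int]_d.
Local Notation mu := (rV_lebesgue R d).
Local Notation C := R[i].
Local Notation cabs := (@Normc.normc R).
Local Notation dist := ((E -> C) -> C).
Variables (g : Z -> E -> R) (a : Z -> E) (b : Z -> R) (Cs : R).
Hypothesis (d_gt0 : (0 < d)%N) (painless : painless_NSGF g a b Cs).
Variable psi : Z -> E -> R.
Hypothesis bapu : BAPU a b Cs psi.
Variables (s q : R).
Hypothesis q_ge1 : 1 <= q.
Local Notation omega := (omega a).
Local Notation lpsi n f := (fun x => (psi n x)%:C * f x).
Local Notation nb := (nb a b Cs).
Local Notation locL2 := (locL2 psi).
Local Notation synth := (synth g a b Cs).

Let q0 : 0 < q. Proof. exact: lt_le_trans q_ge1. Qed.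
Let q20 : 0 < q / 2. Proof. by rewrite divr_gt0. Qed.
Let qV_neq0 : q^-1 != 0. Proof. by rewrite invr_eq0 gt_eqF. Qed.

(** The factor of the n-th block in the q-th power of the norms. *)
Definition wgt (n : Z) : R := (omega n `^ s) `^ q.
Local Notation lq := (lqw wgt (q / 2)).

Lemma wgt_gt0 n : 0 < wgt n.
Proof. by rewrite !powR_gt0// omega_gt0. Qed.

(** The squared L^2 norm of the n-th block of f. *)
Definition sqf (f : E -> C) (n : Z) : \bar R := sqn (lpsi n f).

Lemma sqf_ge0 f n : (0 <= sqf f n)%E. Proof. exact: sqn_ge0. Qed.

Definition agrees (u : dist) (f : E -> C) :=
  locL2 f /\ forall phi, test_function phi -> u phi = dist_of f phi.

Lemma lq_termE n (X : \bar R) : (0 <= X)%E ->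
  (((omega n `^ s)%:E * X `^ 2^-1) `^ q = (wgt n)%:E * X `^ (q / 2))%E.
Proof.
move=> X0; rewrite poweRM ?poweR_ge0 ?lee_fin ?powR_ge0// poweR_EFin; congr (_ * _)%E.
by rewrite -poweRrM mulrC.
Qed.

Lemma DN_agrees u f : agrees u f -> DN a psi 2 q s u = (lq (sqf f) `^ q^-1)%E.
Proof.
move=> [Lf uf]; rewrite /DN /lqN /lqw; congr (_ `^ _)%E; apply: eq_esum => n _.
by rewrite (dist_LpN_psi d_gt0 painless bapu n Lf uf) LpN2E lq_termE// sqf_ge0.
Qed.

Lemma dN_sqc (c : Z -> Z -> C) : dN a 2 q s c = (lq (sqc c) `^ q^-1)%E.
Proof.
rewrite /dN /lqN /lqw; congr (_ `^ _)%E; apply: eq_esum => n _.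
rewrite -lq_termE ?sqc_ge0//; congr ((_ * _ `^ _) `^ _)%E.
apply: eq_esum => m _; rewrite poweR_EFin; congr EFin.
by rewrite powR_mulrn// cabs_ge0.
Qed.

Lemma lq_root_lty (X : Z -> \bar R) : (lq X `^ q^-1 < +oo)%E <-> (lq X < +oo)%E.
Proof. by split; [exact: lty_poweRy|exact: poweR_lty]. Qed.

Lemma ind_sqc c : ind a 2 q s c <-> (lq (sqc c) < +oo)%E.
Proof. by rewrite /ind dN_sqc; exact: lq_root_lty. Qed.

Lemma wgt_nb : exists L : R, 0 <= L /\ forall n j, j \in nb n -> wgt n <= L * wgt j.
Proof.
have [K [K1 HK]] := omega_nb painless.
exists (K `^ `|s * q|); split; first exact: powR_ge0.
move=> n j jn; rewrite /wgt -!powRrM; apply: powR_ratio_le => //; rewrite ?omega_gt0//.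
- exact: HK.
- by apply: HK; rewrite (nb_sym painless).
Qed.

Lemma lq_nb_le k : 0 <= k -> exists K : R, 0 <= K /\ forall X Y,
  (forall n, 0 <= X n)%E -> (forall n, 0 <= Y n)%E ->
  (forall n, X n <= k%:E * \sum_(j <- nb n) Y j)%E -> (lq X <= K%:E * lq Y)%E.
Proof.
move=> k0; have [L [L0 HL]] := wgt_nb; have [n0 Hn0] := card_nb painless.
exact: (lqw_schur (nb_sym painless) Hn0 wgt_gt0 q20 k0 L0 HL).
Qed.

(** The norm of each block of a weighted l^q family is at most a constant
    times omega_n^-s, hence grows at most like a power of omega_n. *)
Lemma sqf_growth f : (lq (sqf f) < +oo)%E -> exists (M : R) (r : nat), 0 <= M /\
  forall n, (sqf f n <= (M * omega n ^+ r)%:E)%E.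
Proof.
move=> foo; set L := fine (lq (sqf f)).
have L0 : 0 <= L by rewrite /L fine_ge0// lqw_ge0//; exact: wgt_gt0.
pose t := - (s * q) * (q / 2)^-1.
exists (L `^ (q / 2)^-1), (Num.bound `|t|); split; first exact: powR_ge0.
move=> n; apply: le_trans (lqw_term (L := L) wgt_gt0 q20 (sqf_ge0 f n) _) _.
  by rewrite (lqw_fineK wgt_gt0 foo).
rewrite lee_fin powRM//; last by rewrite invr_ge0; apply: ltW; exact: wgt_gt0.
apply: ler_wpM2l; first exact: powR_ge0.
rewrite /wgt -powRrM -powRN -powRrM -/t -powR_mulrn; last by rewrite ltW// omega_gt0.
by rewrite ler_powR ?omega_ge1//; apply: le_trans (ler_norm t) _; apply: ltW; exact: archi_boundP.
Qed.

Lemma tempered_lq f : locL2 f -> (lq (sqf f) < +oo)%E -> tempered (dist_of f).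
Proof.
move=> Lf /sqf_growth[M [r [M0 H]]].
exact: (tempered_dist_of d_gt0 painless bapu Lf M0 H).
Qed.

Lemma lq_schwartz_integrable f phi : locL2 f -> (lq (sqf f) < +oo)%E -> schwartz phi ->
  cintegrable (fun x => f x * phi x).
Proof.
move=> Lf /sqf_growth[M [r [M0 H]]] sp.
by have [k [K /(_ phi sp)[]]] := schwartz_pairing d_gt0 painless bapu Lf M0 H.
Qed.

Lemma agrees_dist_of f : locL2 f -> agrees (dist_of f) f.
Proof. by []. Qed.

Lemma inD_dist_of f : locL2 f -> (lq (sqf f) < +oo)%E -> inD a psi 2 q s (dist_of f).
Proof.
move=> Lf foo; split; first exact: tempered_lq.
by rewrite (DN_agrees (agrees_dist_of Lf)); apply/lq_root_lty.
Qed.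

(** All the psi_n u have finite L^2 norms, so u has a representative f that
    agrees with it on test functions; the finiteness of the norm makes f
    tempered, and the agreement extends to Schwartz functions. *)
Lemma inD_repr u : inD a psi 2 q s u ->
  [/\ agrees u (L2loc_repr u), (lq (sqf (L2loc_repr u)) < +oo)%E &
      eq_dist u (dist_of (L2loc_repr u))].
Proof.
move=> [tu uoo].
have doo n : (dist_LpN 2 (dist_mul (psi n) u) < +oo)%E.
  have := lty_poweRy qV_neq0 uoo.
  move/(le_lt_trans (esum_ge1 n (fun i => poweR_ge0 _ _))).
  move/(lty_poweRy (lt0r_neq0 q0)); rewrite !ltey; apply: contraNN => /eqP ->.
  by rewrite gt0_muley// lte_fin powR_gt0// omega_gt0.
have [Lf uf] := L2loc_reprP d_gt0 painless bapu tu doo.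
have uf' : agrees u (L2loc_repr u) by [].
have foo : (lq (sqf (L2loc_repr u)) < +oo)%E by apply/lq_root_lty; rewrite -(DN_agrees uf').
split => //; apply: (tempered_test_eq d_gt0 painless bapu tu) => //.
exact: tempered_lq.
Qed.

End decomposition_norms.

(** * The reconstruction operator *)

Section reconstruction.
Variables (R : realType) (d : nat).
Local Notation E := 'rV[R]_d.
Local Notation Z := 'rV[int]_d.
Local Notation mu := (rV_lebesgue R d).
Local Notation C := R[i].
Local Notation cabs := (@Normc.normc R).
Local Notation dist := ((E -> C) -> C).
Variables (g : Z -> E -> R) (a : Z -> E) (b : Z -> R) (Cs : R).
Hypothesis (d_gt0 : (0 < d)%N) (painless : painless_NSGF g a b Cs).
Variable psi : Z -> E -> R.
Hypothesis bapu : BAPU a b Cs psi.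
Variables (s q : R).
Hypothesis q_ge1 : 1 <= q.
Local Notation lpsi n f := (fun x => (psi n x)%:C * f x).
Local Notation locL2 := (locL2 psi).
Local Notation synth := (synth g a b Cs).
Local Notation lq := (lqw (wgt a s q) (q / 2)).
Local Notation sqf := (sqf psi).
Local Notation agrees := (agrees psi).
Local Notation recon := (recon g a b psi 2 q s).
Local Notation expansion := (expansion g a b psi 2 q s).
Local Notation inD := (inD a psi 2 q s).
Local Notation DN := (DN a psi 2 q s).
Local Notation psum := (psum g b).

Let q0 : 0 < q. Proof. exact: lt_le_trans q_ge1. Qed.
Let q20 : 0 < q / 2. Proof. by rewrite divr_gt0. Qed.
Let qV0 : 0 <= q^-1. Proof. by rewrite invr_ge0 ltW. Qed.
Let w0 n : 0 < wgt a s q n. Proof. exact: wgt_gt0. Qed.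

Lemma synth_locL2 c f : synth c f -> locL2 f.
Proof.
have [k [_ H]] := synth_local d_gt0 painless bapu.
by move=> /H[mf Hf]; split => // n; have [] := Hf n.
Qed.

Lemma synth_bounded : exists K : R, 0 <= K /\ forall c f, synth c f ->
  (lq (sqf f) <= K%:E * lq (sqc c))%E.
Proof.
have [k [k0 H]] := synth_local d_gt0 painless bapu.
have [K [K0 HK]] := lq_nb_le painless s q_ge1 k0.
exists K; split => // c f /H[_ Hf]; apply: HK => n.
- exact: sqf_ge0.
- exact: sqc_ge0.
- by have [] := Hf n.
Qed.

Lemma analysis_bounded : exists K : R, 0 <= K /\ forall f, locL2 f ->
  (lq (sqc (gcoef g b f)) <= K%:E * lq (sqf f))%E.
Proof.
have [k [k0 H]] := sqc_gcoef d_gt0 painless bapu.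
have [K [K0 HK]] := lq_nb_le painless s q_ge1 k0.
exists K; split => // f Lf; apply: HK => n.
- exact: sqc_ge0.
- exact: sqf_ge0.
- exact: H.
Qed.

(** A partial sum of the series is a finite combination of dual atoms, so it
    acts on test functions by integration. *)
Lemma agrees_rest u f c (F : {fset Z * Z}) : agrees u f ->
  locL2 (fun x => f x - psum c F x) ->
  agrees (u - partial_sum
    (fun k : Z * Z => dist_scale (c k.1 k.2) (dist_of (gdual g b k.1 k.2))) F)
    (fun x => f x - psum c F x).
Proof.
move=> [Lf uf] Lr; split => // phi tp.
have Lg (k : Z * Z) : locL2 (gdual g b k.1 k.2).
  exact: synth_locL2 (synth_gdual d_gt0 painless k).
have ig k : cintegrable (fun x => c k.1 k.2 * (gdual g b k.1 k.2 x * phi x)).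
  by apply: cintegrableZ; exact: (locL2_test_integrable d_gt0 painless bapu).
have e1 : dist_of (psum c F) phi = \sum_(k <- F) c k.1 k.2 * dist_of (gdual g b k.1 k.2) phi.
  rewrite /dist_of (eq_cint (k := fun x => \sum_(k <- F) c k.1 k.2 * (gdual g b k.1 k.2 x * phi x))).
    rewrite cint_sum//; apply: eq_bigr => k _; rewrite cintZ//.
    exact: (locL2_test_integrable d_gt0 painless bapu).
  by move=> x; rewrite /psum mulr_suml; apply: eq_bigr => k _; rewrite mulrA.
have e2 : dist_of (fun x => f x - psum c F x) phi = dist_of f phi - dist_of (psum c F) phi.
  rewrite /dist_of -cintB.
  - by apply: eq_cint => x; rewrite mulrBl.
  - exact: (locL2_test_integrable d_gt0 painless bapu).
  - have := cintegrable_sum (F : seq (Z * Z)) ig.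
    by congr cintegrable; apply/funext => x; rewrite /psum mulr_suml; apply: eq_bigr => k _; rewrite mulrA.
rewrite e2 e1 -(uf _ tp) /partial_sum.
have -> : (u - \sum_(i : F) dist_scale (c (val i).1 (val i).2) (dist_of (gdual g b (val i).1 (val i).2))) phi
  = u phi - (\sum_(i : F) dist_scale (c (val i).1 (val i).2) (dist_of (gdual g b (val i).1 (val i).2))) phi by [].
congr (_ - _); rewrite fct_sumE [RHS]big_seq_fsetE.
by [].
Qed.

Lemma sqc_rest c (F : {fset Z * Z}) n :
  sqc (fun m n => if (m, n) \in F then 0 else c m n) n =
  (\esum_(m in [set: Z]) if (m, n) \in F then 0 else (cabs (c m n) ^+ 2)%:E)%E.
Proof. by apply: eq_esum => m _; case: ifP => // _; rewrite cabs0 expr0n. Qed.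

Lemma cvg_ge0_small (I : choiceType) (X : {fset I} -> \bar R) : (forall F, 0 <= X F)%E ->
  (X F @[F --> totally] --> 0%E) <->
  (forall e : R, 0 < e -> exists F0, forall F, (F0 `<=` F)%fset -> (X F <= e%:E)%E).
Proof.
move=> X0; split=> [cX e e0|H A [e /= e0 eA]].
  have : nbhs (0%E : \bar R) [set x | (x < e%:E)%E].
    exists e => // r /=; rewrite sub0r normrN => h.
    by rewrite lte_fin; apply: le_lt_trans (ler_norm _) h.
  by move=> /cX[F0 _ HF0]; exists F0 => F /HF0 /ltW.
have [F0 HF0] := H (e / 2) ltac:(by rewrite divr_gt0).
exists F0 => // F /HF0 XF.
have XFfin : X F \is a fin_num by rewrite ge0_fin_numE// (le_lt_trans XF) ?ltry.
rewrite /= -(fineK XFfin); apply: eA => /=.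
rewrite sub0r normrN ger0_norm ?fine_ge0//.
apply: (@le_lt_trans _ _ (e / 2)); first by rewrite -lee_fin fineK.
by lra.
Qed.

Lemma DN_ge0 u : (0 <= DN u)%E.
Proof. exact: poweR_ge0. Qed.

(** The remainder after the terms in F is synthesized from the coefficients
    outside of F, whose norm is small for large F. *)
Lemma synth_expansion u c f : agrees u f -> synth c f -> (lq (sqc c) < +oo)%E ->
  expansion c u.
Proof.
move=> uf cf coo; have [K [K0 HK]] := synth_bounded.
apply/cvg_ge0_small => [F|e e0]; first exact: DN_ge0.
pose e1 := e `^ q / (K + 1).
have K10 : 0 < K + 1 by rewrite ltr_wpDl.
have e10 : 0 < e1 by rewrite divr_gt0// powR_gt0.
have [F0 HF0] := lqw_tail w0 q20
  (fun m n => (sqr_ge0 (cabs (c m n)) : (0 <= (cabs (c m n) ^+ 2)%:E)%E)) coo e10.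
exists F0 => F /HF0 h.
have rest := synth_rest d_gt0 painless F cf.
rewrite (DN_agrees d_gt0 painless bapu s q (agrees_rest uf (synth_locL2 rest))).
have -> : e%:E = ((e `^ q)%:E `^ q^-1)%E.
  by rewrite poweR_EFin -powRrM divff ?gt_eqF// powRr1// ltW.
apply: le_poweR => //; first exact: lqw_ge0.
apply: le_trans (HK _ _ rest) _.
have -> : lq (sqc (fun m n => if (m, n) \in F then 0 else c m n)) =
  lq (fun n => \esum_(m in [set: Z]) if (m, n) \in F then 0 else (cabs (c m n) ^+ 2)%:E)%E.
  by congr lqw; apply/funext => n; exact: sqc_rest.
apply: le_trans (lee_wpmul2l _ h) _; first by rewrite lee_fin.
rewrite -EFinM lee_fin /e1 mulrCA ger_pMr ?powR_gt0// ler_pdivrMr// mul1r.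
by rewrite lerDl.
Qed.

(** For every n and e the representatives f, f' of u and v are both within e
    of a common partial sum, in the squared norm of the n-th block; so psi_n
    (f - f') = 0 almost everywhere, for all n. *)
Lemma expansion_unique u v c : inD u -> inD v -> expansion c u -> expansion c v ->
  eq_dist u v.
Proof.
move=> uD vD eu ev.
have [uf foo _] := inD_repr d_gt0 painless bapu q_ge1 uD.
have [vf' foo' _] := inD_repr d_gt0 painless bapu q_ge1 vD.
set f := L2loc_repr u in uf foo; set f' := L2loc_repr v in vf' foo'.
have Lf := uf.1; have Lf' := vf'.1.
have Lp F : locL2 (psum c F) := synth_locL2 (synth_psum d_gt0 painless c F).
have LB (h h' : E -> C) : locL2 h -> locL2 h' -> locL2 (fun x => h x - h' x).
  move=> Lh Lh'; have := locL2D Lh (locL2Z (-1) Lh').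
  by congr (locL2 _); apply/funext => x; rewrite mulN1r.
have small (w : dist) (h : E -> C) : agrees w h -> expansion c w -> forall (n : Z) (e : R), 0 < e ->
    exists F0 : {fset Z * Z}, forall F, (F0 `<=` F)%fset ->
    (sqf (fun x => h x - psum c F x)%R n <= e%:E)%E.
  move=> wh ew n e e0.
  pose L := e `^ (q / 2) * wgt a s q n.
  have L0 : 0 < L by rewrite mulr_gt0 ?w0// powR_gt0.
  have [F0 HF0] := (cvg_ge0_small (fun F => DN_ge0 _)).1 ew (L `^ q^-1) ltac:(by rewrite powR_gt0).
  exists F0 => F /HF0.
  rewrite (DN_agrees d_gt0 painless bapu s q (agrees_rest wh (LB _ _ wh.1 (Lp F)))).
  move/(@le_poweR _ q _ _ (ltW q0) (poweR_ge0 _ _)).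
  rewrite poweR_EFin -poweRrM -powRrM mulVf ?gt_eqF// powRr1 ?(ltW L0)// poweRe1; last exact: lqw_ge0.
  move/(lqw_term w0 q20 (sqf_ge0 psi _ n)); rewrite mulfK ?gt_eqF// -powRrM divff ?gt_eqF//.
  by rewrite powRr1// ltW.
have zero n : sqf (fun x => f x - f' x) n = 0%E.
  apply/eqP; rewrite eq_le sqf_ge0 andbT; apply/lee_addgt0Pr => e e0.
  have [F1 H1] := small u f uf eu n (e / 4) ltac:(by rewrite divr_gt0).
  have [F2 H2] := small v f' vf' ev n (e / 4) ltac:(by rewrite divr_gt0).
  pose F := (F1 `|` F2)%fset.
  have {}H1 := H1 F (fsubsetUl _ _); have {}H2 := H2 F (fsubsetUr _ _).
  rewrite add0e; set h1 := (fun x => f x - psum c F x) in H1; set h2 := (fun x => f' x - psum c F x) in H2.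
  have [_ L1] : locL2 h1 by exact: LB.
  have [_ L2_] : locL2 h2 by exact: LB.
  have m1 := emeasurable_cabs2 (L1 n).1; have m2 := emeasurable_cabs2 (L2_ n).1.
  apply: (@le_trans _ _ (2%:E * sqf h1 n + 2%:E * sqf h2 n)%E).
    rewrite /sqf /sqn -!ge0_integralZl_EFin//; try by move=> x _; rewrite lee_fin sqr_ge0.
    rewrite -ge0_integralD//; first apply: ge0_le_integral => //.
    + by move=> x _; rewrite lee_fin sqr_ge0.
    + apply: emeasurable_cabs2; apply: (cmeasurable_psi bapu); exact: (LB _ _ Lf Lf').1.
    + by apply: emeasurable_funD; exact: measurable_funeM.
    + move=> x _; rewrite -!EFinM -EFinD lee_fin.
      have -> : (psi n x)%:C * (f x - f' x) = (psi n x)%:C * h1 x + - ((psi n x)%:C * h2 x).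
        by rewrite /h1 /h2 -mulrN -mulrDr opprB addrA subrK.
      have := cabsD ((psi n x)%:C * h1 x) (- ((psi n x)%:C * h2 x)); rewrite cabsN.
      have := cabs_ge0 ((psi n x)%:C * h1 x + - ((psi n x)%:C * h2 x)).
      set p := cabs _; set p1 := cabs _; set p2 := cabs _ => p0 pp.
      by have := sqr_ge0 (p1 - p2); nra.
    + by move=> x _; rewrite mule_ge0// lee_fin sqr_ge0.
    + exact: measurable_funeM.
    + by move=> x _; rewrite mule_ge0// lee_fin sqr_ge0.
    + exact: measurable_funeM.
  apply: le_trans (leeD (lee_wpmul2l _ H1) (lee_wpmul2l _ H2)) _ => //.
  by rewrite -!EFinM -EFinD lee_fin; lra.
have ff' : {ae mu, forall x, f x = f' x}.
  have : {ae mu, forall x, forall n, (psi n x)%:C * (f x - f' x) = 0}.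
    apply: ae_forall_countable => n.
    have mn := emeasurable_cabs2 (cmeasurable_psi bapu n (LB _ _ Lf Lf').1).
    have : \forall x \ae mu, setT x -> (cabs ((psi n x)%:C * (f x - f' x)) ^+ 2)%:E = 0%E.
      apply: (ae_eq_integral_abs mu measurableT mn).1; rewrite -[RHS](zero n).
      by apply: eq_integral => x _; rewrite gee0_abs// lee_fin sqr_ge0.
    apply: filterS => x /(_ I)[] /eqP; rewrite sqrf_eq0 => /eqP; exact: cabs_eq0.
  apply: filterS => x Hx; have [n pn] := psi_pos d_gt0 painless bapu x.
  have /eqP := Hx n; rewrite mulf_eq0 => /orP[/eqP/(congr1 (@complex.Re R))/= e|].
    by rewrite e ltxx in pn.
  by rewrite subr_eq0 => /eqP.
apply: (tempered_test_eq d_gt0 painless bapu uD.1 vD.1) => phi tp.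
rewrite (uf.2 _ tp) (vf'.2 _ tp); apply: ae_eq_cint.
- by apply: cmeasurableM; [exact: Lf.1|exact: csmooth_cmeasurable tp.1].
- by apply: cmeasurableM; [exact: Lf'.1|exact: csmooth_cmeasurable tp.1].
- by apply: filterS ff' => x ->.
Qed.

Lemma synth_inD c : ind a 2 q s c -> exists f, [/\ synth c f, locL2 f,
  (lq (sqf f) < +oo)%E & inD (dist_of f)].
Proof.
move=> /(ind_sqc _ _ q_ge1) coo.
have [f cf] : exists f, synth c f.
  apply: (synth_exists painless) => n.
  exact: lqw_term_lty w0 q20 (sqc_ge0 _ _) coo.
have Lf := synth_locL2 cf.
have foo : (lq (sqf f) < +oo)%E.
  have [K [K0 /(_ _ _ cf) h]] := synth_bounded; apply: le_lt_trans h _.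
  by apply: lte_mul_pinfty; rewrite ?lee_fin// ?ltry.
by exists f; split => //; exact: (inD_dist_of d_gt0 painless bapu q_ge1 Lf foo).
Qed.

Lemma reconP c : ind a 2 q s c -> inD (recon c) /\ expansion c (recon c).
Proof.
move=> cD; have [f [cf Lf _ fD]] := synth_inD cD.
suff : exists u, [set u | inD u /\ expansion c u] u by move/(xgetPex (fun=> 0)).
exists (dist_of f); split => //; apply: synth_expansion (agrees_dist_of Lf) cf _.
exact/(ind_sqc _ _ q_ge1).
Qed.

Lemma recon_eq c f : ind a 2 q s c -> synth c f -> eq_dist (recon c) (dist_of f).
Proof.
move=> cD cf; have [rD re] := reconP cD; have Lf := synth_locL2 cf.
have coo := (ind_sqc _ _ q_ge1 c).1 cD.
apply: (expansion_unique rD _ re); last exact: synth_expansion (agrees_dist_of Lf) cf coo.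
apply: (inD_dist_of d_gt0 painless bapu q_ge1 Lf).
have [K [K0 /(_ _ _ cf) h]] := synth_bounded; apply: le_lt_trans h _.
by apply: lte_mul_pinfty; rewrite ?lee_fin// ?ltry.
Qed.

Lemma ind_linear z c c' : ind a 2 q s c -> ind a 2 q s c' ->
  ind a 2 q s (fun m n => z * c m n + c' m n).
Proof.
move=> /(ind_sqc _ _ q_ge1) coo /(ind_sqc _ _ q_ge1) coo'; apply/(ind_sqc _ _ q_ge1).
have z0 : 0 <= 2 * cabs z ^+ 2 by rewrite mulr_ge0// sqr_ge0.
have lt_lqwZ k e : 0 <= k -> (lq (sqc e) < +oo)%E -> (lq (fun n => k%:E * sqc e n)%E < +oo)%E.
  move=> k0 eoo; apply: le_lt_trans (lqwZ (q / 2) w0 k0 (sqc_ge0 e)) _.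
  by apply: lte_mul_pinfty; rewrite ?lee_fin ?powR_ge0.
have mge0 (k : R) (e : Z -> Z -> C) n : 0 <= k -> (0 <= k%:E * sqc e n)%E.
  by move=> k0; rewrite mule_ge0 ?sqc_ge0// lee_fin.
have := lqwD w0 q20 (fun n => mge0 _ c n z0) (fun n => mge0 2 c' n ltac:(by []))
  (lt_lqwZ _ _ z0 coo) (lt_lqwZ 2 _ ltac:(by []) coo').
apply: le_lt_trans; apply: le_lqw => //; first exact: ltW.
move=> n; rewrite sqc_ge0/=.
apply: le_trans (leeD (esumZ_le z0 _) (esumZ_le _ _)) => //;
  try by move=> m; rewrite lee_fin sqr_ge0.
rewrite -esumD; try by move=> m _; rewrite -EFinM lee_fin mulr_ge0// sqr_ge0.
apply: le_esum => m _; rewrite -!EFinM -EFinD lee_fin.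
have := cabsD (z * c m n) (c' m n); have := cabs_ge0 (z * c m n + c' m n).
rewrite cabsM; set p := cabs (_ + _); set p1 := cabs z; set p2 := cabs _; set p3 := cabs _.
by move=> h0 h; have := sqr_ge0 (p1 * p2 - p3); nra.
Qed.

Lemma recon_linear z c c' : ind a 2 q s c -> ind a 2 q s c' ->
  eq_dist (recon (fun m n => z * c m n + c' m n))
          (fun phi => z * recon c phi + recon c' phi).
Proof.
move=> cD cD' phi sp.
have [f [cf Lf foo fD]] := synth_inD cD; have [f' [cf' Lf' foo' fD']] := synth_inD cD'.
rewrite (recon_eq (ind_linear z cD cD') (synth_linear painless z cf cf') sp).
rewrite (recon_eq cD cf sp) (recon_eq cD' cf' sp).
have i1 := lq_schwartz_integrable d_gt0 painless bapu q_ge1 Lf foo sp.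
have i2 := lq_schwartz_integrable d_gt0 painless bapu q_ge1 Lf' foo' sp.
rewrite /dist_of -cintZ// -cintD//; last exact: cintegrableZ.
by apply: eq_cint => x; rewrite mulrDl mulrA.
Qed.

Lemma agrees_recon c f : ind a 2 q s c -> synth c f -> agrees (recon c) f.
Proof.
move=> cD cf; split=> [|phi tp]; first exact: synth_locL2 cf.
by apply: (recon_eq cD cf); exact: test_schwartz.
Qed.

Lemma recon_bounded : exists K : R, forall c, ind a 2 q s c ->
  (DN (recon c) <= K%:E * dN a 2 q s c)%E.
Proof.
have [K [K0 HK]] := synth_bounded; exists (K `^ q^-1) => c cD.
have [f [cf _ _ _]] := synth_inD cD.
rewrite (DN_agrees d_gt0 painless bapu s q (agrees_recon cD cf)) dN_sqc.
rewrite -poweR_EFin -poweRM ?lqw_ge0//; apply: le_poweR => //; first exact: lqw_ge0.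
exact: HK.
Qed.

Lemma coef_ind u : inD u -> ind a 2 q s (coef g b u).
Proof.
move=> /(inD_repr d_gt0 painless bapu q_ge1)[[Lf _] foo _].
apply/(ind_sqc _ _ q_ge1); have [K [K0 /(_ _ Lf) h]] := analysis_bounded.
by apply: le_lt_trans h _; apply: lte_mul_pinfty; rewrite ?lee_fin// ?lqw_ge0.
Qed.

Lemma coef_synth u : inD u -> synth (coef g b u) (L2loc_repr u).
Proof.
move=> /(inD_repr d_gt0 painless bapu q_ge1)[[Lf _] _ _].
exact: (synth_gcoef d_gt0 painless bapu Lf).
Qed.

Lemma recon_coef u : inD u -> eq_dist (recon (coef g b u)) u.
Proof.
move=> uD phi sp; rewrite (recon_eq (coef_ind uD) (coef_synth uD) sp).
by have [_ _ ->] := inD_repr d_gt0 painless bapu q_ge1 uD.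
Qed.

Lemma expansion_coef u : inD u -> expansion (coef g b u) u.
Proof.
move=> uD; have [uf _ _] := inD_repr d_gt0 painless bapu q_ge1 uD.
apply: synth_expansion uf (coef_synth uD) _.
exact: ((ind_sqc _ _ q_ge1 _).1 (coef_ind uD)).
Qed.

End reconstruction.

Theorem proposition4p1 (R : realType) (d : nat) (d_gt0 : (0 < d)%N)
    (g : 'rV[int]_d -> 'rV[R]_d -> R) (a : 'rV[int]_d -> 'rV[R]_d)
    (b : 'rV[int]_d -> R) (Cs : R)
    (g_painless : painless_NSGF g a b Cs)
    (psi : 'rV[int]_d -> 'rV[R]_d -> R) (psi_BAPU : BAPU a b Cs psi)
    (s q : R) (q_ge1 : 1 <= q) :
  (* R is a bounded linear operator from d(Q, l^2, l^q) into D(Q, L^2, l^q) *)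
  [/\ forall c, ind a 2 q s c ->
        inD a psi 2 q s (recon g a b psi 2 q s c) /\
        expansion g a b psi 2 q s c (recon g a b psi 2 q s c),
      forall (z : R[i]) c c', ind a 2 q s c -> ind a 2 q s c' ->
        eq_dist (recon g a b psi 2 q s (fun m n => z * c m n + c' m n))
                (fun phi => z * recon g a b psi 2 q s c phi +
                            recon g a b psi 2 q s c' phi) &
      exists K : R, forall c, ind a 2 q s c ->
        (DN a psi 2 q s (recon g a b psi 2 q s c) <= K%:E * dN a 2 q s c)%E]
  /\
  (* R is onto *)
  (forall f, inD a psi 2 q s f ->
     exists2 c, ind a 2 q s c & eq_dist (recon g a b psi 2 q s c) f)
  /\
  (* f = R C f, with unconditional convergence *)
  (forall f, inD a psi 2 q s f ->
     [/\ ind a 2 q s (coef g b f),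
         eq_dist (recon g a b psi 2 q s (coef g b f)) f &
         expansion g a b psi 2 q s (coef g b f) f]).
Proof.
split; [split|split].
- by move=> c cD; exact: (reconP d_gt0 g_painless psi_BAPU q_ge1 cD).
- by move=> z c c' cD cD'; exact: (recon_linear d_gt0 g_painless psi_BAPU q_ge1 z cD cD').
- exact: (recon_bounded d_gt0 g_painless psi_BAPU s q_ge1).
- move=> f fD; exists (coef g b f).
    exact: (coef_ind d_gt0 g_painless psi_BAPU q_ge1 fD).
  exact: (recon_coef d_gt0 g_painless psi_BAPU q_ge1 fD).
- move=> f fD; split.
  + exact: (coef_ind d_gt0 g_painless psi_BAPU q_ge1 fD).
  + exact: (recon_coef d_gt0 g_painless psi_BAPU q_ge1 fD).
  + exact: (expansion_coef d_gt0 g_painless psi_BAPU q_ge1 fD).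
Qed.
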